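(* Let $n \geq 2$ and $p,q \geq 0$ be integers. Then $$\boldsymbol{\lambda}\big(\mathcal{H}_{p,q}(\mathbb{S}^{n-1})\big) = c(p,q,n) \int_{0}^{1} (1-t)^{n-2}\, t^{\frac{|p-q|}{2}} \,\big| P_{p\wedge q}^{n-2,|p-q|}(2t -1)\big|\, dt,$$ where $$c(p,q,n) = (n+p+q-1)\,\frac{\Gamma(n+ p \vee q -1)}{ \Gamma(n-1)\, \Gamma(1+ p \vee q)},$$ and $P_{p\wedge q}^{n-2,|p-q|}$ stands for the Jacobi polynomial of degree $p\wedge q$. Equivalently, $$\boldsymbol{\lambda}\big(\mathcal{H}_{p,q}(\mathbb{S}^{n-1})\big) = \frac{c(p,q,n)}{2^{n + \frac{|p-q|}{2}}} \int_{-1}^{1} (1-s)^{n-2} (1+s)^{\frac{|p-q|}{2}} \,\big| P_{p\wedge q}^{n-2,|p-q|}(s)\big|\, ds.$$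
   Context: Notation: $p\wedge q=\min\{p,q\}$, $p\vee q=\max\{p,q\}$; $\mathbb{S}^{n-1}=\{z\in\mathbb{C}^n:\|z\|_2=1\}$ is the complex Euclidean sphere. $\mathcal{H}_{p,q}(\mathbb{C}^n)$ is the space of functions $f(z)=\sum_{|\alpha|=p,|\beta|=q}c_{(\alpha,\beta)}z^\alpha\overline{z}^\beta$ on $\mathbb{C}^n$ ($\alpha,\beta\in\mathbb{N}_0^n$, $c_{(\alpha,\beta)}\in\mathbb{C}$) with $\Delta f=0$, where $\Delta=\sum_{j=1}^n\frac{\partial^2}{\partial z_j\partial\overline{z_j}}$. $\mathcal{H}_{p,q}(\mathbb{S}^{n-1})$ is the space of restrictions of these functions to $\mathbb{S}^{n-1}$, with the supremum norm (a subspace of $C(\mathbb{S}^{n-1})$, complex-valued functions). For a Banach space $Y$ and a closed complemented subspace $X\subset Y$, $\boldsymbol{\lambda}(X,Y)$ is the infimum of the norms of all bounded linear projections from $Y$ onto $X$. The (absolute) projection constant of a Banach space $X$ is $\boldsymbol{\lambda}(X)=\sup\boldsymbol{\lambda}(I(X),Y)$, the supremum over all Banach spaces $Y$ and isometric embeddings $I:X\to Y$. If $X$ is a finite-dimensional subspace of $C(K)$, then $\boldsymbol{\lambda}(X)=\boldsymbol{\lambda}(X,C(K))$. For $\alpha,\beta>-1$ and $d\in\mathbb{N}_0$, the Jacobi polynomial of degree $d$ is $$P_d^{\alpha,\beta}(t)=\frac{(-1)^d}{2^d d!}(1-t)^{-\alpha}(1+t)^{-\beta}\Big(\frac{d}{dt}\Big)^d\big[(1-t)^{\alpha+d}(1+t)^{\beta+d}\big],$$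 so that $P_d^{\alpha,\beta}(1)=\binom{d+\alpha}{d}$.
   Formalization: In the second formula the power of 2 in the denominator is 2^{n-1+|p-q|/2} instead of the printed 2^{n+|p-q|/2}, which is off by a factor 2: for p=q=0 the projection constant is 1, but the printed right-hand side is 1/2. *)

(* Defs.v *)
From HB Require Import structures.
From mathcomp Require Import all_boot all_order all_algebra.
From mathcomp Require Import complex.
From mathcomp Require Import all_classical all_reals all_analysis.
From mathcomp Require Import ring.

Set Implicit Arguments.
Unset Strict Implicit.
Unset Printing Implicit Defensive.

Import Order.TTheory GRing.Theory Num.Theory.
Import numFieldNormedType.Exports.

Local Open Scope classical_set_scope.
Local Open Scope complex_scope.
Local Open Scope ring_scope.

(* The norm of a normed module over R[i] takes its values in R[i] (on the
   nonnegative reals); [rnorm] is the same norm, read in R. *)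
Definition rnorm (R : realType) (V : normedZmodType R[i]) (x : V) : R :=
  complex.Re `|x|.

Section rnorm_theory.
Variable R : realType.

Lemma rnormE (V : normedZmodType R[i]) (x : V) : `|x| = (rnorm x)%:C.
Proof. by rewrite RRe_real ?normr_real. Qed.

Lemma rnorm_ge0 (V : normedZmodType R[i]) (x : V) : 0 <= rnorm x.
Proof. by rewrite -lecR -rnormE normr_ge0. Qed.

Lemma rnormD (V : normedZmodType R[i]) (x y : V) :
  rnorm (x + y) <= rnorm x + rnorm y.
Proof. by rewrite -lecR rmorphD/= -!rnormE ler_normD. Qed.

Lemma rnormM (x y : R[i]) : rnorm (x * y) = rnorm x * rnorm y.
Proof. by apply: complexI; rewrite rmorphM/= -!rnormE normrM. Qed.

Lemma rnormJ (x : R[i]) : rnorm (x^*%C) = rnorm x.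
Proof. by apply: complexI; rewrite -!rnormE normcJ. Qed.

Lemma rnorm_eq0 (V : normedZmodType R[i]) (x : V) : (rnorm x == 0) = (x == 0).
Proof. by rewrite -(inj_eq (@complexI R)) -rnormE normr_eq0. Qed.

End rnorm_theory.

Section projection_constants.
Variable R : realType.

Definition opnorm (V W : normedModType R[i]) (f : V -> W) : \bar R :=
  ereal_sup [set (rnorm (f x))%:E | x in [set x : V | rnorm x <= 1]].

Definition projection_onto (Y : normedModType R[i]) (E : set Y)
    (P : {linear Y -> Y}) : Prop :=
  [/\ continuous P, range P = E & forall y, E y -> P y = y].

Definition rel_projection_constant (Y : normedModType R[i]) (E : set Y) :
    \bar R :=
  ereal_inf [set opnorm P | P in [set P : {linear Y -> Y} |
    projection_onto E P]].

Definition projection_constant (X : normedModType R[i]) : \bar R :=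
  ereal_sup [set l | exists (Y : completeNormedModType R[i])
                            (I : {linear X -> Y}),
    (forall x, `|I x| = `|x|) /\ l = rel_projection_constant (range I)].

End projection_constants.

Section wirtinger.
Variables (R : realType) (n : nat).
Implicit Types (f : 'rV[R[i]]_n -> R[i]) (v z : 'rV[R[i]]_n) (j : 'I_n).

(* Derivative at z of f along v, with respect to a REAL parameter: the
   derivative of the library on R[i] would be the complex one. *)
Definition rderiv v f z : R[i] :=
  derive1 (fun h : R => complex.Re (f (z + h%:C *: v))) 0 +i*
  derive1 (fun h : R => complex.Im (f (z + h%:C *: v))) 0.

Definition dz j f z : R[i] :=
  (rderiv (delta_mx 0 j) f z - 'i%C * rderiv ('i%C *: delta_mx 0 j) f z) / 2.

Definition dzbar j f z : R[i] :=
  (rderiv (delta_mx 0 j) f z + 'i%C * rderiv ('i%C *: delta_mx 0 j) f z) / 2.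

Definition laplacian f z : R[i] := \sum_(j < n) dz j (dzbar j f) z.

End wirtinger.

(* Polynomials in the z_j and their conjugates, seen as functions; used to
   build the normed space of spherical harmonics below. *)
Section polynomial_functions.
Variables (R : realType) (n : nat).
Local Notation C := R[i].
Implicit Types (f g : 'rV[C]_n -> C) (v z : 'rV[C]_n) (j : 'I_n).

Inductive polyfun : ('rV[C]_n -> C) -> Prop :=
| polyfun_cst a : polyfun (fun=> a)
| polyfun_coord j : polyfun (fun z => z 0 j)
| polyfun_conj j : polyfun (fun z => (z 0 j)^*%C)
| polyfunD f g : polyfun f -> polyfun g -> polyfun (fun z => f z + g z)
| polyfunM f g : polyfun f -> polyfun g -> polyfun (fun z => f z * g z).

Lemma eq_polyfun f g : f =1 g -> polyfun f -> polyfun g.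
Proof. by move=> /funext ->. Qed.

Lemma polyfunX f k : polyfun f -> polyfun (fun z => f z ^+ k).
Proof.
move=> pf; elim: k => [|k IH].
  by apply: eq_polyfun (polyfun_cst 1) => z; rewrite expr0.
by apply: eq_polyfun (polyfunM pf IH) => z; rewrite exprS.
Qed.

Lemma polyfun_sum (I : Type) (r : seq I) (P : pred I)
    (F : I -> 'rV[C]_n -> C) : (forall i, polyfun (F i)) ->
  polyfun (fun z => \sum_(i <- r | P i) F i z).
Proof.
move=> pF; elim: r => [|i r IH].
  by apply: eq_polyfun (polyfun_cst 0) => z; rewrite big_nil.
case Pi: (P i).
  by apply: eq_polyfun (polyfunD (pF i) IH) => z; rewrite big_cons Pi.
by apply: eq_polyfun IH => z; rewrite big_cons Pi.
Qed.

Lemma polyfun_prod (I : Type) (r : seq I) (P : pred I)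
    (F : I -> 'rV[C]_n -> C) : (forall i, polyfun (F i)) ->
  polyfun (fun z => \prod_(i <- r | P i) F i z).
Proof.
move=> pF; elim: r => [|i r IH].
  by apply: eq_polyfun (polyfun_cst 1) => z; rewrite big_nil.
case Pi: (P i).
  by apply: eq_polyfun (polyfunM (pF i) IH) => z; rewrite big_cons Pi.
by apply: eq_polyfun IH => z; rewrite big_cons Pi.
Qed.

Definition has_rderiv v f z (d : C) : Prop :=
  is_derive (0 : R) 1 (fun h : R => complex.Re (f (z + h%:C *: v)))
    (complex.Re d) /\
  is_derive (0 : R) 1 (fun h : R => complex.Im (f (z + h%:C *: v)))
    (complex.Im d).

Lemma has_rderivE v f z d : has_rderiv v f z d -> rderiv v f z = d.
Proof.
move=> [a b]; rewrite /rderiv !derive1E.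
rewrite (@derive_val _ _ _ _ _ _ _ a) (@derive_val _ _ _ _ _ _ _ b).
by case: d {a b}.
Qed.

Lemma has_rderiv_cst v a z : has_rderiv v (fun=> a) z 0.
Proof. by split; exact: is_derive_cst. Qed.

Lemma is_derive_affine (a b : R) :
  is_derive (0 : R) 1 (fun h : R => a + h * b) b.
Proof.
have H1 : is_derive (0 : R) (1 : R) (cst a : R -> R) 0 by exact: is_derive_cst.
have H2 : is_derive (0 : R) (1 : R) (b *: (id : R -> R)) b.
  by have := is_deriveZ b (is_derive_id (0 : R) (1 : R)); rewrite [_ *: 1]mulr1.
have := is_deriveD H1 H2; rewrite add0r.
by congr is_derive; apply/funext => h /=; rewrite mulrC.
Qed.

Lemma has_rderiv_coord v j z : has_rderiv v (fun w => w 0 j) z (v 0 j).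
Proof.
split; [set g := complex.Re (v 0 j)|set g := complex.Im (v 0 j)].
- rewrite (_ : (fun h : R => _) = fun h => complex.Re (z 0 j) + h * g).
    exact: is_derive_affine.
  apply/funext => h; rewrite !mxE /g.
  by case: (z 0 j) => ? ?; case: (v 0 j) => ? ?/=; rewrite mul0r subr0.
- rewrite (_ : (fun h : R => _) = fun h => complex.Im (z 0 j) + h * g).
    exact: is_derive_affine.
  apply/funext => h; rewrite !mxE /g.
  by case: (z 0 j) => ? ?; case: (v 0 j) => ? ?/=; rewrite mul0r addr0.
Qed.

Lemma has_rderiv_conj v f z d : has_rderiv v f z d ->
  has_rderiv v (fun w => (f w)^*%C) z (d^*%C).
Proof.
move=> [a b]; split.
- rewrite (_ : (fun h : R => _) = fun h => complex.Re (f (z + h%:C *: v))).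
    by case: d a b.
  by apply/funext => h; case: (f _).
- have := is_deriveN b; congr is_derive; last by case: d {a b}.
  by apply/funext => h; rewrite /= opprfctE; case: (f _).
Qed.

Lemma has_rderivD v f g z df dg : has_rderiv v f z df ->
  has_rderiv v g z dg -> has_rderiv v (fun w => f w + g w) z (df + dg).
Proof.
move=> [a1 b1] [a2 b2]; split; rewrite raddfD/=.
- rewrite (_ : (fun h : R => _) = (fun h => complex.Re (f (z + h%:C *: v))) +
    (fun h => complex.Re (g (z + h%:C *: v)))); first exact: is_deriveD.
  by apply/funext => h; rewrite raddfD.
- rewrite (_ : (fun h : R => _) = (fun h => complex.Im (f (z + h%:C *: v))) +
    (fun h => complex.Im (g (z + h%:C *: v)))); first exact: is_deriveD.
  by apply/funext => h; rewrite raddfD.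
Qed.

Lemma ReD (x y : C) : complex.Re (x + y) = complex.Re x + complex.Re y.
Proof. by case: x; case: y. Qed.

Lemma ImD (x y : C) : complex.Im (x + y) = complex.Im x + complex.Im y.
Proof. by case: x; case: y. Qed.

Lemma ReM (x y : C) : complex.Re (x * y) =
  complex.Re x * complex.Re y - complex.Im x * complex.Im y.
Proof. by case: x; case: y. Qed.

Lemma ImM (x y : C) : complex.Im (x * y) =
  complex.Re x * complex.Im y + complex.Im x * complex.Re y.
Proof. by case: x; case: y. Qed.

Lemma has_rderivM v f g z df dg : has_rderiv v f z df ->
  has_rderiv v g z dg ->
  has_rderiv v (fun w => f w * g w) z (f z * dg + df * g z).
Proof.
move=> [a1 b1] [a2 b2].
have z0 : z + (0 : R)%:C *: v = z by rewrite scale0r addr0.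
split.
- have := is_deriveB (is_deriveM a1 a2) (is_deriveM b1 b2); rewrite z0.
  congr is_derive; first by apply/funext => h; rewrite ReM.
  by rewrite ReD !ReM /GRing.scale/=; ring.
- have := is_deriveD (is_deriveM a1 b2) (is_deriveM b1 a2); rewrite z0.
  congr is_derive; first by apply/funext => h; rewrite ImM.
  by rewrite ImD !ImM /GRing.scale/=; ring.
Qed.

Lemma polyfun_derive f v : polyfun f ->
  exists2 g, polyfun g & forall z, has_rderiv v f z (g z).
Proof.
elim=> {f} [a|j|j|f1 f2 _ [g1 pg1 d1] _ [g2 pg2 d2]
           |f1 f2 p1 [g1 pg1 d1] p2 [g2 pg2 d2]].
- by exists (fun=> 0) => [|z]; [exact: polyfun_cst|exact: has_rderiv_cst].
- exists (fun=> v 0 j) => [|z]; first exact: polyfun_cst.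
  exact: has_rderiv_coord.
- exists (fun=> (v 0 j)^*%C) => [|z]; first exact: polyfun_cst.
  by apply: has_rderiv_conj; exact: has_rderiv_coord.
- by exists (fun z => g1 z + g2 z) => [|z]; [exact: polyfunD|exact: has_rderivD].
- exists (fun z => f1 z * g2 z + g1 z * f2 z) => [|z]; last exact: has_rderivM.
  by apply: polyfunD; exact: polyfunM.
Qed.

Lemma rderiv_polyfun f v : polyfun f -> polyfun (rderiv v f).
Proof.
move=> /(polyfun_derive v)[g pg dg].
by apply: eq_polyfun pg => z; rewrite (has_rderivE (dg z)).
Qed.

Lemma rderiv_linear (a : C) f g v z : polyfun f -> polyfun g ->
  rderiv v (fun w => a * f w + g w) z = a * rderiv v f z + rderiv v g z.
Proof.
move=> /(polyfun_derive v)[f' _ df] /(polyfun_derive v)[g' _ dg].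
rewrite (has_rderivE (df z)) (has_rderivE (dg z)).
rewrite (has_rderivE
  (has_rderivD (has_rderivM (has_rderiv_cst v a z) (df z)) (dg z))).
by rewrite mul0r addr0.
Qed.

Lemma dz_polyfun j f : polyfun f -> polyfun (dz j f).
Proof.
move=> pf; rewrite /dz.
have -> : (fun z => (rderiv (delta_mx 0 j) f z - 'i%C * rderiv ('i%C *: delta_mx 0 j) f z) / 2)
  = (fun z => (rderiv (delta_mx 0 j) f z + (- 'i%C) * rderiv ('i%C *: delta_mx 0 j) f z) * 2^-1).
  by apply/funext => z; rewrite mulNr.
apply: polyfunM; last exact: polyfun_cst.
apply: polyfunD; first exact: rderiv_polyfun.
apply: polyfunM; first exact: polyfun_cst.
exact: rderiv_polyfun.
Qed.

Lemma dzbar_polyfun j f : polyfun f -> polyfun (dzbar j f).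
Proof.
move=> pf; rewrite /dzbar; apply: polyfunM; last exact: polyfun_cst.
apply: polyfunD; first exact: rderiv_polyfun.
apply: polyfunM; first exact: polyfun_cst.
exact: rderiv_polyfun.
Qed.

Lemma wirtinger_lin (A : comPzRingType) (a x y u v k h : A) :
  (a * x + y + k * (a * u + v)) * h = a * ((x + k * u) * h) + (y + k * v) * h.
Proof. by ring. Qed.

Lemma dz_linear (a : C) f g j z : polyfun f -> polyfun g ->
  dz j (fun w => a * f w + g w) z = a * dz j f z + dz j g z.
Proof.
by move=> pf pg; rewrite /dz !rderiv_linear// -!mulNr; exact: wirtinger_lin.
Qed.

Lemma dzbar_linear (a : C) f g j z : polyfun f -> polyfun g ->
  dzbar j (fun w => a * f w + g w) z = a * dzbar j f z + dzbar j g z.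
Proof.
by move=> pf pg; rewrite /dzbar !rderiv_linear//; exact: wirtinger_lin.
Qed.

Lemma laplacian_linear (a : C) f g z : polyfun f -> polyfun g ->
  laplacian (fun w => a * f w + g w) z = a * laplacian f z + laplacian g z.
Proof.
move=> pf pg; rewrite /laplacian mulr_sumr -big_split/=.
apply: eq_bigr => j _.
rewrite (_ : dzbar j _ = fun w => a * dzbar j f w + dzbar j g w).
  by rewrite dz_linear//; exact: dzbar_polyfun.
by apply/funext => w; rewrite dzbar_linear.
Qed.

End polynomial_functions.

Section spherical_harmonics.
Variables (R : realType) (n p q : nat).

(* A multi-index of length p has all its entries at most p, hence the finite
   index types. *)
Definition bihomogeneous (f : 'rV[R[i]]_n -> R[i]) : Prop :=
  exists c : {ffun 'I_n -> 'I_p.+1} -> {ffun 'I_n -> 'I_q.+1} -> R[i],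
  forall z, f z =
    \sum_(a : {ffun 'I_n -> 'I_p.+1} | (\sum_j a j == p)%N)
    \sum_(b : {ffun 'I_n -> 'I_q.+1} | (\sum_j b j == q)%N)
      c a b * ((\prod_j z 0 j ^+ a j) * (\prod_j (z 0 j)^*%C ^+ b j)).

Definition harmonics : set ('rV[R[i]]_n -> R[i]) :=
  [set f | bihomogeneous f /\ forall z, laplacian f z = 0].

Definition sphere : Type :=
  {z : 'rV[R[i]]_n | Num.sqrt (\sum_j rnorm (z 0 j) ^+ 2) == 1}.

Definition sphere_harmonics : {pred sphere -> R[i]} :=
  fun f => `[< exists2 g, harmonics g & f = g \o val >].

Lemma bihomogeneous_polyfun f : bihomogeneous f -> polyfun f.
Proof.
move=> [c fE]; apply: eq_polyfun (fun z => esym (fE z)) _.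
apply: polyfun_sum => a; apply: polyfun_sum => b.
apply: polyfunM; first exact: polyfun_cst.
apply: polyfunM; apply: polyfun_prod => j; apply: polyfunX.
  exact: polyfun_coord.
exact: polyfun_conj.
Qed.

Lemma bihomogeneous_linear (k : R[i]) f g : bihomogeneous f ->
  bihomogeneous g -> bihomogeneous (fun z => k * f z + g z).
Proof.
move=> [c fE] [d gE]; exists (fun a b => k * c a b + d a b) => z.
rewrite fE gE mulr_sumr -big_split; apply: eq_bigr => a _ /=.
rewrite mulr_sumr -big_split; apply: eq_bigr => b _ /=.
by rewrite mulrDl mulrA.
Qed.

Lemma sphere_harmonics_submod_closed : submod_closed sphere_harmonics.
Proof.
split.
  apply/asboolP; exists (fun=> 0) => //; split.
    exists (fun _ _ => 0) => z; rewrite big1// => a _; rewrite big1// => b _.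
    by rewrite mul0r.
  move=> z; have pc := polyfun_cst n (0 : R[i]).
  have := laplacian_linear (- 1) z pc pc.
  by rewrite mulr0 addr0 mulN1r addNr.
move=> k _ _ /asboolP[f [bf lf] ->] /asboolP[g [bg lg] ->].
apply/asboolP; exists (fun z => k * f z + g z); last by apply/funext.
split; first exact: bihomogeneous_linear.
move=> z.
have pf := bihomogeneous_polyfun bf; have pg := bihomogeneous_polyfun bg.
by rewrite (laplacian_linear k z pf pg) lf lg mulr0 addr0.
Qed.

HB.instance Definition _ := GRing.isSubmodClosed.Build _ _ sphere_harmonics
  sphere_harmonics_submod_closed.

Record Hpq : Type := MkHpq {
  Hpq_fun :> sphere -> R[i];
  Hpq_funP : Hpq_fun \in sphere_harmonics }.

HB.instance Definition _ := [isSub for Hpq_fun].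
HB.instance Definition _ := [Choice of Hpq by <:].
HB.instance Definition _ := [SubChoice_isSubLmodule of Hpq by <:].

Lemma rnorm_coord_le1 (z : sphere) j : rnorm ((val z) 0 j) <= 1.
Proof.
case: z => z /= /eqP z1.
have z2 : \sum_j rnorm (z 0 j) ^+ 2 = 1.
  rewrite -[LHS]sqr_sqrtr ?z1 ?expr1n//.
  by apply: sumr_ge0 => i _; rewrite sqr_ge0.
rewrite -(@expr_le1 _ 2) ?rnorm_ge0// -z2 (bigD1 j)//= lerDl.
by apply: sumr_ge0 => i _; rewrite sqr_ge0.
Qed.

Lemma polyfun_bounded f : polyfun f ->
  exists M : R, forall z : sphere, rnorm (f (val z)) <= M.
Proof.
elim=> {f} [a|j|j|f g _ [M fM] _ [N gN]|f g _ [M fM] _ [N gN]].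
- by exists (rnorm a).
- by exists 1 => z; exact: rnorm_coord_le1.
- by exists 1 => z; rewrite rnormJ; exact: rnorm_coord_le1.
- by exists (M + N) => z; rewrite (le_trans (rnormD _ _))// lerD.
- by exists (M * N) => z; rewrite rnormM ler_pM ?rnorm_ge0.
Qed.

Definition supnorm (f : Hpq) : R := sup (range (fun z => rnorm (f z))).

Lemma le_supnorm (f : Hpq) z : rnorm (f z) <= supnorm f.
Proof.
apply: ub_le_sup; last by exists z.
have /asboolP[g [bg _] fE] := Hpq_funP f.
have [M gM] := polyfun_bounded (bihomogeneous_polyfun bg).
by exists M => _ [w _ <-]; rewrite fE; exact: gM.
Qed.

Lemma supnorm_le (f : Hpq) (M : R) : 0 <= M ->
  (forall z, rnorm (f z) <= M) -> supnorm f <= M.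
Proof.
move=> M0 fM; rewrite /supnorm.
have [->|/set0P fN0] := eqVneq (range (fun z => rnorm (f z))) set0.
  by rewrite sup0.
by apply: ge_sup => // _ [z _ <-].
Qed.

Lemma supnorm_ge0 (f : Hpq) : 0 <= supnorm f.
Proof.
have [S0|/set0P[_ [z _ _]]] := eqVneq (range (fun z => rnorm (f z))) set0.
  by rewrite /supnorm S0 sup0.
exact: le_trans (rnorm_ge0 (f z)) (le_supnorm f z).
Qed.

Definition Hpq_norm (f : Hpq) : R[i] := (supnorm f)%:C.

Lemma Hpq_normD f g : Hpq_norm (f + g) <= Hpq_norm f + Hpq_norm g.
Proof.
rewrite -rmorphD/= lecR; apply: supnorm_le => [|z].
  by rewrite addr_ge0 ?supnorm_ge0.
by rewrite (le_trans (rnormD _ _))// lerD ?le_supnorm.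
Qed.

Lemma Hpq_normZ (l : R[i]) f : Hpq_norm (l *: f) = `|l| * Hpq_norm f.
Proof.
have le_scale k g : supnorm (k *: g) <= rnorm k * supnorm g.
  apply: supnorm_le => [|z]; first by rewrite mulr_ge0 ?rnorm_ge0 ?supnorm_ge0.
  by rewrite rnormM ler_wpM2l ?rnorm_ge0 ?le_supnorm.
rewrite rnormE -rmorphM/=; congr (_%:C); apply/eqP; rewrite eq_le le_scale/=.
have [->|l0] := eqVneq l 0.
  suff -> : rnorm (0 : R[i]) = 0 by rewrite mul0r supnorm_ge0.
  by apply/eqP; rewrite rnorm_eq0.
have := le_scale l^-1 (l *: f); rewrite scalerA mulVf// scale1r.
have lgt0 : 0 < rnorm l by rewrite lt_neqAle eq_sym rnorm_eq0 l0 rnorm_ge0.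
move=> /(ler_wpM2l (ltW lgt0)); rewrite mulrA -rnormM divff//.
suff -> : rnorm (1 : R[i]) = 1 by rewrite mul1r.
by apply: complexI; rewrite -rnormE normr1.
Qed.

Lemma Hpq_norm_eq0 f : Hpq_norm f = 0 -> f = 0.
Proof.
move=> /complexI f0; apply: val_inj; apply/funext => z; apply/eqP.
by rewrite -rnorm_eq0 eq_le rnorm_ge0 -f0 le_supnorm.
Qed.

HB.instance Definition _ := Lmodule_isNormed.Build R[i] Hpq
  Hpq_normD Hpq_normZ Hpq_norm_eq0.

End spherical_harmonics.

Section jacobi_polynomials.
Variable R : realType.
Implicit Types (a b t : R) (d k : nat).

Definition rodrigues a b d t : R :=
  (- 1) ^+ d / (2 ^+ d * d`!%:R) * (1 - t) `^ (- a) * (1 + t) `^ (- b) *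
  derive1n d (fun s => (1 - s) `^ (a + d%:R) * (1 + s) `^ (b + d%:R)) t.

(* The polynomial given by the Rodrigues formula, which makes sense as it
   stands on ]-1, 1[ only; [jacobiE] shows that there is one. *)
Definition jacobi a b d : {poly R} :=
  xget 0 [set P : {poly R} |
    forall t, -1 < t < 1 -> P.[t] = rodrigues a b d t].

Lemma derive_jacobi_weight a b (Q : {poly R}) t : -1 < t < 1 ->
  is_derive t (1 : R) (fun s => (1 - s) `^ a * (1 + s) `^ b * Q.[s])
    ((1 - t) `^ (a - 1) * (1 + t) `^ (b - 1) *
     ((- a)%:P * (1 + 'X) * Q + b%:P * (1 - 'X) * Q +
        (1 - 'X) * (1 + 'X) * Q^`())%R.[t]).
Proof.
move=> /andP[t1 t2].
have m0 : 0 < 1 - t by rewrite subr_gt0.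
have p0 : 0 < 1 + t by rewrite -ltrBlDl sub0r.
have d1 : is_derive t (1 : R) (fun s : R => 1 - s) (-1).
  have := is_deriveB (is_derive_cst (1 : R) t (1 : R)) (is_derive_id t (1 : R)).
  by rewrite sub0r.
have d2 : is_derive t (1 : R) (fun s : R => 1 + s) 1.
  have := is_deriveD (is_derive_cst (1 : R) t (1 : R)) (is_derive_id t (1 : R)).
  by rewrite add0r.
have e1 := @is_derive1_comp R (fun x => x `^ a) (fun s => 1 - s) t _ _ (is_derive1_powR a m0) d1.
have e2 := @is_derive1_comp R (fun x => x `^ b) (fun s => 1 + s) t _ _ (is_derive1_powR b p0) d2.
have dQ : is_derive t (1 : R) (horner Q) Q^`().[t].
  exact: is_derive_poly.
have := is_deriveM (is_deriveM e1 e2) dQ.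
congr is_derive.
have h (x c : R) : 0 < x -> x `^ c = x `^ (c - 1) * x.
  by move=> x0; rewrite -{3}[x]powRr1 ?ltW// -powRD ?subrK//= (gt_eqF x0) implybT.
rewrite /= mulrfctE /= (h _ a m0) (h _ b p0) !hornerE /GRing.scale/=.
ring.
Qed.

Lemma derive1n_jacobi_weight a b k : exists Q : {poly R}, forall t,
  -1 < t < 1 -> derive1n k (fun s => (1 - s) `^ a * (1 + s) `^ b) t =
    (1 - t) `^ (a - k%:R) * (1 + t) `^ (b - k%:R) * Q.[t].
Proof.
elim: k => [|k [Q IH]].
  by exists 1 => t _; rewrite derive1n0 !subr0 hornerC mulr1.
exists ((- (a - k%:R))%:P * (1 + 'X) * Q + (b - k%:R)%:P * (1 - 'X) * Q +
  (1 - 'X) * (1 + 'X) * Q^`())%R => t t1.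
have kS (c : R) : c - k.+1%:R = c - k%:R - 1 by rewrite -natr1 opprD addrA.
rewrite derive1nS derive1E !kS.
have D := derive_jacobi_weight (a - k%:R) (b - k%:R) Q t1.
rewrite -(@derive_val _ _ _ _ _ _ _ D).
apply: near_eq_derive.
near=> s; apply: IH.
near: s.
have : t \in `]-1, 1[ by rewrite in_itv.
by move=> /near_in_itvoo; apply: filterS => s; rewrite in_itv.
Unshelve. all: by end_near. Qed.

Lemma jacobiE a b d t : -1 < t < 1 -> (jacobi a b d).[t] = rodrigues a b d t.
Proof.
have [Q dQ] := derive1n_jacobi_weight (a + d%:R) (b + d%:R) d.
pose K : R := (- 1) ^+ d / (2 ^+ d * d`!%:R).
have PQ : [set P : {poly R} | forall t, -1 < t < 1 ->
    P.[t] = rodrigues a b d t] (K *: Q).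
  move=> s s1; rewrite /rodrigues dQ// !addrK hornerZ -/K.
  have /andP[s2 s3] := s1.
  have m0 : 1 - s != 0 by rewrite gt_eqF// subr_gt0.
  have p0 : 1 + s != 0 by rewrite gt_eqF// -ltrBlDl sub0r.
  have hm : (1 - s) `^ (- a) * (1 - s) `^ a = 1.
    by rewrite -powRD ?addNr ?powRr0// eqxx m0.
  have hp : (1 + s) `^ (- b) * (1 + s) `^ b = 1.
    by rewrite -powRD ?addNr ?powRr0// eqxx p0.
  transitivity ((1 - s) `^ (- a) * (1 - s) `^ a *
    ((1 + s) `^ (- b) * (1 + s) `^ b) * (K * Q.[s])).
    by rewrite hm hp !mul1r.
  by ring.
by move=> t1; rewrite /jacobi; case: xgetP => [P _ ->//|/(_ _ PQ)].
Qed.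

End jacobi_polynomials.

(* Euler's integral, for x > 0. *)
Definition Gamma (R : realType) (x : R) : R :=
  \int[lebesgue_measure]_(t in `]0, +oo[) (t `^ (x - 1) * expR (- t)).

(* Main.v *)
Require Import Defs.
From HB Require Import structures.
From mathcomp Require Import all_boot all_order all_algebra.
From mathcomp Require Import complex polyrcf separable.
From mathcomp Require Import all_classical all_reals all_analysis.
From mathcomp Require cyclotomic.
From mathcomp Require Import ring lra zify.

Set Implicit Arguments.
Unset Strict Implicit.
Unset Printing Implicit Defensive.

Import Order.TTheory GRing.Theory Num.Theory.
Import numFieldNormedType.Exports.

Local Open Scope classical_set_scope.
Local Open Scope complex_scope.
Local Open Scope ring_scope.

(* Let K_w be the zonal reproducing kernel of the harmonics of bidegree (p, q).
   For every N there are finitely many points w_i of the sphere and weights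
   a_i >= 0 of sum 1 integrating the polynomials of bidegree <= (N, N) exactly,
   so that f = sum_i a_i f(w_i) K_(w_i) for f harmonic of bidegree (p, q).
   Upper bound: Hahn-Banach extends evaluation at w_i to a functional phi_i of
   norm <= 1 on any space Y containing the harmonics isometrically, and
   y |-> sum_i a_i phi_i(y) K_(w_i) is a projection of norm at most
   max_z sum_i a_i |K_(w_i)(z)|, which tends to the L1 norm of K_w.
   Lower bound: among the bounded functions on the sphere, let F_z approximate
   the phase of the kernel K_z, with |F_z| <= 1.  For a projection P,
   sum_i a_i (P F_(w_i))(w_i) is at most the norm of P; expanding P F_(w_i) by
   the reproducing formula and summing over i first, Funk-Hecke replaces F by a
   multiple of the kernel, which P fixes, and the sum is nearly the same L1
   norm.  In the variable t = |<z, w>|^2 the kernel is a Jacobi polynomial. *)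

(** * Gauss quadrature on [0, 1] *)

(** Exact finite sums stand for all integrals over the sphere: Hahn-Banach is applied at finitely
    many points, and moving a projection through an average is mere linearity. The weights must be
    nonnegative, because the norm estimates sum moduli; Gauss nodes secure this, each weight being
    the integral of a square. The obstacle is that the modulus of the kernel is not a polynomial. Up
    to a constant it is the square root of chi = t^|p-q| J(t)^2, with J the Jacobi polynomial moved
    to [0, 1]. A polynomial psi close to chi^(-1/2) with chi psi^2 <= 1 serves both bounds: chi psi
    plus a small constant majorises sqrt chi, and J psi yields an approximate phase of modulus at
    most 1. The degree of psi, hence the quadrature, depends on the error allowed. For the lower
    bound one space Y suffices; in the bounded functions with the supremum norm, evaluation at a
    point has norm at most 1, which is what the estimate of the diagonal sum uses. The constant
    c(p,q,n) is the factor n - 1 of the density (n-1)(1-t)^(n-2) of t, times the normalisation that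
    makes the kernel reproducing. *)

Section poly_integral.
Variable R : realType.
Implicit Types p q : {poly R}.

Definition pint p : R := \int[lebesgue_measure]_(t in `[0, 1]) p.[t].

Lemma integrable_poly p :
  lebesgue_measure.-integrable `[0, 1] (EFin \o horner p).
Proof.
apply: continuous_compact_integrable; first exact: segment_compact.
by apply: continuous_subspaceT; exact: continuous_horner.
Qed.

Lemma pintD p q : pint (p + q) = pint p + pint q.
Proof.
rewrite /pint -RintegralD//; try exact: integrable_poly.
by apply: eq_Rintegral => t _; rewrite hornerD.
Qed.

Lemma pintZ a p : pint (a *: p) = a * pint p.
Proof.
rewrite /pint -RintegralZl//; try exact: integrable_poly.
by apply: eq_Rintegral => t _; rewrite hornerZ.
Qed.

Lemma pintB p q : pint (p - q) = pint p - pint q.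
Proof. by rewrite -scaleN1r pintD pintZ mulN1r. Qed.

Lemma pint0 : pint 0 = 0.
Proof. by rewrite -(scale0r 0) pintZ mul0r. Qed.

Lemma pint_sum (I : Type) (r : seq I) (P : pred I) (F : I -> {poly R}) :
  pint (\sum_(i <- r | P i) F i) = \sum_(i <- r | P i) pint (F i).
Proof. by apply: big_morph; [exact: pintD|exact: pint0]. Qed.

Lemma pint_ge0 p : (forall t, 0 <= t <= 1 -> 0 <= p.[t]) -> 0 <= pint p.
Proof.
by move=> p0; apply: Rintegral_ge0 => t /=; rewrite in_itv/=; exact: p0.
Qed.

Lemma pint_deriv p : pint p^`() = p.[1] - p.[0].
Proof.
rewrite /pint /Rintegral (@continuous_FTC2 _ _ (horner p)) => [//|//|||].
- by apply: continuous_subspaceT; exact: continuous_horner.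
- split.
  + by move=> x _; exact: (@ex_derive _ _ _ _ _ _ _ (is_derive_poly p x)).
  + by apply: cvg_at_right_filter; exact: continuous_horner.
  + by apply: cvg_at_left_filter; exact: continuous_horner.
- move=> x _; rewrite derive1E.
  exact: (@derive_val _ _ _ _ _ _ _ (is_derive_poly p x)).
Qed.

Lemma pint_by_parts p q : (p * q).[0] = 0 -> (p * q).[1] = 0 ->
  pint (p^`() * q) = - pint (p * q^`()).
Proof.
move=> h0 h1; apply/eqP; rewrite -addr_eq0 -pintD -derivM pint_deriv.
by rewrite h0 h1 subrr.
Qed.

(** Euler's Beta integral: ['X^a.+1 * (1 - 'X)^b.+1] vanishes at both ends, so the integral of its
    derivative relates exponent [b.+1] to [b]. *)
Lemma pint_beta a b :
  pint ('X^a * (1 - 'X) ^+ b) = a`!%:R * b`!%:R / (a + b).+1`!%:R.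
Proof.
elim: b a => [|b IH] a.
  rewrite expr0 mulr1 addn0 fact0 mulr1.
  have -> : ('X^a : {poly R}) = deriv (a.+1%:R^-1 *: 'X^(a.+1)).
    by rewrite derivZ derivXn/= -(scaler_nat a.+1 'X^a) scalerA mulVf ?pnatr_eq0// scale1r.
  rewrite pint_deriv !hornerZ !hornerXn expr1n expr0n/= mulr1 mulr0 subr0.
  by rewrite factS natrM invfM mulrCA divff ?mulr1// pnatr_eq0 -lt0n fact_gt0.
have d : deriv ('X^(a.+1) * (1 - 'X) ^+ b.+1) =
    a.+1%:R *: ('X^a * (1 - 'X) ^+ b.+1) -
    b.+1%:R *: ('X^(a.+1) * (1 - 'X) ^+ b) :> {poly R}.
  rewrite derivM derivXn deriv_exp derivB derivC derivX sub0r/= mulN1r.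
  by rewrite mulrnAl mulrnAr mulrN mulNrn !scaler_nat.
have := pint_deriv ('X^(a.+1) * (1 - 'X) ^+ b.+1).
rewrite d pintB !pintZ IH !hornerE subrr !expr0n/= mulr0 mul0r subr0 => /eqP.
rewrite subr_eq0 => /eqP h.
have a0 : (a.+1%:R : R) != 0 by rewrite pnatr_eq0.
apply: (mulfI a0); rewrite h addnS addSn !factS !natrM.
by set D := _^-1; ring.
Qed.

(** Rolle's theorem between consecutive roots. The last clause keeps the new roots below the last
    old one, so an endpoint can be appended before the next application. *)
Lemma rolle_path p a s : path <%R a s -> root p a -> all (root p) s ->
  exists s', [/\ size s' = size s, path <%R a s', all (root p^`()%R) s' &
    all (< last a s) s'].
Proof.
elim: s a => [|b s IH] a /=; first by exists [::].
move=> /andP[ab bs] pa /andP[pb ps].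
have [s' [ss' bs' ps' ls']] := IH b bs pb ps.
have [c /[!in_itv]/= /andP[ac cb] pc] := poly_rolle ab (etrans (eqP pa) (esym (eqP pb))).
exists (c :: s'); split => /=.
- by rewrite ss'.
- by rewrite ac (unstable.path_lt_head cb).
- by rewrite ps' andbT; apply/eqP.
- rewrite ls' andbT (lt_le_trans cb)//.
  have := bs; rewrite lt_path_sortedE => /andP[/allP lb _].
  have := mem_last b s; rewrite in_cons => /predU1P[->//|/lb/ltW//].
Qed.

Lemma derivn_XsubCX_dvd a (g : {poly R}) k N : (k <= N)%N ->
  exists h, derivn k (('X - a%:P) ^+ N * g) = ('X - a%:P) ^+ (N - k) * h.
Proof.
elim: k => [|k IH] kN; first by exists g; rewrite derivn0 subn0.
have [h hE] := IH (ltnW kN).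
exists ((N - k)%:R *: h + ('X - a%:P) * h^`()).
rewrite derivnS hE derivM deriv_exp derivXsubC mul1r -(subnSK kN)/= exprS.
by rewrite -mulr_natl -!mul_polyC -!polyC_natr; ring.
Qed.

(** Its N-th derivative is a multiple of the Legendre polynomial moved to [0, 1]. Writing
    ['X - 0%:P] for ['X] lets [derivn_XsubCX_dvd] serve both endpoints. *)
Definition legendre_weight N : {poly R} := ('X - 0%:P) ^+ N * ('X - 1%:P) ^+ N.

Lemma size_legendre_weight N : size (legendre_weight N) = (N + N).+1.
Proof.
rewrite /legendre_weight size_monicM ?monic_exp ?monicXsubC ?expf_neq0 ?polyXsubC_eq0//.
by rewrite !size_exp_XsubC addnS.
Qed.

Lemma root_legendre_weight N k a : (k < N)%N -> (a == 0) || (a == 1) ->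
  root (derivn k (legendre_weight N)) a.
Proof.
move=> kN a01; suff [h ->] : exists h, derivn k (legendre_weight N) =
    ('X - a%:P) ^+ (N - k) * h.
  by rewrite -(subnSK kN) rootM root_exp_XsubC eqxx.
have /orP[/eqP->|/eqP->] := a01; first exact/derivn_XsubCX_dvd/ltnW.
by rewrite /legendre_weight mulrC; exact/derivn_XsubCX_dvd/ltnW.
Qed.

(** Each integration by parts has zero boundary terms and moves one derivative onto [g], which k
    derivations kill. *)
Lemma legendre_orthogonal N k (g : {poly R}) : (k <= N)%N -> (size g <= k)%N ->
  pint (derivn k (legendre_weight N) * g) = 0.
Proof.
elim: k g => [|k IH] g kN.
  by rewrite leqn0 size_poly_eq0 => /eqP->; rewrite mulr0 pint0.
move=> gk; rewrite derivnS pint_by_parts ?IH ?oppr0//.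
- exact: ltnW.
- by rewrite polyorder.size_deriv; case: (size g) gk.
- by rewrite hornerM (eqP (root_legendre_weight kN _)) ?mul0r// eqxx.
- by rewrite hornerM (eqP (root_legendre_weight kN _)) ?mul0r// eqxx orbT.
Qed.

(** Rolle applied to 0, the k interior roots of the k-th derivative, and 1 gives k + 1 interior
    roots of the next one. *)
Lemma legendre_roots N k : (k <= N)%N -> exists s : seq R,
  [/\ size s = k, path <%R 0 s, all (< 1) s &
      all (root (derivn k (legendre_weight N))) s].
Proof.
elim: k => [|k IH] kN; first by exists [::].
have [s [ss s0 s1 rs]] := IH (ltnW kN).
have r01 := root_legendre_weight kN.
have p : path <%R 0 (rcons s 1).
  rewrite rcons_path s0/=; have := mem_last 0 s; rewrite in_cons.
  by move=> /predU1P[->//|/(allP s1)].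
have := rolle_path p (r01 0 _); rewrite eqxx => /(_ isT).
rewrite all_rcons r01 ?eqxx ?orbT//= => /(_ rs)[s' [ss' s'0 rs' s'1]].
exists s'; split => //; first by rewrite ss' size_rcons ss.
by move: s'1; rewrite last_rcons.
Qed.

(** The nodes are the N zeros of the Legendre polynomial. Two polynomials of size at most 2N that
    agree there differ by a multiple of it with cofactor of size at most N, which integrates to 0 by
    orthogonality. *)
Lemma gauss_quadrature N : exists s : seq (R * R),
  (forall x, x \in s -> 0 <= x.1 /\ 0 <= x.2 <= 1) /\
  forall p : {poly R}, (size p <= N + N)%N -> \sum_(x <- s) x.1 * p.[x.2] = pint p.
Proof.
have [r [sr r0 r1 rr]] := legendre_roots (leqnn N).
set Q := \prod_(x <- r) ('X - x%:P).
have ur : uniq r by apply: lt_sorted_uniq (path_sorted r0).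
have sQ : size Q = N.+1 by rewrite size_prod_XsubC sr.
have mQ : Q \is monic by exact: monic_prod_XsubC.
have Qr x : x \in r -> Q.[x] = 0.
  by move=> xr; apply/eqP; rewrite -/(root _ _) root_prod_XsubC.
(* The N-th derivative of the weight has size [N.+1] and the N distinct roots [r], so it is a
   nonzero multiple of [Q]. *)
have orth (g : {poly R}) : (size g <= N)%N -> pint (Q * g) = 0.
  move=> gN; have := all_roots_prod_XsubC _ rr.
  rewrite uniq_rootsE ur cauchyreals.size_derivn size_legendre_weight.
  rewrite subSn ?leq_addl// addnK sr => /(_ erefl isT) E.
  have := legendre_orthogonal (leqnn N) gN; rewrite E -scalerAl pintZ.
  move/eqP; rewrite mulf_eq0 lead_coef_eq0 -size_poly_eq0.
  rewrite cauchyreals.size_derivn size_legendre_weight subSn ?leq_addl//=.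
  by move/eqP.
have dvdQ (p : {poly R}) : (forall x, x \in r -> p.[x] = 0) -> Q %| p.
  move=> p0; apply: uniq_roots_dvdp; last by rewrite uniq_rootsE.
  by apply/allP => x /p0 /eqP.
(* The Lagrange basis at the nodes. *)
pose l x : {poly R} := let q := \prod_(y <- rem x r) ('X - y%:P) in q.[x]^-1 *: q.
have lE x y : x \in r -> y \in r -> (l x).[y] = (x == y)%:R.
  move=> xr yr; rewrite /l hornerZ; have [<-|xy] := eqVneq x y.
    rewrite mulVf// -[_ == 0]/(root _ _) root_prod_XsubC.
    by rewrite mem_rem_uniq// inE eqxx.
  rewrite [X in _ * X](_ : _ = 0) ?mulr0//; apply/eqP.
  by rewrite -[_ == 0]/(root _ _) root_prod_XsubC mem_rem_uniq// inE eq_sym xy.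
have sl x : x \in r -> (size (l x) <= N)%N.
  move=> xr; rewrite (leq_trans (size_scale_leq _ _))// size_prod_XsubC.
  by rewrite size_rem// sr prednK// -sr -has_predT; apply/hasP; exists x.
have exactQ (p : {poly R}) : (size p <= N + N)%N -> (forall x, x \in r -> p.[x] = 0) ->
    pint p = 0.
  move=> sp /dvdQ /(Pdiv.Field.divpK) <-; rewrite mulrC orth//.
  rewrite size_divp ?monic_neq0// sQ/= leq_subLR//.
(* [l x] and its square agree at all nodes, so the weight at [x] is the integral of a square, hence
   nonnegative. *)
have l2 x : x \in r -> pint (l x) = pint (l x ^+ 2).
  move=> xr; apply/eqP; rewrite -subr_eq0 -pintB; apply/eqP/exactQ => [|y yr].
    rewrite (leq_trans (size_polyD _ _))// geq_max size_polyN.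
    rewrite (leq_trans (sl _ xr)) ?leq_addr//= expr2.
    by rewrite (leq_trans (size_polyMleq _ _))// (leq_trans (leq_pred _))// leq_add// sl.
  rewrite hornerD hornerN horner_exp lE//.
  by case: (x == y); rewrite ?expr1n ?expr0n subrr.
exists [seq (pint (l x), x) | x <- r]; split.
  move=> _ /mapP[x xr ->] /=; split.
    by rewrite l2//; apply: pint_ge0 => t _; rewrite horner_exp sqr_ge0.
  by move: r0; rewrite lt_path_sortedE => /andP[/allP/(_ _ xr)/ltW -> _]; exact/ltW/(allP r1).
move=> p sp; rewrite big_map/=; apply/esym/eqP.
rewrite -subr_eq0.
have -> : \sum_(x <- r) pint (l x) * p.[x] = pint (\sum_(x <- r) p.[x] *: l x).
  by rewrite pint_sum; apply: eq_bigr => x _; rewrite pintZ mulrC.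
rewrite -pintB; apply/eqP/exactQ => [|x xr].
  rewrite (leq_trans (size_polyD _ _))// geq_max sp size_polyN/=.
  rewrite (leq_trans (size_sum _ _ _))//; apply/bigmax_leqP_seq => x xr _.
  by rewrite (leq_trans (size_scale_leq _ _))// (leq_trans (sl _ xr))// leq_addr.
rewrite hornerD hornerN horner_sum (bigD1_seq x)//= hornerZ lE// eqxx mulr1.
rewrite big_seq_cond big1 ?addr0 ?subrr// => y /andP[yr yx].
by rewrite hornerZ lE// (negbTE yx) mulr0.
Qed.

End poly_integral.

(** * Positive quadrature on the complex sphere *)

Section sphere_quadrature.
Variable R : realType.
Local Notation C := R[i].

Lemma conjcM (x y : C) : (x * y)^*%C = x^*%C * y^*%C.
Proof. exact: rmorphM. Qed.

Lemma conjcX (x : C) k : (x ^+ k)^*%C = x^*%C ^+ k.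
Proof. exact: rmorphXn. Qed.

Lemma conjc_sum (I : Type) (r : seq I) (P : pred I) (F : I -> C) :
  (\sum_(i <- r | P i) F i)^*%C = \sum_(i <- r | P i) (F i)^*%C.
Proof. exact: rmorph_sum. Qed.

Lemma conjc_norm1 (x : C) : `|x| = 1 -> x * x^*%C = 1.
Proof. by move=> x1; rewrite -normCK x1 expr1n. Qed.

Lemma prim_root_exists N : (0 < N)%N -> exists z : C, N.-primitive_root z.
Proof.
move=> N0; pose p : {poly C} := 'X^N - 1.
have [r Dp] := closed_field_poly_normal p.
rewrite lead_coefXnsubC// scale1r in Dp.
have rn1 : all N.-unity_root r by apply/allP => z; rewrite -root_prod_XsubC -Dp.
have sr : (N < (size r).+1)%N by rewrite -(size_prod_XsubC r id) -Dp size_XnsubC.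
have [|z] := hasP (cyclic.has_prim_root N0 rn1 _ sr); last by exists z.
rewrite -separable_prod_XsubC -Dp cyclotomic.separable_Xn_sub_1// pnatr_eq0 -lt0n//.
Qed.

(** The nodes are the N-th roots of unity: the sum of the powers [w^(a-b)] is a vanishing geometric
    sum unless N divides [a - b], and here |a - b| < N. *)
Lemma unity_quadrature N : (0 < N)%N -> exists s : seq C,
  (forall w, w \in s -> w * w^*%C = 1) /\
  forall a b, (a < N)%N -> (b < N)%N ->
  \sum_(w <- s) w ^+ a * w^*%C ^+ b = N%:R * (a == b)%:R.
Proof.
move=> N0; have [z zP] := prim_root_exists N0.
have zN := prim_expr_order zP.
have z1 : z * z^*%C = 1.
  apply: conjc_norm1; apply/eqP; rewrite -(pexpr_eq1 N0)//.
  by rewrite -normrX zN normr1.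
have zi i : z ^+ i * (z ^+ i)^*%C = 1 by rewrite conjcX -exprMn z1 expr1n.
have sum0 k : (0 < k < N)%N -> \sum_(i < N) (z ^+ i) ^+ k = 0.
  move=> /andP[k0 kN]; have zk : z ^+ k - 1 != 0.
    by rewrite subr_eq0 -(prim_order_dvd zP) gtnNdvd.
  apply: (mulfI zk); rewrite mulr0.
  under eq_bigr do rewrite -exprM mulnC exprM.
  by rewrite -subrX1 -exprM mulnC exprM zN expr1n subrr.
have sum1 a b : (b < a < N)%N ->
    \sum_(i < N) (z ^+ i) ^+ a * (z ^+ i)^*%C ^+ b = 0.
  move=> /andP[ba aN]; rewrite -[RHS](sum0 (a - b)%N); last first.
    by rewrite subn_gt0 ba (leq_ltn_trans (leq_subr _ _)).
  apply: eq_bigr => i _; rewrite -{1}(subnK (ltnW ba)) exprD -mulrA -exprMn.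
  by rewrite zi expr1n mulr1.
exists [seq z ^+ (nat_of_ord i) | i <- index_enum 'I_N]; split.
  by move=> _ /mapP[i _ ->].
move=> a b aN bN; rewrite big_map; have [->|] := eqVneq a b.
  under eq_bigr do rewrite -exprMn zi expr1n.
  by rewrite sumr_const card_ord mulr1.
rewrite mulr0 neq_ltn => /orP[ab|ba]; last by rewrite sum1// ba.
apply: (can_inj (@conjcK R)); rewrite conjc0 conjc_sum -[RHS](sum1 b a) ?ab//.
by apply: eq_bigr => i _; rewrite conjcM !conjcX conjcK mulrC.
Qed.

Definition monomial n (a b : 'I_n -> nat) (z : 'rV[C]_n) : C :=
  (\prod_j z 0 j ^+ a j) * (\prod_j (z 0 j)^*%C ^+ b j).

Definition row_cons n (x : C) (w : 'rV[C]_n) : 'rV[C]_n.+1 :=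
  \row_j (if unlift ord0 j is Some k then w 0 k else x).

Lemma row_cons0 n i x (w : 'rV[C]_n) : row_cons x w i ord0 = x.
Proof. by rewrite mxE unlift_none. Qed.

Lemma row_consS n i x (w : 'rV[C]_n) j : row_cons x w i (lift ord0 j) = w ord0 j.
Proof. by rewrite mxE liftK. Qed.

Lemma monomial_row_cons n (a b : 'I_n.+1 -> nat) (u v : R) x w :
  monomial a b (row_cons (u%:C * x) (v%:C *: w)) =
  (u ^+ (a ord0 + b ord0) *
   v ^+ (\sum_j a (lift ord0 j) + \sum_j b (lift ord0 j)))%:C *
  (x ^+ a ord0 * x^*%C ^+ b ord0) *
  monomial (a \o lift ord0) (b \o lift ord0) w.
Proof.
have E (c : 'I_n -> nat) (y : C) (f : 'I_n -> C) :
    \prod_i (y * f i) ^+ c i = y ^+ (\sum_i c i) * \prod_i f i ^+ c i.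
  under eq_bigr do rewrite exprMn.
  by rewrite big_split/= prodrXr.
rewrite /monomial !big_ord_recl !row_cons0.
rewrite -[X in _ = _ * X]/((\prod_j w 0 j ^+ a (lift ord0 j)) *
   (\prod_j (w 0 j)^*%C ^+ b (lift ord0 j))).
under [X in _ * X * _ = _]eq_bigr do rewrite row_consS mxE.
under [X in _ * (_ * X) = _]eq_bigr do rewrite row_consS mxE conjcM.
rewrite !E conjcM !conjc_real !exprMn !exprD !rmorphM !rmorphXn/=.
by ring.
Qed.

(** Induction on the dimension through z = (sqrt t w, sqrt(1-t) y) with |w| = 1 and y on the smaller
    sphere: for the uniform measure on the sphere of C^(n+2), the variables t, w and y are
    independent and t has density (n+1)(1-t)^n. The right-hand side is the Dirichlet integral for
    the sphere in [n.+1] coordinates. *)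
Lemma sphere_quadrature n D : exists s : seq (R * 'rV[C]_n.+1),
  (forall x, x \in s -> 0 <= x.1 /\ \sum_j x.2 0 j * (x.2 0 j)^*%C = 1) /\
  forall a b : 'I_n.+1 -> nat, (\sum_j a j <= D)%N -> (\sum_j b j <= D)%N ->
  \sum_(x <- s) x.1%:C * monomial a b x.2 =
  [forall j, a j == b j]%:R *
  ((n`! * \prod_j (a j)`!)%:R / (n + \sum_j a j)`!%:R).
Proof.
have [U [U1 US]] := unity_quadrature (ltn0Sn D).
have D0 : (D.+1%:R : C) != 0 by rewrite pnatr_eq0.
elim: n => [|n [s [s1 IH]]].
  exists [seq (D.+1%:R^-1, const_mx w) | w <- U]; split.
    move=> _ /mapP[w wU ->] /=; rewrite invr_ge0 ler0n big_ord1 mxE.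
    by split => //; exact: U1.
  move=> a b; rewrite !big_ord1 => aD bD; rewrite big_map/=.
  under eq_bigr do rewrite /monomial !big_ord1 mxE.
  rewrite -mulr_sumr US// fact0 mul1n add0n divff ?pnatr_eq0 -?lt0n ?fact_gt0//.
  rewrite mulr1 fmorphV rmorph_nat mulKf//; congr (nat_of_bool _)%:R.
  by apply/eqP/forallP => [ab j|/(_ ord0)/eqP//]; rewrite ord1 ab.
have [g [g1 gS]] := gauss_quadrature R (D + n).+1.
pose wt (x : R * R) := x.1 * (n.+1%:R * (1 - x.2) ^+ n) / D.+1%:R.
exists [seq (wt xw.1 * y.1, row_cons ((Num.sqrt xw.1.2)%:C * xw.2)
    ((Num.sqrt (1 - xw.1.2))%:C *: y.2)) | xw <- [seq (x, w) | x <- g, w <- U], y <- s].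
split.
  move=> _ /allpairsP[[[x w] y] /= [/allpairsP[[x' w'] /= [xg wU [-> ->]]] ys ->]] /=.
  have [x0 /andP[t0 t1]] := g1 _ xg; have [y0 yn] := s1 _ ys; split.
    by rewrite mulr_ge0// /wt divr_ge0// mulr_ge0// mulr_ge0// exprn_ge0// subr_ge0.
  rewrite big_ord_recl row_cons0.
  under eq_bigr do rewrite row_consS mxE conjcM mulrACA.
  rewrite -mulr_sumr yn mulr1 conjcM mulrACA (U1 _ wU) mulr1.
  rewrite !conjc_real -!rmorphM -!expr2 !sqr_sqrtr ?subr_ge0// -rmorphD/=.
  by rewrite addrC subrK.
move=> a b aD bD.
rewrite big_allpairs_dep/= big_allpairs_dep/=.
set s1a := \sum_j a (lift ord0 j); set s1b := \sum_j b (lift ord0 j).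
have [aD0 aD1] : (a ord0 <= D)%N /\ (s1a <= D)%N.
  by move: aD; rewrite big_ord_recl => h; split; apply: leq_trans h; rewrite ?leq_addr ?leq_addl.
have [bD0 bD1] : (b ord0 <= D)%N /\ (s1b <= D)%N.
  by move: bD; rewrite big_ord_recl => h; split; apply: leq_trans h; rewrite ?leq_addr ?leq_addl.
(* Square roots of t and 1 - t still occur here. Where the other two factors are nonzero,
   [a ord0 = b ord0] and [s1a = s1b], so that only even powers of them remain and the Gauss rule
   applies. *)
pose F (x : R * R) : R := x.1 * (n.+1%:R * (1 - x.2) ^+ n) / D.+1%:R *
  (Num.sqrt x.2 ^+ (a ord0 + b ord0) * Num.sqrt (1 - x.2) ^+ (s1a + s1b)).
transitivity ((\sum_(x <- g) (F x)%:C) * (\sum_(w <- U) w ^+ a ord0 * w^*%C ^+ b ord0) *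
  (\sum_(y <- s) y.1%:C * monomial (a \o lift ord0) (b \o lift ord0) y.2)).
  rewrite -[RHS]mulrA [RHS]mulr_suml; apply: eq_bigr => x _.
  rewrite [in RHS]mulr_suml [RHS]mulr_sumr; apply: eq_bigr => w _.
  rewrite [in RHS]mulr_sumr [RHS]mulr_sumr; apply: eq_bigr => y _.
  rewrite monomial_row_cons /F /wt !rmorphM/=.
  by ring.
rewrite US// IH//.
have -> : [forall j, a j == b j] =
    (a ord0 == b ord0) && [forall j, (a \o lift ord0) j == (b \o lift ord0) j].
  apply/forallP/andP => [ab|[ab0 /forallP ab1] j].
    by split; [exact: ab|apply/forallP => j; exact: ab].
  by case: (unliftP ord0 j) => [k|] ->//; exact: ab1.
case: eqP => ab0/=; last by rewrite !(mulr0, mul0r).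
case: forallP => ab1/=; last by rewrite !(mulr0, mul0r).
have s1ab : s1b = s1a by apply: eq_bigr => j _; rewrite -(eqP (ab1 j)).
rewrite mulr1 mul1r [_ * D.+1%:R]mulrC mulrA.
have -> : \sum_(x <- g) (F x)%:C = (D.+1%:R^-1 * n.+1%:R *
    pint ('X^(a ord0) * (1 - 'X) ^+ (n + s1a)))%:C.
  rewrite -rmorph_sum/= -gS; last first.
    rewrite (leq_trans (size_polyMleq _ _))// size_polyXn addSn/=.
    have -> : 1 - 'X = - ('X - 1%:P) :> {poly R} by rewrite opprB.
    have sk := size_poly_exp_leq (- ('X - 1%:P : {poly R})) (n + s1a).
    rewrite size_polyN size_XsubC mul1n in sk.
    apply: leq_trans (leq_add (leqnn _) sk) _.
    have aD' : (a ord0 + s1a <= D)%N by move: aD; rewrite big_ord_recl.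
    by rewrite addnS ltnS addnCA (leq_trans (leq_add (leqnn n) aD'))// addnC leq_addr.
  rewrite mulr_sumr; congr (_%:C); apply: eq_big_seq => x xg.
  have [_ /andP[t0 t1]] := g1 _ xg.
  rewrite /F -ab0 s1ab !addnn -!mul2n !exprM !sqr_sqrtr ?subr_ge0//.
  rewrite hornerM hornerXn horner_exp hornerD hornerN hornerC hornerX.
  by rewrite (exprD _ n s1a); move: (_ ^-1) => iD; ring.
rewrite pint_beta [in RHS]big_ord_recl [in X in _ = _ / X]big_ord_recl.
rewrite -/s1a; move: (s1a : nat) => k.
have -> : (n.+1 + (a ord0 + k) = (a ord0 + (n + k)).+1)%N by lia.
rewrite (factS n).
have f0 m : (m`!%:R : C) != 0 by rewrite pnatr_eq0 -lt0n fact_gt0.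
move: (f0 (n + k)%N) (f0 (a ord0 + (n + k)).+1) => {f0}.
move: ((n + k)`!) ((a ord0 + (n + k)).+1`!) (n`!) ((a ord0)`!)
  (\prod_(j < n.+1) (a (lift ord0 j))`!)%N => f1 f2 f3 f4 f5 f10 f20.
rewrite !natrM !(rmorphM (real_complex R)) !fmorphV !rmorph_nat.
have := D0; move: (D.+1%:R : C) => d d0; move: (n.+1%:R : C) => n1.
by field; rewrite f10 f20 d0.
Qed.

End sphere_quadrature.

(** * Wirtinger derivatives of bihomogeneous polynomials *)

Section wirtinger_calculus.
Variables (R : realType) (n : nat).
Local Notation C := R[i].
Implicit Types (f g : 'rV[C]_n -> C) (v z : 'rV[C]_n) (j k : 'I_n) (s t : C).

Lemma rderiv_cst v (a : C) z : rderiv v (fun=> a) z = 0.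
Proof. exact/has_rderivE/has_rderiv_cst. Qed.

Lemma rderivD v f g z : polyfun f -> polyfun g ->
  rderiv v (fun w => f w + g w) z = rderiv v f z + rderiv v g z.
Proof.
move=> /(polyfun_derive v)[f' _ df] /(polyfun_derive v)[g' _ dg].
rewrite (has_rderivE (df z)) (has_rderivE (dg z)).
exact/has_rderivE/has_rderivD.
Qed.

Lemma rderivM v f g z : polyfun f -> polyfun g ->
  rderiv v (fun w => f w * g w) z = f z * rderiv v g z + rderiv v f z * g z.
Proof.
move=> /(polyfun_derive v)[f' _ df] /(polyfun_derive v)[g' _ dg].
rewrite (has_rderivE (df z)) (has_rderivE (dg z)).
exact/has_rderivE/has_rderivM.
Qed.

(** [s = - 'i] gives [dz] and [s = 'i] gives [dzbar], so one calculus covers both. *)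
Definition wirt s j f z : C :=
  (rderiv (delta_mx 0 j) f z + s * rderiv ('i%C *: delta_mx 0 j) f z) / 2.

Lemma dzE j f : dz j f = wirt (- 'i%C) j f.
Proof. by apply/funext => z; rewrite /dz /wirt mulNr. Qed.

Lemma dzbarE j f : dzbar j f = wirt 'i%C j f.
Proof. by []. Qed.

Lemma wirt_polyfun s j f : polyfun f -> polyfun (wirt s j f).
Proof.
move=> pf; rewrite /wirt; apply: polyfunM; last exact: polyfun_cst.
apply: polyfunD; first exact: rderiv_polyfun.
apply: polyfunM; first exact: polyfun_cst.
exact: rderiv_polyfun.
Qed.

Lemma wirt_cst s j (a : C) : wirt s j (fun=> a) = fun=> 0.
Proof. by apply/funext => z; rewrite /wirt !rderiv_cst mulr0 addr0 mul0r. Qed.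

Lemma wirtD s j f g : polyfun f -> polyfun g ->
  wirt s j (fun z => f z + g z) = fun z => wirt s j f z + wirt s j g z.
Proof.
move=> pf pg; apply/funext => z; rewrite /wirt !(rderivD _ _ pf pg).
by rewrite mulrDr addrACA mulrDl.
Qed.

Let wirt_leibniz (A : comPzRingType) (f g a b c d s h : A) :
  (f * a + b * g + s * (f * c + d * g)) * h =
  f * ((a + s * c) * h) + (b + s * d) * h * g.
Proof. by ring. Qed.

Let wirt_leibniz2 (A : comPzRingType) (f g fs ft gs gt fst gst : A) :
  f * gst + fs * gt + (ft * gs + fst * g) =
  f * gst + ft * gs + (fs * gt + fst * g).
Proof. by ring. Qed.

Lemma wirtM s j f g : polyfun f -> polyfun g ->
  wirt s j (fun z => f z * g z) =
  fun z => f z * wirt s j g z + wirt s j f z * g z.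
Proof.
move=> pf pg; apply/funext => z; rewrite /wirt !(rderivM _ _ pf pg).
exact: wirt_leibniz.
Qed.

Lemma wirtZ s j (a : C) f : polyfun f ->
  wirt s j (fun z => a * f z) = fun z => a * wirt s j f z.
Proof.
move=> pf; rewrite wirtM ?wirt_cst//; last exact: polyfun_cst.
by apply/funext => z; rewrite mul0r addr0.
Qed.

Lemma wirt_sum s j (I : Type) (r : seq I) (P : pred I) (F : I -> 'rV[C]_n -> C) :
  (forall i, polyfun (F i)) ->
  wirt s j (fun z => \sum_(i <- r | P i) F i z) =
  fun z => \sum_(i <- r | P i) wirt s j (F i) z.
Proof.
move=> pF; elim: r => [|i r IH].
  rewrite [X in wirt s j X](_ : _ = fun=> 0) ?wirt_cst.
    by apply/funext => z; rewrite big_nil.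
  by apply/funext => z; rewrite big_nil.
case Pi: (P i); last first.
  rewrite [X in wirt s j X](_ : _ = fun z => \sum_(i <- r | P i) F i z) ?IH.
    by apply/funext => z; rewrite big_cons Pi.
  by apply/funext => z; rewrite big_cons Pi.
rewrite [X in wirt s j X](_ : _ = fun z => F i z + \sum_(i <- r | P i) F i z).
  rewrite wirtD//; last exact: polyfun_sum.
  by rewrite IH; apply/funext => z; rewrite big_cons Pi.
by apply/funext => z; rewrite big_cons Pi.
Qed.

Lemma wirtX s j f m : polyfun f ->
  wirt s j (fun z => f z ^+ m) = fun z => m%:R * f z ^+ m.-1 * wirt s j f z.
Proof.
move=> pf; elim: m => [|m IH].
  rewrite [X in wirt s j X](_ : _ = fun=> 1) ?wirt_cst.
    by apply/funext => z; rewrite mul0r mul0r.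
  by apply/funext => z; rewrite expr0.
rewrite [X in wirt s j X](_ : _ = fun z => f z * f z ^+ m).
  rewrite wirtM ?IH//; last exact: polyfunX.
  apply/funext => z; case: m {IH} => [|m] /=; first by rewrite !expr0; ring.
  by rewrite exprS; ring.
by apply/funext => z; rewrite exprS.
Qed.

Lemma wirt_prod0 s j (I : Type) (r : seq I) (P : pred I) (F : I -> 'rV[C]_n -> C) :
  (forall i, polyfun (F i)) -> (forall i, P i -> wirt s j (F i) = fun=> 0) ->
  wirt s j (fun z => \prod_(i <- r | P i) F i z) = fun=> 0.
Proof.
move=> pF F0; elim: r => [|i r IH].
  rewrite [X in wirt s j X](_ : _ = fun=> 1) ?wirt_cst//.
  by apply/funext => z; rewrite big_nil.
case Pi: (P i); last first.
  rewrite [X in wirt s j X](_ : _ = fun z => \prod_(i <- r | P i) F i z) ?IH//.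
  by apply/funext => z; rewrite big_cons Pi.
rewrite [X in wirt s j X](_ : _ = fun z => F i z * \prod_(i <- r | P i) F i z).
  rewrite wirtM//; last exact: polyfun_prod.
  by rewrite IH F0//; apply/funext => z; rewrite mulr0 mul0r addr0.
by apply/funext => z; rewrite big_cons Pi.
Qed.

Lemma mul_ii : 'i%C * 'i%C = -1 :> C.
Proof. by rewrite -expr2 sqr_i. Qed.

Lemma wirt_coord s j k :
  wirt s j (fun z => z 0 k) = fun=> (k == j)%:R * (1 + s * 'i%C) / 2.
Proof.
apply/funext => z; rewrite /wirt !(has_rderivE (has_rderiv_coord _ _ _)).
by rewrite !mxE eqxx/=; ring.
Qed.

Lemma wirt_conj s j k :
  wirt s j (fun z => (z 0 k)^*%C) = fun=> (k == j)%:R * (1 - s * 'i%C) / 2.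
Proof.
apply/funext => z.
rewrite /wirt !(has_rderivE (has_rderiv_conj (has_rderiv_coord _ _ _))).
rewrite !mxE eqxx; case: (k == j); last first.
  by rewrite !mulr0 conjc0 mulr0 addr0 !mul0r.
rewrite !mulr1 conjc1.
have -> : ('i%C : C)^*%C = - 'i%C by apply/eqP; rewrite eq_complex /= oppr0 !eqxx.
by rewrite mul1r mulrN.
Qed.

(** Induction on the construction of [f]: coordinates have constant derivatives, and for a product
    the two double Leibniz expansions agree up to the order of the terms. *)
Lemma wirtC s j t k f : polyfun f ->
  wirt s j (wirt t k f) = wirt t k (wirt s j f).
Proof.
elim=> {f} [a|l|l|f g pf IHf pg IHg|f g pf IHf pg IHg].
- by rewrite !wirt_cst.
- by rewrite !wirt_coord !wirt_cst.
- by rewrite !wirt_conj !wirt_cst.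
- rewrite !(wirtD _ _ pf pg) (wirtD _ _ (wirt_polyfun t k pf) (wirt_polyfun t k pg)).
  rewrite (wirtD _ _ (wirt_polyfun s j pf) (wirt_polyfun s j pg)).
  by rewrite IHf IHg.
- have [wf wg] := (wirt_polyfun s j pf, wirt_polyfun s j pg).
  have [vf vg] := (wirt_polyfun t k pf, wirt_polyfun t k pg).
  rewrite !(wirtM _ _ pf pg).
  rewrite (wirtD _ _ (polyfunM pf vg) (polyfunM vf pg)).
  rewrite (wirtD _ _ (polyfunM pf wg) (polyfunM wf pg)).
  rewrite (wirtM _ _ pf vg) (wirtM _ _ vf pg) (wirtM _ _ pf wg) (wirtM _ _ wf pg).
  rewrite IHf IHg; apply/funext => z; exact: wirt_leibniz2.
Qed.

Lemma two_neq0 : (2 : C) != 0.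
Proof. by rewrite pnatr_eq0. Qed.

Lemma dz_coord j k : dz j (fun z => z 0 k) = fun=> (k == j)%:R :> C.
Proof.
rewrite dzE wirt_coord; apply/funext => _.
by rewrite mulNr mul_ii opprK -mulrA divff ?mulr1// two_neq0.
Qed.

Lemma dz_conj j k : dz j (fun z => (z 0 k)^*%C) = fun=> 0 :> C.
Proof.
by rewrite dzE wirt_conj; apply/funext => _; rewrite mulNr mul_ii opprK subrr mulr0 mul0r.
Qed.

Lemma dzbar_coord j k : dzbar j (fun z => z 0 k) = fun=> 0 :> C.
Proof. by rewrite dzbarE wirt_coord; apply/funext => _; rewrite mul_ii subrr mulr0 mul0r. Qed.

Lemma dzbar_conj j k : dzbar j (fun z => (z 0 k)^*%C) = fun=> (k == j)%:R :> C.
Proof.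
rewrite dzbarE wirt_conj; apply/funext => _.
by rewrite mul_ii opprK -mulrA divff ?mulr1// two_neq0.
Qed.

End wirtinger_calculus.

(** * Bihomogeneous polynomials and Euler's identities *)

Section bihomogeneous_functions.
Variables (R : realType) (n : nat).
Local Notation C := R[i].
Implicit Types (f g : 'rV[C]_n -> C) (j k : 'I_n) (a b : 'I_n -> nat).

Lemma dz_polyfunM j f g : polyfun f -> polyfun g ->
  dz j (fun z => f z * g z) = fun z => f z * dz j g z + dz j f z * g z.
Proof. by move=> pf pg; rewrite !dzE wirtM. Qed.

Lemma dzbar_polyfunM j f g : polyfun f -> polyfun g ->
  dzbar j (fun z => f z * g z) = fun z => f z * dzbar j g z + dzbar j f z * g z.
Proof. by move=> pf pg; rewrite !dzbarE wirtM. Qed.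

Lemma monomial_polyfun a b : polyfun (@monomial R n a b).
Proof.
apply: polyfunM; apply: polyfun_prod => j; apply: polyfunX.
  exact: polyfun_coord.
exact: polyfun_conj.
Qed.

(** When [a j = 0] the subtraction truncates and [a] is unchanged; in the derivative of a monomial
    the factor [(a j)%:R] is then 0. *)
Definition decr a j k : nat := (a k - (k == j))%N.

Lemma prodX_decr (x : 'I_n -> C) a j : (0 < a j)%N ->
  \prod_k x k ^+ a k = x j * \prod_k x k ^+ decr a j k.
Proof.
move=> aj; rewrite (bigD1 j)//= [in RHS](bigD1 j)//= mulrA -exprS /decr eqxx.
rewrite subn1 prednK//; congr (_ * _); apply: eq_bigr => k /negbTE kj.
by rewrite kj subn0.
Qed.

Lemma dz_monomial j a b :
  dz j (@monomial R n a b) = fun z => (a j)%:R * monomial (decr a j) b z.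
Proof.
rewrite [in LHS]/monomial.
have pX k : polyfun (fun z : 'rV[C]_n => z 0 k ^+ a k).
  by apply: polyfunX; exact: polyfun_coord.
have pY k : polyfun (fun z : 'rV[C]_n => (z 0 k)^*%C ^+ b k).
  by apply: polyfunX; exact: polyfun_conj.
have dY : dz j (fun z : 'rV[C]_n => \prod_k (z 0 k)^*%C ^+ b k) = fun=> 0.
  rewrite dzE wirt_prod0// => k _; rewrite wirtX -?dzE ?dz_conj; last exact: polyfun_conj.
  by apply/funext => z; rewrite mulr0.
have dX : dz j (fun z : 'rV[C]_n => \prod_k z 0 k ^+ a k) =
    fun z => (a j)%:R * \prod_k z 0 k ^+ decr a j k.
  have -> : (fun z : 'rV[C]_n => \prod_k z 0 k ^+ a k) =
      fun z => z 0 j ^+ a j * \prod_(k | k != j) z 0 k ^+ a k.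
    by apply/funext => z; rewrite (bigD1 j).
  rewrite dz_polyfunM//; last exact: polyfun_prod.
  have -> : dz j (fun z : 'rV[C]_n => \prod_(k | k != j) z 0 k ^+ a k) = fun=> 0.
    rewrite dzE wirt_prod0// => k kj; rewrite wirtX -?dzE ?dz_coord; last exact: polyfun_coord.
    by apply/funext => z; rewrite (negbTE kj) mulr0.
  rewrite [dz j (fun z => z 0 j ^+ a j)]dzE wirtX -?dzE ?dz_coord; last exact: polyfun_coord.
  apply/funext => z; rewrite mulr0 add0r eqxx mulr1 [in RHS](bigD1 j)//= /decr eqxx subn1.
  rewrite mulrA; congr (_ * _ * _); apply: eq_bigr => k /negbTE kj.
  by rewrite kj subn0.
rewrite dz_polyfunM; try exact: polyfun_prod.
by rewrite dY dX; apply/funext => z; rewrite mulr0 add0r mulrA.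
Qed.

Lemma dzbar_monomial j a b :
  dzbar j (@monomial R n a b) = fun z => (b j)%:R * monomial a (decr b j) z.
Proof.
rewrite [in LHS]/monomial.
have pX k : polyfun (fun z : 'rV[C]_n => z 0 k ^+ a k).
  by apply: polyfunX; exact: polyfun_coord.
have pY k : polyfun (fun z : 'rV[C]_n => (z 0 k)^*%C ^+ b k).
  by apply: polyfunX; exact: polyfun_conj.
have dX : dzbar j (fun z : 'rV[C]_n => \prod_k z 0 k ^+ a k) = fun=> 0.
  rewrite dzbarE wirt_prod0// => k _; rewrite wirtX -?dzbarE ?dzbar_coord; last exact: polyfun_coord.
  by apply/funext => z; rewrite mulr0.
have dY : dzbar j (fun z : 'rV[C]_n => \prod_k (z 0 k)^*%C ^+ b k) =
    fun z => (b j)%:R * \prod_k (z 0 k)^*%C ^+ decr b j k.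
  have -> : (fun z : 'rV[C]_n => \prod_k (z 0 k)^*%C ^+ b k) =
      fun z => (z 0 j)^*%C ^+ b j * \prod_(k | k != j) (z 0 k)^*%C ^+ b k.
    by apply/funext => z; rewrite (bigD1 j).
  rewrite dzbar_polyfunM//; last exact: polyfun_prod.
  have -> : dzbar j (fun z : 'rV[C]_n => \prod_(k | k != j) (z 0 k)^*%C ^+ b k) = fun=> 0.
    rewrite dzbarE wirt_prod0// => k kj; rewrite wirtX -?dzbarE ?dzbar_conj; last exact: polyfun_conj.
    by apply/funext => z; rewrite (negbTE kj) mulr0.
  rewrite [dzbar j (fun z => (z 0 j)^*%C ^+ b j)]dzbarE wirtX -?dzbarE ?dzbar_conj; last exact: polyfun_conj.
  apply/funext => z; rewrite mulr0 add0r eqxx mulr1 [in RHS](bigD1 j)//= /decr eqxx subn1.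
  rewrite mulrA; congr (_ * _ * _); apply: eq_bigr => k /negbTE kj.
  by rewrite kj subn0.
rewrite dzbar_polyfunM; try exact: polyfun_prod.
by rewrite dY dX; apply/funext => z; rewrite mul0r addr0 /monomial mulrCA.
Qed.

(** The functions of [bihomogeneous], presented as finite lists of monomials with plain functions as
    exponents: this gives induction on the number of terms. *)
Inductive bihom p q : ('rV[C]_n -> C) -> Prop :=
| bihom0 : bihom p q (fun=> 0)
| bihomS c a b f : (\sum_j a j = p)%N -> (\sum_j b j = q)%N ->
    bihom p q f -> bihom p q (fun z => c * monomial a b z + f z).

Lemma eq_bihom p q f g : f =1 g -> bihom p q f -> bihom p q g.
Proof. by move=> /funext ->. Qed.

Lemma bihom_polyfun p q f : bihom p q f -> polyfun f.
Proof.
elim=> [|c a b {}f _ _ _ pf]; first exact: polyfun_cst.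
apply: polyfunD => //; apply: polyfunM; first exact: polyfun_cst.
exact: monomial_polyfun.
Qed.

Lemma bihom_mon p q c a b : (\sum_j a j = p)%N -> (\sum_j b j = q)%N ->
  bihom p q (fun z => c * monomial a b z).
Proof.
move=> ap bq; apply: eq_bihom (bihomS c ap bq (bihom0 _ _)) => z.
by rewrite addr0.
Qed.

Lemma bihomD p q f g : bihom p q f -> bihom p q g ->
  bihom p q (fun z => f z + g z).
Proof.
move=> + gpq; elim=> [|c a b {}f ap bq _ IH].
  by apply: eq_bihom gpq => z; rewrite add0r.
by apply: eq_bihom (bihomS c ap bq IH) => z; rewrite addrA.
Qed.

Lemma bihomZ p q c f : bihom p q f -> bihom p q (fun z => c * f z).
Proof.
elim=> [|d a b {}f ap bq _ IH].
  by apply: eq_bihom (bihom0 p q) => z; rewrite mulr0.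
by apply: eq_bihom (bihomS (c * d) ap bq IH) => z; rewrite mulrDr mulrA.
Qed.

Lemma bihom_sum p q (I : Type) (r : seq I) (P : pred I) (F : I -> 'rV[C]_n -> C) :
  (forall i, P i -> bihom p q (F i)) ->
  bihom p q (fun z => \sum_(i <- r | P i) F i z).
Proof.
move=> pF; elim: r => [|i r IH].
  by apply: eq_bihom (bihom0 p q) => z; rewrite big_nil.
case Pi: (P i).
  by apply: eq_bihom (bihomD (pF i Pi) IH) => z; rewrite big_cons Pi.
by apply: eq_bihom IH => z; rewrite big_cons Pi.
Qed.

Lemma monomialM a b a' b' (z : 'rV[C]_n) :
  monomial (fun k => (a k + a' k)%N) (fun k => (b k + b' k)%N) z =
  monomial a b z * monomial a' b' z.
Proof.
rewrite /monomial mulrACA; congr (_ * _); rewrite -big_split;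
  by apply: eq_bigr => j _; rewrite exprD.
Qed.

Lemma bihomM p q p' q' f g : bihom p q f -> bihom p' q' g ->
  bihom (p + p') (q + q') (fun z => f z * g z).
Proof.
move=> + gpq; elim=> [|c a b {}f ap bq _ IH].
  by apply: eq_bihom (bihom0 _ _) => z; rewrite mul0r.
suff h : bihom (p + p') (q + q') (fun z => c * monomial a b z * g z).
  by apply: eq_bihom (bihomD h IH) => z; rewrite mulrDl.
elim: {IH} gpq => [|c' a' b' {}g ap' bq' _ IH].
  by apply: eq_bihom (bihom0 _ _) => z; rewrite mulr0.
have ha : (\sum_k (a k + a' k) = p + p')%N by rewrite big_split/= ap ap'.
have hb : (\sum_k (b k + b' k) = q + q')%N by rewrite big_split/= bq bq'.
apply: eq_bihom (bihomS (c * c') ha hb IH) => z.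
by rewrite monomialM mulrDr mulrACA.
Qed.

Lemma bihomX p q f m : bihom p q f -> bihom (m * p) (m * q) (fun z => f z ^+ m).
Proof.
move=> fpq; elim: m => [|m IH].
  have h : (\sum_(j < n) 0 = 0)%N by rewrite big1.
  by apply: eq_bihom (bihom_mon 1 h h) => z; rewrite /monomial !big1 ?mulr1 ?expr0.
by apply: eq_bihom (bihomM fpq IH) => z; rewrite exprS.
Qed.

Lemma sum_delta j : (\sum_k (k == j) = 1)%N.
Proof. by rewrite (bigD1 j)//= eqxx big1 ?addn0// => k /negbTE ->. Qed.

Lemma prodX_delta (x : 'I_n -> C) j : \prod_k x k ^+ (k == j) = x j.
Proof.
by rewrite (bigD1 j)//= eqxx big1 ?mulr1// => k /negbTE ->; rewrite expr0.
Qed.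

Lemma bihom_coord j : bihom 1 0 (fun z => z 0 j).
Proof.
have h : (\sum_(j < n) 0 = 0)%N by rewrite big1.
apply: eq_bihom (bihom_mon 1 (sum_delta j) h) => z.
by rewrite /monomial prodX_delta mul1r big1 ?mulr1// => k _; rewrite expr0.
Qed.

Lemma bihom_conj j : bihom 0 1 (fun z => (z 0 j)^*%C).
Proof.
have h : (\sum_(j < n) 0 = 0)%N by rewrite big1.
apply: eq_bihom (bihom_mon 1 h (sum_delta j)) => z.
by rewrite /monomial (prodX_delta (fun k => (z 0 k)^*%C)) mul1r big1 ?mul1r// => k _; rewrite expr0.
Qed.

Lemma sum_decr a j p : (0 < a j)%N -> (\sum_k a k = p.+1)%N ->
  (\sum_k decr a j k = p)%N.
Proof.
move=> aj; rewrite (bigD1 j)//= [in X in _ -> X = _](bigD1 j)//= {1}/decr eqxx => h.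
rewrite (_ : \sum_(k | k != j) decr a j k = \sum_(k | k != j) a k)%N.
  by move: h aj; move: (\sum_(k | _) _)%N (a j) => s m; lia.
by apply: eq_bigr => k /negbTE kj; rewrite /decr kj subn0.
Qed.

Lemma dz_bihomE j c a b f : polyfun f ->
  dz j (fun z => c * monomial a b z + f z) =
  fun z => c * (a j)%:R * monomial (decr a j) b z + dz j f z.
Proof.
move=> pf; have pm := monomial_polyfun a b.
rewrite dzE (wirtD _ _ (polyfunM (polyfun_cst _ c) pm) pf) wirtZ// -!dzE.
by rewrite dz_monomial; apply/funext => z; rewrite mulrA.
Qed.

Lemma dzbar_bihomE j c a b f : polyfun f ->
  dzbar j (fun z => c * monomial a b z + f z) =
  fun z => c * (b j)%:R * monomial a (decr b j) z + dzbar j f z.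
Proof.
move=> pf; have pm := monomial_polyfun a b.
rewrite dzbarE (wirtD _ _ (polyfunM (polyfun_cst _ c) pm) pf) wirtZ// -!dzbarE.
by rewrite dzbar_monomial; apply/funext => z; rewrite mulrA.
Qed.

Lemma dz_cst0 j : dz j (fun=> 0 : C) = fun=> 0.
Proof. by rewrite dzE wirt_cst. Qed.

Lemma dzbar_cst0 j : dzbar j (fun=> 0 : C) = fun=> 0.
Proof. by rewrite dzbarE wirt_cst. Qed.

Lemma bihom_dz j p q f : bihom p.+1 q f -> bihom p q (dz j f).
Proof.
elim=> [|c a b {}f ap bq fpq IH]; first by rewrite dz_cst0; exact: bihom0.
rewrite dz_bihomE; last exact: bihom_polyfun fpq.
have [aj0|aj0] := posnP (a j).
  by apply: eq_bihom IH => z; rewrite aj0 mulr0 mul0r add0r.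
exact: bihomS (sum_decr aj0 ap) bq IH.
Qed.

Lemma bihom_dzbar j p q f : bihom p q.+1 f -> bihom p q (dzbar j f).
Proof.
elim=> [|c a b {}f ap bq fpq IH]; first by rewrite dzbar_cst0; exact: bihom0.
rewrite dzbar_bihomE; last exact: bihom_polyfun fpq.
have [aj0|aj0] := posnP (b j).
  by apply: eq_bihom IH => z; rewrite aj0 mulr0 mul0r add0r.
exact: bihomS ap (sum_decr aj0 bq) IH.
Qed.

Lemma dz_bihom0 j q f : bihom 0 q f -> dz j f = fun=> 0.
Proof.
elim=> [|c a b {}f ap bq fpq IH]; first exact: dz_cst0.
rewrite dz_bihomE ?IH; last exact: bihom_polyfun fpq.
have -> : a j = 0%N by move/eqP: ap; rewrite sum_nat_eq0 => /forallP/(_ j)/eqP.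
by apply/funext => z; rewrite mulr0 mul0r addr0.
Qed.

Lemma dzbar_bihom0 j p f : bihom p 0 f -> dzbar j f = fun=> 0.
Proof.
elim=> [|c a b {}f ap bq fpq IH]; first exact: dzbar_cst0.
rewrite dzbar_bihomE ?IH; last exact: bihom_polyfun fpq.
have -> : b j = 0%N by move/eqP: bq; rewrite sum_nat_eq0 => /forallP/(_ j)/eqP.
by apply/funext => z; rewrite mulr0 mul0r addr0.
Qed.

Lemma mul_decr (x : 'I_n -> C) a j :
  x j * ((a j)%:R * \prod_k x k ^+ decr a j k) = (a j)%:R * \prod_k x k ^+ a k.
Proof.
have [->|aj] := posnP (a j); first by rewrite !mul0r mulr0.
by rewrite (prodX_decr x aj) mulrCA.
Qed.

Let euler_aux (A : comPzRingType) (z c a x' x y : A) : z * (a * x') = a * x ->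
  z * (c * a * (x' * y)) = a * (c * (x * y)).
Proof.
move=> h; transitivity (c * (z * (a * x')) * y); first by ring.
by rewrite h; ring.
Qed.

(** Each monomial is an eigenvector of z_j dz_j with eigenvalue [a j], and these sum to p. *)
Lemma euler_dz p q f (z : 'rV[C]_n) : bihom p q f -> \sum_j z 0 j * dz j f z = p%:R * f z.
Proof.
elim=> [|c a b {}f ap bq fpq IH].
  by rewrite big1 ?mulr0// => j _; rewrite dz_cst0 mulr0.
rewrite mulrDr -{}IH -ap natr_sum mulr_suml -big_split/=.
apply: eq_bigr => j _; rewrite dz_bihomE; last exact: bihom_polyfun fpq.
rewrite mulrDr; congr (_ + _); rewrite /monomial.
by apply: euler_aux; exact: (mul_decr (fun k => z 0 k)).
Qed.

Lemma euler_dzbar p q f (z : 'rV[C]_n) : bihom p q f ->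
  \sum_j (z 0 j)^*%C * dzbar j f z = q%:R * f z.
Proof.
elim=> [|c a b {}f ap bq fpq IH].
  by rewrite big1 ?mulr0// => j _; rewrite dzbar_cst0 mulr0.
rewrite mulrDr -{}IH -bq natr_sum mulr_suml -big_split/=.
apply: eq_bigr => j _; rewrite dzbar_bihomE; last exact: bihom_polyfun fpq.
rewrite mulrDr; congr (_ + _); rewrite /monomial.
rewrite ![(\prod_k z 0 k ^+ a k) * _]mulrC.
by apply: euler_aux; exact: (mul_decr (fun k => (z 0 k)^*%C)).
Qed.

Lemma bihom00 f z w : bihom 0 0 f -> f z = f w.
Proof.
elim=> [//|c a b {}f ap bq fpq IH]; congr (_ * _ + _) => //.
have a0 k : a k = 0%N by move/eqP: ap; rewrite sum_nat_eq0 => /forallP/(_ k)/eqP.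
have b0 k : b k = 0%N by move/eqP: bq; rewrite sum_nat_eq0 => /forallP/(_ k)/eqP.
by rewrite /monomial !big1// => k _; rewrite ?a0 ?b0 expr0.
Qed.

End bihomogeneous_functions.

(** * Integration by parts and the Funk-Hecke formula *)

Section quadrature_moments.
Variables (R : realType) (n D : nat).
Local Notation C := R[i].
Implicit Types (f g : 'rV[C]_n.+1 -> C) (j k : 'I_n.+1) (a b : 'I_n.+1 -> nat).

Definition qavg m (s : seq (R * 'rV[C]_m)) (F : 'rV[C]_m -> C) : C :=
  \sum_(x <- s) x.1%:C * F x.2.

Lemma eq_qavg m (s : seq (R * 'rV[C]_m)) F G : F =1 G -> qavg s F = qavg s G.
Proof. by move=> FG; apply: eq_bigr => x _; rewrite FG. Qed.

Lemma qavgD m (s : seq (R * 'rV[C]_m)) F G :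
  qavg s (fun z => F z + G z) = qavg s F + qavg s G.
Proof. by rewrite /qavg -big_split; apply: eq_bigr => x _; rewrite mulrDr. Qed.

Lemma qavgZ m (s : seq (R * 'rV[C]_m)) c F :
  qavg s (fun z => c * F z) = c * qavg s F.
Proof. by rewrite /qavg mulr_sumr; apply: eq_bigr => x _; rewrite mulrCA. Qed.

Lemma qavg0 m (s : seq (R * 'rV[C]_m)) : qavg s (fun=> 0) = 0.
Proof. by rewrite /qavg big1// => x _; rewrite mulr0. Qed.

Lemma qavg_sum m (s : seq (R * 'rV[C]_m)) (I : Type) (r : seq I) (P : pred I)
    (F : I -> 'rV[C]_m -> C) :
  qavg s (fun z => \sum_(i <- r | P i) F i z) = \sum_(i <- r | P i) qavg s (F i).
Proof.
by rewrite /qavg exchange_big/=; apply: eq_bigr => x _; rewrite mulr_sumr.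
Qed.

(** [D] bounds the degree in z and the degree in its conjugate separately; there are [n.+1]
    coordinates. *)
Definition exact_quadrature (s : seq (R * 'rV[C]_n.+1)) : Prop :=
  (forall x, x \in s -> 0 <= x.1 /\ \sum_j x.2 0 j * (x.2 0 j)^*%C = 1) /\
  forall a b, (\sum_j a j <= D)%N -> (\sum_j b j <= D)%N ->
  qavg s (monomial a b) = [forall j, a j == b j]%:R *
  ((n`! * \prod_j (a j)`!)%:R / (n + \sum_j a j)`!%:R).

Variable s : seq (R * 'rV[C]_n.+1).
Hypothesis sD : exact_quadrature s.

Let moment a : C := (n`! * \prod_j (a j)`!)%:R / (n + \sum_j a j)`!%:R.

Lemma qavg_monomial p q a b : (\sum_j a j = p)%N -> (\sum_j b j = q)%N ->
  (p <= D)%N -> (q <= D)%N ->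
  qavg s (monomial a b) = [forall j, a j == b j]%:R * moment a.
Proof. by move=> <- <- pD qD; rewrite sD.2. Qed.

Definition incr a j k : nat := (a k + (k == j))%N.

Lemma decrK a j : (0 < a j)%N -> incr (decr a j) j =1 a.
Proof.
move=> aj k; rewrite /incr /decr; case: eqP => [->|_]; last by rewrite subn0 addn0.
by rewrite subnK.
Qed.

Lemma sum_incr a j p : (\sum_k a k = p)%N -> (\sum_k incr a j k = p.+1)%N.
Proof. by move=> <-; rewrite big_split/= sum_delta addn1. Qed.

Lemma prod_fact_incr a j :
  (\prod_k (incr a j k)`! = (incr a j j) * \prod_k (a k)`!)%N.
Proof.
rewrite (bigD1 j)//= [in RHS](bigD1 j)//= /incr eqxx addn1 factS -mulnA.
by congr (_ * (_ * _))%N; apply: eq_bigr => k /negbTE ->; rewrite addn0.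
Qed.

(** The recursion of the Dirichlet moments; read on monomials, it is integration by parts on the
    sphere. *)
Lemma moment_incr a j m : (\sum_k a k = m)%N ->
  (n + m.+1)%:R * moment (incr a j) = (incr a j j)%:R * moment a.
Proof.
move=> am; rewrite /moment prod_fact_incr (sum_incr j am) am addnS factS !natrM.
have f0 : (((n + m)`!)%:R : C) != 0 by rewrite pnatr_eq0 -lt0n fact_gt0.
have f1 : ((n + m).+1%:R : C) != 0 by rewrite pnatr_eq0.
move: f0 f1; move: (_%:R : C) ((n + m).+1%:R : C) => x y x0 y0.
move: (\prod_k _)%N => P.
by field; rewrite ?x0 ?y0.
Qed.

Lemma eq_incr a b j : [forall k, a k == incr b j k] =
  (0 < a j)%N && [forall k, decr a j k == b k].
Proof.
apply/forallP/andP => [ab|[aj /forallP ab] k].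
  split; first by rewrite (eqP (ab j)) /incr eqxx addn1.
  by apply/forallP => k; rewrite /decr (eqP (ab k)) /incr addnK.
by rewrite /incr -(eqP (ab k)) -[in X in _ == X]/(incr (decr a j) j k) decrK.
Qed.

Lemma prodX_incr (x : 'I_n.+1 -> C) a j :
  \prod_k x k ^+ incr a j k = x j * \prod_k x k ^+ a k.
Proof.
rewrite -[in RHS](prodX_delta x j) -big_split.
by apply: eq_bigr => k _; rewrite /incr addnC exprD.
Qed.

Lemma monomial_incrl a b j (z : 'rV[C]_n.+1) :
  monomial (incr a j) b z = z 0 j * monomial a b z.
Proof. by rewrite /monomial prodX_incr mulrA. Qed.

Lemma monomial_incrr a b j (z : 'rV[C]_n.+1) :
  monomial a (incr b j) z = (z 0 j)^*%C * monomial a b z.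
Proof. by rewrite /monomial (prodX_incr (fun k => (z 0 k)^*%C)) mulrCA. Qed.

Lemma eq_moment a b : a =1 b -> moment a = moment b.
Proof. by move=> /funext ->. Qed.

(* Integration by parts on the sphere. *)
Lemma qavg_mul_conj j m f : bihom m.+1 m f -> (m < D)%N ->
  (n + m.+1)%:R * qavg s (fun z => (z 0 j)^*%C * f z) = qavg s (dz j f).
Proof.
move=> + mD; elim=> [|c a b {}f am bm fm IH].
  rewrite dz_cst0 qavg0 (@eq_qavg n.+1 s _ (fun=> 0)) ?qavg0 ?mulr0// => z.
  by rewrite mulr0.
rewrite dz_bihomE; last exact: bihom_polyfun fm.
rewrite qavgD -IH (@eq_qavg n.+1 s _ (fun z =>
    c * monomial a (incr b j) z + (z 0 j)^*%C * f z)); last first.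
  by move=> z; rewrite mulrDr monomial_incrr mulrCA.
rewrite qavgD mulrDr; congr (_ + _).
rewrite !qavgZ mulrCA -mulrA; congr (_ * _).
rewrite (qavg_monomial am (sum_incr j bm))// eq_incr.
have [->|aj] := posnP (a j); first by rewrite !mul0r mulr0.
rewrite (qavg_monomial (sum_decr aj am) bm) 1?ltnW// mulrCA [RHS]mulrCA; congr (_ * _).
rewrite -(eq_moment (decrK aj)) moment_incr ?(sum_decr aj am)//.
by rewrite decrK.
Qed.

Lemma qavg_mul_coord j m f : bihom m m.+1 f -> (m < D)%N ->
  (n + m.+1)%:R * qavg s (fun z => z 0 j * f z) = qavg s (dzbar j f).
Proof.
move=> + mD; elim=> [|c a b {}f am bm fm IH].
  rewrite dzbar_cst0 qavg0 (@eq_qavg n.+1 s _ (fun=> 0)) ?qavg0 ?mulr0// => z.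
  by rewrite mulr0.
rewrite dzbar_bihomE; last exact: bihom_polyfun fm.
rewrite qavgD -IH (@eq_qavg n.+1 s _ (fun z =>
    c * monomial (incr a j) b z + z 0 j * f z)); last first.
  by move=> z; rewrite mulrDr monomial_incrl mulrCA.
rewrite qavgD mulrDr; congr (_ + _).
rewrite !qavgZ mulrCA -mulrA; congr (_ * _).
have symb a' b' : [forall k, a' k == b' k] = [forall k, b' k == a' k :> nat].
  by apply: eq_forallb => k; rewrite eq_sym.
rewrite (qavg_monomial (sum_incr j am) bm)// symb eq_incr.
have [->|bj] := posnP (b j); first by rewrite !mul0r mulr0.
rewrite (qavg_monomial am (sum_decr bj bm)) 1?ltnW// symb.
case: forallP => /= [ba|_]; last by rewrite !mul0r !mulr0.
rewrite !mul1r moment_incr//; congr (_%:R * _).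
by rewrite -(decrK bj j) /incr (eqP (ba j)).
Qed.

End quadrature_moments.

(** * The Hermitian product and directional derivatives *)

Section inner_product.
Variables (R : realType) (n : nat).
Local Notation C := R[i].
Implicit Types (f g : 'rV[C]_n -> C) (j k : 'I_n) (a b : nat) (z w : 'rV[C]_n).

Definition cdot m (z w : 'rV[C]_m) : C := \sum_j z 0 j * (w 0 j)^*%C.

Lemma bihom_cdotl w : bihom 1 0 (fun z : 'rV[C]_n => cdot z w).
Proof.
have h : bihom 1 0 (fun z : 'rV[C]_n => \sum_j (w 0 j)^*%C * z 0 j).
  by apply: (@bihom_sum _ _ _ _ _ _ _ (fun j z => (w 0 j)^*%C * z 0 j)) => j _; exact/bihomZ/bihom_coord.
by apply: eq_bihom h => z; apply: eq_bigr => j _; rewrite mulrC.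
Qed.

Lemma bihom_cdotr w : bihom 0 1 (fun z : 'rV[C]_n => cdot w z).
Proof.
by apply: (@bihom_sum _ _ _ _ _ _ _ (fun j z => w 0 j * (z 0 j)^*%C)) => j _; exact/bihomZ/bihom_conj.
Qed.

Lemma dz_cdotl j w : dz j (fun z : 'rV[C]_n => cdot z w) = fun=> (w 0 j)^*%C.
Proof.
rewrite dzE wirt_sum => [|k]; last first.
  by apply: polyfunM; [exact: polyfun_coord|exact: polyfun_cst].
apply/funext => z; rewrite (bigD1 j)//= big1 ?addr0 => [|k kj];
  rewrite (wirtM _ _ (polyfun_coord _ _) (polyfun_cst _ _)) wirt_cst -dzE dz_coord.
  by rewrite eqxx mul1r mulr0 add0r.
by rewrite (negbTE kj) mul0r mulr0 add0r.
Qed.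

Lemma dzbar_cdotl j w : dzbar j (fun z : 'rV[C]_n => cdot z w) = fun=> 0.
Proof. exact: dzbar_bihom0 (bihom_cdotl w). Qed.

Lemma dz_cdotr j w : dz j (fun z : 'rV[C]_n => cdot w z) = fun=> 0.
Proof. exact: dz_bihom0 (bihom_cdotr w). Qed.

Lemma dzbar_cdotr j w : dzbar j (fun z : 'rV[C]_n => cdot w z) = fun=> w 0 j.
Proof.
rewrite dzbarE wirt_sum => [|k]; last first.
  by apply: polyfunM; [exact: polyfun_cst|exact: polyfun_conj].
apply/funext => z; rewrite (bigD1 j)//= big1 ?addr0 => [|k kj];
  rewrite (wirtM _ _ (polyfun_cst _ _) (polyfun_conj _ _)) wirt_cst -dzbarE dzbar_conj.
  by rewrite eqxx mulr1 mul0r addr0.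
by rewrite (negbTE kj) mulr0 mul0r add0r.
Qed.

Definition harmonic_fun f := forall z, \sum_j dz j (dzbar j f) z = 0.

Lemma dz_dzbarC j k f : polyfun f -> dz j (dzbar k f) = dzbar k (dz j f).
Proof. by move=> pf; rewrite dzbarE !dzE wirtC. Qed.

Lemma dz_dzC j k f : polyfun f -> dz j (dz k f) = dz k (dz j f).
Proof. by move=> pf; rewrite !dzE wirtC. Qed.

Definition dir_dz w f z : C := \sum_j w 0 j * dz j f z.

Lemma dir_dz_bihom w p q f : bihom p.+1 q f -> bihom p q (dir_dz w f).
Proof. by move=> fpq; rewrite /dir_dz; apply: bihom_sum => j _; apply/bihomZ/bihom_dz. Qed.

(** A constant-coefficient derivative commutes with the Laplacian. *)
Lemma harmonic_dir_dz w f : polyfun f -> harmonic_fun f -> harmonic_fun (dir_dz w f).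
Proof.
move=> pf hf z.
have pfk k : polyfun (fun z => w 0 k * dz k f z).
  by apply: polyfunM; [exact: polyfun_cst|exact: dz_polyfun].
have E j : dz j (dzbar j (dir_dz w f)) z = \sum_k w 0 k * dz k (dz j (dzbar j f)) z.
  rewrite dzbarE /dir_dz wirt_sum// dzE wirt_sum => [|k]; last exact: wirt_polyfun.
  apply: eq_bigr => k _; rewrite (wirtZ _ _ _ (dz_polyfun k pf)).
  rewrite wirtZ; last exact/wirt_polyfun/dz_polyfun.
  by rewrite -dzE -dzbarE -(dz_dzbarC _ _ pf) dz_dzC//; exact: dzbar_polyfun.
rewrite (eq_bigr _ (fun j _ => E j)) exchange_big/= big1// => k _.
rewrite -mulr_sumr.
have -> : \sum_j dz k (dz j (dzbar j f)) z = dz k (fun z => \sum_j dz j (dzbar j f) z) z.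
  rewrite [in RHS]dzE wirt_sum => [|j]; last exact/dz_polyfun/dzbar_polyfun.
  by apply: eq_bigr => j _; rewrite -dzE.
have -> : (fun z => \sum_j dz j (dzbar j f) z) = fun=> 0 by apply/funext.
by rewrite dz_cst0 mulr0.
Qed.

Lemma bihom_castM p q f a b g p' q' : bihom p q f -> bihom a b g ->
  (p + a = p')%N -> (q + b = q')%N -> bihom p' q' (fun z => f z * g z).
Proof. by move=> fpq gab <- <-; exact: bihomM. Qed.

Lemma bihom_cdotlX w b : bihom b 0 (fun z : 'rV[C]_n => cdot z w ^+ b).
Proof. by have := bihomX b (bihom_cdotl w); rewrite muln1 muln0. Qed.

Lemma bihom_cdotrX w b : bihom 0 b (fun z : 'rV[C]_n => cdot w z ^+ b).
Proof. by have := bihomX b (bihom_cdotr w); rewrite muln1 muln0. Qed.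

End inner_product.

(** * The Funk-Hecke formula *)

Section funk_hecke.
Variables (R : realType) (n D : nat).
Local Notation C := R[i].
Implicit Types (f g : 'rV[C]_n.+1 -> C) (a b : nat) (z w : 'rV[C]_n.+1).

Variable s : seq (R * 'rV[C]_n.+1).
Hypothesis sD : exact_quadrature D s.

Let fact_neq0 k : (k`!%:R : C) != 0.
Proof. by rewrite pnatr_eq0 -lt0n fact_gt0. Qed.

Let nS_neq0 m : ((n + m.+1)%:R : C) != 0.
Proof. by rewrite addnS pnatr_eq0. Qed.

(** Euler's identity turns (p+1) f into the sum of the z_j dz_j f. Integrating by parts against z_j
    applies [dzbar j], which kills the holomorphic power of [cdot z w] and builds the Laplacian of
    [f]. *)
Lemma qavg_harmonic_cdotlX p b f w : bihom p.+1 (p.+1 + b) f -> harmonic_fun f ->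
  (p.+1 + b <= D)%N -> qavg s (fun z => f z * cdot z w ^+ b) = 0.
Proof.
move=> fpb hf pbD.
have pf := bihom_polyfun fpb; have vb := bihom_cdotlX w b.
have Gj j : bihom (p + b) (p + b).+1 (fun z => dz j f z * cdot z w ^+ b).
  exact: (bihom_castM (bihom_dz j fpb) vb erefl (addn0 _)).
apply: (mulfI (nS_neq0 (p + b))); apply: (@mulfI _ p.+1%:R).
  by rewrite pnatr_eq0.
rewrite !mulr0 mulrCA -qavgZ (@eq_qavg _ _ s _ (fun z => \sum_j
    z 0 j * (dz j f z * cdot z w ^+ b))); last first.
  move=> z; rewrite mulrA -(euler_dz z fpb) mulr_suml.
  by apply: eq_bigr => j _; rewrite mulrA.
rewrite qavg_sum mulr_sumr (eq_bigr (fun j => qavg s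
    (fun z => dz j (dzbar j f) z * cdot z w ^+ b))); last first.
  move=> j _; rewrite (qavg_mul_coord sD j (Gj j))//; apply: eq_qavg => z.
  rewrite dzbar_polyfunM; [|exact: dz_polyfun|exact: bihom_polyfun vb].
  rewrite -(dz_dzbarC _ _ pf) dzbarE wirtX; last exact: bihom_polyfun (bihom_cdotl w).
  by rewrite -dzbarE dzbar_cdotl !mulr0 add0r.
rewrite -qavg_sum (@eq_qavg _ _ s _ (fun=> 0)) ?qavg0// => z.
by rewrite -mulr_suml hf mul0r.
Qed.

Lemma qavg_cst c : qavg s (fun=> c) = c.
Proof.
have h : (\sum_(j < n.+1) 0 = 0)%N by rewrite big1.
rewrite (@eq_qavg _ _ s _ (fun z => c * monomial (fun=> 0%N) (fun=> 0%N) z)).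
  rewrite qavgZ (qavg_monomial sD h h)//; have -> : [forall k : 'I_n.+1, 0 == 0 :> nat]%N by apply/forallP.
  rewrite h addn0 big1 ?muln1// divff ?mulr1//.
by move=> z; rewrite /monomial !big1 ?mulr1.
Qed.

(** One factor [cdot z w] is expanded and integrated by parts; the [dzbar j] fall on [f] alone, and
    Euler's identity at [w] evaluates what the induction returns. *)
Lemma qavg_antiholomorphic b f w : bihom 0 b f -> (b <= D)%N ->
  qavg s (fun z => f z * cdot z w ^+ b) =
  (n`! * b`!)%:R / (n + b)`!%:R * f w.
Proof.
elim: b f => [|b IH] f fb bD.
  rewrite (@eq_qavg _ _ s _ (fun=> f w)) ?qavg_cst => [|z].
    by rewrite muln1 addn0 divff ?mul1r.
  by rewrite expr0 mulr1 (bihom00 _ w fb).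
have pf := bihom_polyfun fb; have vb := bihom_cdotlX w b.
have Gb : bihom b b.+1 (fun z => f z * cdot z w ^+ b).
  exact: (bihom_castM fb vb erefl (addn0 _)).
apply: (mulfI (nS_neq0 b)).
rewrite (@eq_qavg _ _ s _ (fun z => \sum_j (w 0 j)^*%C *
    (z 0 j * (f z * cdot z w ^+ b)))); last first.
  move=> z; rewrite exprS mulrCA {1}/cdot mulr_suml; apply: eq_bigr => j _.
  by rewrite -mulrA mulrCA.
rewrite qavg_sum mulr_sumr (eq_bigr (fun j => qavg s
    (fun z => (w 0 j)^*%C * dzbar j f z * cdot z w ^+ b))); last first.
  move=> j _; rewrite qavgZ mulrCA (qavg_mul_coord sD j Gb)// -qavgZ.
  apply: eq_qavg => z; rewrite dzbar_polyfunM//; last exact: bihom_polyfun vb.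
  rewrite [dzbar j (fun z => cdot z w ^+ b)]dzbarE wirtX; last exact: bihom_polyfun (bihom_cdotl w).
  by rewrite -dzbarE dzbar_cdotl !mulr0 add0r mulrA.
rewrite -qavg_sum (@eq_qavg _ _ s _ (fun z =>
    (\sum_j (w 0 j)^*%C * dzbar j f z) * cdot z w ^+ b)); last first.
  by move=> z; rewrite mulr_suml.
rewrite IH; first last.
- exact: ltnW.
- by apply: bihom_sum => j _; apply/bihomZ/bihom_dzbar.
rewrite (euler_dzbar w fb) addnS !factS !natrM.
have := nS_neq0 b; have := fact_neq0 (n + b); rewrite addnS.
move: ((n + b)`!%:R : C) ((n + b).+1%:R : C) => x y x0 y0.
by field; rewrite ?x0 ?y0.
Qed.

(** 1/(a-p)! with the convention that it is 0 for p > a, which keeps the recursion used in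
    [funk_hecke] uniform. *)
Definition fact_quot p a : C := if (p <= a)%N then ((a - p)`!%:R)^-1 else 0.

(** The hypothesis [p + b = q + a] says that the integrand has equal degrees in z and its conjugate.
    Induction on [a]: one factor [cdot w z] is expanded and integrated by parts. Each [dz j] falls
    on [f], giving [dir_dz w f] of bidegree (p-1, q), or on [cdot z w ^+ b], lowering [b]; the
    powers of [cdot w z] are antiholomorphic. The two previous lemmas are the case a = 0, for p > 0
    and p = 0. *)
Theorem funk_hecke a b p q f w : bihom p q f -> harmonic_fun f -> cdot w w = 1 ->
  (p + b = q + a)%N -> (p + b <= D)%N ->
  qavg s (fun z => f z * (cdot w z ^+ a * cdot z w ^+ b)) =
  (n`! * a`! * b`!)%:R / (n + (p + b))`!%:R * fact_quot p a * f w.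
Proof.
move=> + + w1; elim: a p q b f => [|a IH] p q b f fpq hf pbqa pbD.
  rewrite (@eq_qavg _ _ s _ (fun z => f z * cdot z w ^+ b)); last first.
    by move=> z; rewrite expr0 mul1r.
  rewrite addn0 in pbqa; rewrite -{q}pbqa in fpq.
  case: p => [|p] in fpq pbD *.
    rewrite qavg_antiholomorphic//.
    by rewrite /fact_quot/= invr1 mulr1 add0n fact0 muln1.
  by rewrite (qavg_harmonic_cdotlX w fpq)// /fact_quot/= mulr0 mul0r.
have pf := bihom_polyfun fpq.
have ua := bihom_cdotrX w a; have vb := bihom_cdotlX w b.
have puv : polyfun (fun z : 'rV[C]_n.+1 => cdot w z ^+ a * cdot z w ^+ b).
  exact: polyfunM (bihom_polyfun ua) (bihom_polyfun vb).
have pqa : (p + b = (q + a).+1)%N by rewrite pbqa addnS.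
have Guv : bihom (q + a).+1 (q + a) (fun z => f z * (cdot w z ^+ a * cdot z w ^+ b)).
  apply: (bihom_castM fpq (bihomM ua vb)); first by rewrite add0n.
  by rewrite addn0.
rewrite pqa; apply: (mulfI (nS_neq0 (q + a))).
rewrite (@eq_qavg _ _ s _ (fun z => \sum_j w 0 j *
    ((z 0 j)^*%C * (f z * (cdot w z ^+ a * cdot z w ^+ b))))); last first.
  move=> z; rewrite exprS -mulrA mulrCA {1}/cdot mulr_suml; apply: eq_bigr => j _.
  by rewrite -mulrA.
rewrite qavg_sum mulr_sumr (eq_bigr (fun j => qavg s (fun z =>
    w 0 j * dz j f z * (cdot w z ^+ a * cdot z w ^+ b)) +
    b%:R * (w 0 j * (w 0 j)^*%C) * qavg s (fun z =>
      f z * (cdot w z ^+ a * cdot z w ^+ b.-1)))); last first.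
  move=> j _; rewrite qavgZ mulrCA (qavg_mul_conj sD j Guv) -?pqa// -qavgZ -qavgZ -qavgD.
  apply: eq_qavg => z; rewrite (dz_polyfunM _ pf puv).
  rewrite [dz j (fun z => _ * cdot z w ^+ b)]dz_polyfunM; [|exact: bihom_polyfun ua|exact: bihom_polyfun vb].
  rewrite [dz j (fun z => cdot w z ^+ a)]dzE wirtX; last exact: bihom_polyfun (bihom_cdotr w).
  rewrite [dz j (fun z => cdot z w ^+ b)]dzE wirtX; last exact: bihom_polyfun (bihom_cdotl w).
  rewrite -!dzE dz_cdotr dz_cdotl.
  move: (cdot w z) (cdot z w) (f z) (dz j f z) (w 0 j) (w 0 j)^*%C => x1 x2 x3 x4 x5 x6.
  move: (x1 ^+ a) (x2 ^+ b) (x2 ^+ b.-1) (x1 ^+ a.-1) (a%:R : C) (b%:R : C).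
  by move=> *; ring.
rewrite big_split/= -mulr_suml -mulr_sumr -[\sum_j w 0 j * _]/(cdot w w) w1 mulr1.
rewrite -qavg_sum (@eq_qavg _ _ s _ (fun z =>
    dir_dz w f z * (cdot w z ^+ a * cdot z w ^+ b))); last first.
  by move=> z; rewrite -mulr_suml.
(* For b = 0 the balance gives p = q + a + 1 > a, so [fact_quot p a] vanishes together with the
   left-hand side. *)
have T2 : b%:R * qavg s (fun z => f z * (cdot w z ^+ a * cdot z w ^+ b.-1)) =
    (n`! * a`! * b`!)%:R / (n + (q + a))`!%:R * fact_quot p a * f w.
  case: b => [|b] in pbqa pqa pbD {Guv vb puv} *.
    rewrite mul0r /fact_quot leqNgt (_ : (a < p)%N) ?mulr0 ?mul0r//.
    by rewrite -(addn0 p) pqa ltnS leq_addl.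
  have pqa' : (p + b = q + a)%N by apply: succn_inj; rewrite -addnS.
  rewrite (IH _ _ _ _ fpq hf pqa'); last by rewrite (leq_trans _ pbD)// leq_add2l.
  by rewrite pqa' factS !natrM; ring.
rewrite {}T2.
have -> : qavg s (fun z => dir_dz w f z * (cdot w z ^+ a * cdot z w ^+ b)) =
    (n`! * a`! * b`!)%:R / (n + (q + a))`!%:R *
    (if p is p'.+1 then p%:R * fact_quot p' a else 0) * f w.
  case: p => [|p] in fpq pbqa pqa pbD *.
    rewrite mulr0 mul0r -[RHS](@qavg0 _ _ s); apply: eq_qavg => z.
    by rewrite /dir_dz big1 ?mul0r// => j _; rewrite (dz_bihom0 j fpq) mulr0.
  have pqa' : (p + b = q + a)%N by apply: succn_inj; rewrite -addSn.
  rewrite (IH _ _ _ _ (dir_dz_bihom w fpq) (harmonic_dir_dz w pf hf) pqa').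
    by rewrite pqa' /dir_dz (euler_dz w fpq); ring.
  by rewrite (leq_trans _ pbD)// addSn.
rewrite -mulrDl -mulrDr.
(* p/(a-p+1)! + 1/(a-p)! = (a+1)/(a+1-p)!, with the boundary cases p = 0, p = a + 1 and p > a + 1
   absorbed by the convention. *)
have -> : (if p is p'.+1 then p%:R * fact_quot p' a else 0) + fact_quot p a =
    a.+1%:R * fact_quot p a.+1 :> C.
  rewrite /fact_quot; case: p {fpq pbqa pqa pbD} => [|p].
    rewrite !subn0 factS natrM invfM mulrA divff ?pnatr_eq0// mul1r add0r.
    by [].
  rewrite ltnS; case: (ltngtP p a) => [pa|pa|->].
  - rewrite subSS -(subnSK pa) factS natrM invfM.
    have : ((a - p.+1).+1%:R : C) != 0 by rewrite pnatr_eq0.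
    have -> : (a.+1%:R : C) = p.+1%:R + (a - p.+1).+1%:R.
      by rewrite -natrD; congr (_%:R); lia.
    move: ((a - p.+1).+1%:R : C) (((a - p.+1)`!%:R : C)) => x y x0.
    rewrite mulrDl; congr (_ + _); rewrite mulrA divff ?mul1r//.
  - by rewrite mulr0 addr0 mulr0.
  - by rewrite subnn subSS subnn addr0.
rewrite addnS !factS !natrM.
have := nS_neq0 (q + a); have := fact_neq0 (n + (q + a)); rewrite addnS.
move: ((n + (q + a))`!%:R : C) ((n + (q + a)).+1%:R : C) => x y x0 y0.
move: (n`!%:R : C) (a`!%:R : C) (b`!%:R : C) (a.+1%:R : C) (f w) (fact_quot p a.+1).
by move=> *; field; rewrite ?x0 ?y0.
Qed.

End funk_hecke.

(** * Jacobi polynomials on [0, 1] *)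

Section jacobi_explicit.
Variables (R : realType) (al d m : nat).
Implicit Types (p q : {poly R}) (t : R).

Lemma derivnM p q k :
  derivn k (p * q) = \sum_(i < k.+1) ('C(k, i))%:R *: (derivn i p * derivn (k - i) q).
Proof.
elim: k => [|k IH].
  by rewrite big_ord1 !derivn0 bin0 scale1r.
rewrite derivnS IH raddf_sum.
under eq_bigr do rewrite /= derivZ derivM scalerDr -!derivnS.
rewrite big_split/= big_ord_recr [in X in _ + X = _]big_ord_recl.
rewrite [in RHS]big_ord_recl [in RHS]big_ord_recr/=.
rewrite addrCA [X in _ + X]addrAC; congr (_ + (_ + _)).
- by rewrite !bin0 !subn0.
- rewrite -big_split/=; apply: eq_bigr => i _.
  rewrite /bump /= !add1n binS natrD scalerDl addrC subSS; congr (_ + _).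
  by rewrite -(subnSK (ltn_ord i)) derivnS.
- by rewrite !binn !subnn.
Qed.

Lemma derivn_onemX A k : (k <= A)%N ->
  derivn k ((1 - 'X) ^+ A : {poly R}) =
  ((- 1) ^+ k * (A ^_ k)%:R) *: (1 - 'X) ^+ (A - k).
Proof.
elim: k => [|k IH] kA; first by rewrite derivn0 expr0 mul1r ffactn0 scale1r subn0.
rewrite derivnS IH ?(ltnW kA)// derivZ deriv_exp derivB derivC derivX sub0r.
rewrite -(subnSK kA)/= mulN1r mulNrn -(scaler_nat (A - k.+1).+1 ((1 - 'X) ^+ (A - k.+1))).
rewrite scalerN -scaleNr scalerA.
by rewrite ffactnSr natrM exprS -(subnSK kA) mulN1r mulrA !mulNr.
Qed.

Lemma derivn_X A k : (k <= A)%N ->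
  derivn k ('X^A : {poly R}) = (A ^_ k)%:R *: 'X^(A - k).
Proof. by move=> _; rewrite derivnXn scaler_nat. Qed.

(* Values at [2 t - 1] of the Jacobi polynomial of degree m with parameters
   al and d, in the form given by Leibniz' rule. *)
Definition jac : {poly R} := \sum_(k < m.+1)
  ('C(m + al, m - k) * 'C(m + d, k))%:R *: (('X - 1) ^+ k * 'X^(m - k)).

Definition jac_weight : {poly R} := 'X^(d + m) * (1 - 'X) ^+ (al + m).

(** Leibniz' rule with the summation index reversed, [k] being sent to [m - k]; the falling
    factorials are binomials times factorials. *)
Lemma jac_rodrigues : derivn m jac_weight =
  ((- 1) ^+ m * m`!%:R) *: ('X^d * (1 - 'X) ^+ al * jac).
Proof.
rewrite /jac_weight mulrC derivnM /jac mulr_sumr scaler_sumr.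
rewrite (reindex_inj rev_ord_inj)/=; apply: eq_bigr => -[k /= km] _.
rewrite subSS subKn -1?ltnS// derivn_onemX; last first.
  by rewrite (leq_trans (leq_subr _ _))// leq_addl.
rewrite derivn_X; last by rewrite (leq_trans _ (leq_addl _ _))// -ltnS.
rewrite -!scalerAl -!scalerAr !scalerA.
have -> : (al + m - (m - k) = al + k)%N by lia.
have -> : (d + m - k = d + (m - k))%N by lia.
rewrite !exprD.
have -> : ('X - 1 : {poly R}) ^+ k = (- 1) ^+ k *: (1 - 'X) ^+ k.
  by rewrite -opprB -scaleN1r exprZn.
have -> : 'X^d * (1 - 'X) ^+ al * ((- 1) ^+ k *: (1 - 'X) ^+ k * 'X^(m - k)) =
    (- 1) ^+ k *: ('X^d * (1 - 'X) ^+ al * ((1 - 'X) ^+ k * 'X^(m - k))) :> {poly R}.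
  by rewrite -[in LHS]scalerAl -[LHS]scalerAr.
rewrite scalerA.
have -> : (- 1) ^+ m = (- 1) ^+ (m - k) * (- 1) ^+ k :> R.
  by rewrite -exprD subnK// -ltnS.
have -> : (m`!%:R : R) = 'C(m, m - k)%:R * (m - k)`!%:R * k`!%:R.
  rewrite -!natrM bin_sub -1?ltnS//; congr (_%:R).
  by rewrite -(@bin_fact m k) -1?ltnS// mulnAC mulnA.
rewrite -!bin_ffact !natrM [(al + m)%N]addnC [(d + m)%N]addnC.
have sk : (- 1) ^+ k * (- 1) ^+ k = 1 :> R by rewrite -exprMn mulrNN mulr1 expr1n.
set x := 'C(m, m - k)%:R; set b1 := 'C(m + al, m - k)%:R; set b2 := 'C(m + d, k)%:R.
set e := (-1) ^+ (m - k); set f1 := (m - k)`!%:R; set f2 := k`!%:R.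
congr (_ *: _); last by rewrite mulrACA [_ * 'X^d]mulrC.
have -> : e * (- 1) ^+ k * (x * f1 * f2) * (b1 * b2) * (- 1) ^+ k =
   x * (e * (b1 * f1)) * (b2 * f2) * ((- 1) ^+ k * (- 1) ^+ k).
  by clearbody x b1 b2 e f1 f2; ring.
by rewrite sk mulr1.
Qed.

Lemma jac_weight_root k a : (k < m)%N -> (a == 0) || (a == 1) ->
  root (derivn k jac_weight) a.
Proof.
move=> km a01; suff [N [g [kN ->]]] : exists N g, (k < N)%N /\
    jac_weight = ('X - a%:P) ^+ N * g.
  have [h ->] := derivn_XsubCX_dvd a g (ltnW kN).
  by rewrite -(subnSK kN) rootM root_exp_XsubC eqxx.
have /orP[/eqP->|/eqP->] := a01.
  exists (d + m)%N, ((1 - 'X) ^+ (al + m)); split; first by rewrite (leq_trans km)// leq_addl.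
  by rewrite subr0.
exists (al + m)%N, ((- 1) ^+ (al + m) * 'X^(d + m)); split.
  by rewrite (leq_trans km)// leq_addl.
by rewrite mulrA -exprMn mulrN1 opprB mulrC.
Qed.

Lemma pint_derivn_jac_weight k q : (k <= m)%N ->
  pint (derivn k jac_weight * q) = (- 1) ^+ k * pint (jac_weight * derivn k q).
Proof.
elim: k q => [|k IH] q km; first by rewrite !derivn0 expr0 mul1r.
rewrite derivnS pint_by_parts ?IH 1?ltnW//.
- by rewrite exprS mulN1r mulNr derivSn.
- by rewrite hornerM (eqP (jac_weight_root km _)) ?mul0r// eqxx.
- by rewrite hornerM (eqP (jac_weight_root km _)) ?mul0r// eqxx orbT.
Qed.

(** m integrations by parts; their sign cancels the one in Rodrigues' formula. *)
Lemma pint_jac q : pint ('X^d * (1 - 'X) ^+ al * jac * q) =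
  m`!%:R^-1 * pint (jac_weight * derivn m q).
Proof.
have m0 : (m`!%:R : R) != 0 by rewrite pnatr_eq0 -lt0n fact_gt0.
have s0 : ((- 1) ^+ m * m`!%:R : R) != 0 by rewrite mulf_neq0// signr_eq0.
apply: (mulfI s0); rewrite -pintZ scalerAl -jac_rodrigues pint_derivn_jac_weight//.
by rewrite -[RHS]mulrA mulVKf.
Qed.

Lemma pint_jacXn j : pint ('X^d * (1 - 'X) ^+ al * jac * 'X^j) =
  if (m <= j)%N then (j`! * (d + j)`! * (al + m)`!)%:R /
    (m`! * (j - m)`! * (al + m + d + j).+1`!)%:R else 0.
Proof.
rewrite pint_jac; have f0 k : (k`!%:R : R) != 0 by rewrite pnatr_eq0 -lt0n fact_gt0.
case: leqP => [mj|jm]; last first.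
  rewrite derivnXn ffact_small// mulr0n mulr0.
  by rewrite pint0 mulr0.
rewrite derivn_X// -scalerAr pintZ /jac_weight mulrAC -exprD pint_beta.
have -> : (d + m + (j - m) = d + j)%N by lia.
have -> : (d + j + (al + m) = al + m + d + j)%N by lia.
have -> : ((j ^_ m)%:R : R) = j`!%:R / (j - m)`!%:R.
  by rewrite -(ffact_fact mj) natrM mulfK.
move: (f0 m) (f0 (j - m)%N) (f0 (al + m + d + j).+1).
move: (m`!) ((j - m)`!) ((al + m + d + j).+1`!) => x y z x0 y0 z0.
by rewrite !natrM; field; rewrite ?x0 ?y0 ?z0.
Qed.

Lemma jac1 : jac.[1] = 'C(m + al, m)%:R.
Proof.
rewrite /jac horner_sum big_ord_recl big1 ?addr0 => [|i _].
  by rewrite hornerZ hornerM hornerXn horner_exp expr0 expr1n !mulr1 /= subn0 bin0 muln1.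
by rewrite hornerZ hornerM horner_exp -polyC1 hornerXsubC subrr expr0n/= mul0r mulr0.
Qed.

Lemma size_jac : (size jac <= m.+1)%N.
Proof.
rewrite /jac (leq_trans (size_sum _ _ _))//; apply/bigmax_leqP => -[k km] _ /=.
rewrite (leq_trans (size_scale_leq _ _))// (leq_trans (size_polyMleq _ _))//.
by rewrite -polyC1 size_exp_XsubC size_polyXn; lia.
Qed.

(** Every [('X - 1)^k * 'X^(m - k)] is monic of degree m, so the coefficients add up by
    Vandermonde's identity. *)
Lemma jac_lead : jac`_m = 'C(m + m + al + d, m)%:R.
Proof.
rewrite /jac coef_sum.
transitivity (\sum_(k < m.+1) (('C(m + al, m - k) * 'C(m + d, k))%:R : R)).
  apply: eq_bigr => -[k /= km] _; rewrite coefZ.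
  have mon : ('X - 1 : {poly R}) ^+ k * 'X^(m - k) \is monic.
    by rewrite rpredM ?monicXn// monic_exp// -polyC1 monicXsubC.
  have sm : size (('X - 1 : {poly R}) ^+ k * 'X^(m - k)) = m.+1.
    rewrite size_monicM ?monic_exp ?monicXsubC -?size_poly_eq0 ?size_polyXn -?polyC1 ?size_exp_XsubC ?monicXsubC//.
    by lia.
  by have /monicP := mon; rewrite /lead_coef sm/= => ->; rewrite mulr1.
rewrite -natr_sum (_ : (m + m + al + d = (m + d) + (m + al))%N); last by lia.
rewrite -(binomial.Vandermonde (m + d) (m + al)); congr (_%:R); apply: eq_bigr => k _.
by rewrite mulnC.
Qed.

(** In one factor only the leading term counts: lower powers are orthogonal to [jac]. *)
Lemma pint_jac_sqr : pint ('X^d * (1 - 'X) ^+ al * jac * jac) =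
  jac`_m * pint ('X^d * (1 - 'X) ^+ al * jac * 'X^m).
Proof.
have {2}-> : jac = \sum_(i < m.+1) jac`_i *: 'X^i.
  rewrite -poly_def; apply/polyP => i; rewrite coef_poly; case: ltnP => // mi.
  by rewrite nth_default// (leq_trans size_jac).
rewrite mulr_sumr pint_sum big_ord_recr/= big1 ?add0r => [|i _].
  by rewrite -scalerAr pintZ.
by rewrite -scalerAr pintZ pint_jacXn leqNgt ltn_ord/= mulr0.
Qed.

End jacobi_explicit.

(** * The zonal reproducing kernel *)

Section zonal_functions.
Variables (R : realType) (al : nat).
Local Notation C := R[i].
Implicit Types (f : 'rV[C]_al.+2 -> C) (A B k : nat) (z w : 'rV[C]_al.+2).

Lemma conj_cdot n (z w : 'rV[C]_n) : (cdot z w)^*%C = cdot w z.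
Proof.
rewrite /cdot conjc_sum; apply: eq_bigr => j _.
by rewrite conjcM conjcK mulrC.
Qed.

Lemma cdot_mul_conj n (z w : 'rV[C]_n) :
  cdot z w * cdot w z = (rnorm (cdot z w) ^+ 2)%:C.
Proof.
by rewrite -[cdot w z]conj_cdot -[_ * _]normCK rnormE rmorphXn.
Qed.

Lemma polyfun_cdotl n (w : 'rV[C]_n) : polyfun (fun z : 'rV[C]_n => cdot z w).
Proof. exact: bihom_polyfun (bihom_cdotl w). Qed.

Lemma polyfun_cdotr n (w : 'rV[C]_n) : polyfun (fun z : 'rV[C]_n => cdot w z).
Proof. exact: bihom_polyfun (bihom_cdotr w). Qed.

Lemma bihom_cdot_diag n : bihom 1 1 (fun z : 'rV[C]_n => cdot z z).
Proof.
by apply: (@bihom_sum _ _ _ _ _ _ _ (fun j (z : 'rV[C]_n) => z 0 j * (z 0 j)^*%C)) => j _;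
  exact: (bihomM (bihom_coord R j) (bihom_conj R j)).
Qed.

Lemma dz_cdot_diag n (j : 'I_n) :
  dz j (fun z : 'rV[C]_n => cdot z z) = fun z : 'rV[C]_n => (z 0 j)^*%C.
Proof.
rewrite dzE wirt_sum => [|k]; last first.
  by apply: polyfunM; [exact: polyfun_coord|exact: polyfun_conj].
apply/funext => z; rewrite (bigD1 j)//= big1 ?addr0 => [|k kj];
  rewrite (wirtM _ _ (polyfun_coord _ _) (polyfun_conj _ _)) -!dzE dz_coord dz_conj.
  by rewrite eqxx mul1r mulr0 add0r.
by rewrite (negbTE kj) mul0r mulr0 add0r.
Qed.

Lemma dzbar_cdot_diag n (j : 'I_n) :
  dzbar j (fun z : 'rV[C]_n => cdot z z) = fun z : 'rV[C]_n => z 0 j.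
Proof.
rewrite dzbarE wirt_sum => [|k]; last first.
  by apply: polyfunM; [exact: polyfun_coord|exact: polyfun_conj].
apply/funext => z; rewrite (bigD1 j)//= big1 ?addr0 => [|k kj];
  rewrite (wirtM _ _ (polyfun_coord _ _) (polyfun_conj _ _)) -!dzbarE dzbar_coord dzbar_conj.
  by rewrite eqxx mulr1 mul0r addr0.
by rewrite (negbTE kj) mul0r mulr0 add0r.
Qed.

(** For |w| = 1, minus the Gram determinant of z and w. On the sphere it is |<z,w>|^2 - 1, so it is
    ['X - 1] homogenised to bidegree (1, 1). *)
Definition gram w z : C := cdot z w * cdot w z - cdot z z.

Lemma bihom_gram w : bihom 1 1 (gram w).
Proof.
apply: eq_bihom (bihomD (bihomM (bihom_cdotl w) (bihom_cdotr w))
  (bihomZ (- 1) (bihom_cdot_diag al.+2))) => z.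
by rewrite /gram mulN1r.
Qed.

Lemma wirt_gram s j w : wirt s j (gram w) = fun z =>
  cdot z w * wirt s j (fun z => cdot w z) z +
  wirt s j (fun z => cdot z w) z * cdot w z - wirt s j (fun z => cdot z z) z.
Proof.
have pd := bihom_polyfun (bihom_cdot_diag al.+2).
have -> : gram w = fun z => cdot z w * cdot w z + (- 1) * cdot z z.
  by apply/funext => z; rewrite /gram mulN1r.
rewrite (wirtD _ _ (polyfunM (polyfun_cdotl w) (polyfun_cdotr w)) (polyfunM (polyfun_cst _ _) pd)).
rewrite (wirtZ _ _ _ pd) (wirtM _ _ (polyfun_cdotl w) (polyfun_cdotr w)).
by apply/funext => z; rewrite mulN1r.
Qed.

Definition zonal w A B k z : C :=
  cdot z w ^+ A * cdot w z ^+ B * gram w z ^+ k.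

Lemma bihom_zonal w A B k : bihom (A + k) (B + k) (zonal w A B k).
Proof.
have := bihomM (bihomM (bihom_cdotlX w A) (bihom_cdotrX w B)) (bihomX k (bihom_gram w)).
by rewrite addn0 add0n muln1.
Qed.

Lemma polyfun_zonal w A B k : polyfun (zonal w A B k).
Proof. exact: bihom_polyfun (bihom_zonal w A B k). Qed.

Let leibniz3 (K : comPzRingType) (a b c f g h A B k a' b' c' : K) :
  (f * g * (k * c' * c) + (f * (B * b' * b) + A * a' * a * g) * h) =
  A * a * (a' * g * h) + B * b * (f * b' * h) + k * c * (f * g * c').
Proof. by ring. Qed.

Lemma wirt_zonal s j w A B k : wirt s j (zonal w A B k) = fun z =>
  A%:R * wirt s j (fun z => cdot z w) z * zonal w A.-1 B k z +
  B%:R * wirt s j (fun z => cdot w z) z * zonal w A B.-1 k z +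
  k%:R * wirt s j (gram w) z * zonal w A B k.-1 z.
Proof.
have pl := polyfun_cdotl w; have pr := polyfun_cdotr w.
have pg := bihom_polyfun (bihom_gram w).
have plA := polyfunX A pl; have prB := polyfunX B pr; have pgk := polyfunX k pg.
rewrite [in LHS]/zonal (wirtM _ _ (polyfunM plA prB) pgk) (wirtM _ _ plA prB).
rewrite (wirtX _ _ _ pl) (wirtX _ _ _ pr) (wirtX _ _ _ pg).
apply/funext => z; exact: leibniz3.
Qed.

Lemma dz_zonal j w A B k : dz j (zonal w A B k) = fun z =>
  A%:R * (w 0 j)^*%C * zonal w A.-1 B k z +
  k%:R * ((w 0 j)^*%C * cdot w z - (z 0 j)^*%C) * zonal w A B k.-1 z.
Proof.
rewrite dzE wirt_zonal wirt_gram -!dzE dz_cdotl dz_cdotr dz_cdot_diag.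
by apply/funext => z; rewrite !mulr0 mul0r addr0 add0r.
Qed.

Lemma dzbar_zonal j w A B k : dzbar j (zonal w A B k) = fun z =>
  B%:R * w 0 j * zonal w A B.-1 k z +
  (k%:R * w 0 j * zonal w A.+1 B k.-1 z -
  k%:R * (z 0 j * zonal w A B k.-1 z)).
Proof.
rewrite dzbarE wirt_zonal wirt_gram -!dzbarE dzbar_cdotl dzbar_cdotr dzbar_cdot_diag.
apply/funext => z; rewrite mulr0 !mul0r addr0 add0r; congr (_ + _).
have -> : zonal w A.+1 B k.-1 z = cdot z w * zonal w A B k.-1 z.
  by rewrite /zonal exprS !mulrA.
move: (zonal _ _ _ _ _) (cdot z w) (w 0 j) (z 0 j) (k%:R : C).
by move=> *; ring.
Qed.

(** Along [w] the derivative of [gram w] is <w,z>(<w,w> - 1) = 0, so only the power of [cdot z w]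
    contributes. *)
Lemma dir_dz_zonal w A B k z : cdot w w = 1 ->
  dir_dz w (zonal w A B k) z = A%:R * zonal w A.-1 B k z.
Proof.
move=> w1; rewrite /dir_dz.
rewrite (eq_bigr (fun j => A%:R * zonal w A.-1 B k z * (w 0 j * (w 0 j)^*%C) +
  k%:R * zonal w A B k.-1 z * (cdot w z * (w 0 j * (w 0 j)^*%C) - w 0 j * (z 0 j)^*%C))).
  rewrite big_split/= -!mulr_sumr sumrB -mulr_sumr -[\sum_j w 0 j * (w 0 j)^*%C]/(cdot w w) w1.
  by rewrite !mulr1 -[\sum_j w 0 j * _]/(cdot w z) subrr mulr0 addr0.
move=> j _; rewrite dz_zonal.
move: (zonal _ _ _ _ _) (zonal _ _ _ _ _) (cdot w z) (w 0 j) (w 0 j)^*%C (z 0 j)^*%C (A%:R : C) (k%:R : C).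
by move=> *; ring.
Qed.

(** Terms in w are derivatives along [w], terms in z fall under Euler's identity, and [al.+2] counts
    the coordinates. The coefficient of [zonal w A B k.-1] is k((A+1) - (al+2) - (A+k-1)) =
    -k(al+k). *)
Lemma laplacian_zonal w A B k z : cdot w w = 1 ->
  \sum_j dz j (dzbar j (zonal w A B k)) z =
  A%:R * B%:R * zonal w A.-1 B.-1 k z -
  k%:R * (al + k)%:R * zonal w A B k.-1 z.
Proof.
move=> w1.
have E j : dz j (dzbar j (zonal w A B k)) z =
    B%:R * (w 0 j * dz j (zonal w A B.-1 k) z) +
    k%:R * (w 0 j * dz j (zonal w A.+1 B k.-1) z) -
    k%:R * zonal w A B k.-1 z - k%:R * (z 0 j * dz j (zonal w A B k.-1) z).
  rewrite dzbar_zonal; have pz A' B' k' := polyfun_zonal w A' B' k'.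
  have pc := @polyfun_coord R al.+2 j.
  have -> : (fun z => B%:R * w 0 j * zonal w A B.-1 k z +
      (k%:R * w 0 j * zonal w A.+1 B k.-1 z - k%:R * (z 0 j * zonal w A B k.-1 z))) =
    (fun z => B%:R * w 0 j * zonal w A B.-1 k z +
      (k%:R * w 0 j * zonal w A.+1 B k.-1 z + - k%:R * (z 0 j * zonal w A B k.-1 z))).
    by apply/funext => z'; rewrite mulNr.
  have pcst c h : polyfun h -> polyfun (fun z => c * h z) by move=> ph; exact: polyfunM (polyfun_cst _ c) ph.
  have pcz := polyfunM pc (pz A B k.-1).
  rewrite dzE (wirtD _ _ (pcst _ _ (pz _ _ _)) (polyfunD (pcst _ _ (pz _ _ _)) (pcst _ _ pcz))).
  rewrite (wirtD _ _ (pcst _ _ (pz _ _ _)) (pcst _ _ pcz)).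
  rewrite (wirtZ _ _ _ (pz A B.-1 k)) (wirtZ _ _ _ (pz A.+1 B k.-1)) (wirtZ _ _ _ pcz).
  rewrite (wirtM _ _ pc (pz _ _ _)) -!dzE dz_coord eqxx mul1r.
  move: (dz j _ z) (dz j _ z) (dz j _ z) (zonal _ _ _ _ _) (w 0 j) (z 0 j) (A%:R : C) (B%:R : C) (k%:R : C).
  by move=> *; ring.
have S (x : C) : \sum_(j < al.+2) x = al.+2%:R * x by rewrite sumr_const card_ord mulr_natl.
rewrite (eq_bigr _ (fun j _ => E j)) !(sumrB, big_split)/= S -!mulr_sumr.
rewrite -![\sum_j w 0 j * _]/(dir_dz w _ z) !dir_dz_zonal//.
rewrite (euler_dz z (bihom_zonal w A B k.-1))/=.
case: k {E} => [|k]/=.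
  by rewrite !mul0r mulr0 !subr0 addr0 mulrCA mulrA.
rewrite !natrD -!natr1.
move: (zonal _ _ _ _ _) (zonal _ _ _ _ _) (A%:R : C) (B%:R : C) (k%:R : C) (al%:R : C).
by move=> *; ring.
Qed.

Section zonal_kernel.
Variables (p q : nat).
Let m := minn p q.
Let d := `|p - q|%N.

(** With n = al + 2, this times [jac.[1]] is the dimension of the space of harmonics, the value of
    its reproducing kernel on the diagonal. *)
Definition zkernel_const : R :=
  (al.+2 + p + q - 1)%:R * (maxn p q + al)`!%:R / (al.+1`! * (maxn p q)`!)%:R.

(** The coefficients are those of [jac], with ['X] read as [cdot z w * cdot w z] and ['X - 1] as
    [gram w z], so that the kernel is bihomogeneous on the whole space and not only defined on the
    sphere. *)
Definition zkernel w z : C := zkernel_const%:C * \sum_(k < m.+1)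
  ('C(m + al, m - k) * 'C(m + d, k))%:R * zonal w (p - k) (q - k) k z.

Lemma bihom_zkernel w : bihom p q (zkernel w).
Proof.
apply: bihomZ.
apply: (@bihom_sum _ _ _ _ _ _ _ (fun (k : 'I_m.+1) z =>
  ('C(m + al, m - k) * 'C(m + d, k))%:R * zonal w (p - k) (q - k) k z)) => -[k /= km] _.
apply: bihomZ; have := bihom_zonal w (p - k) (q - k) k.
by rewrite !subnK//; move: km; rewrite /m; lia.
Qed.

(** The Laplacian of the k-th term is G k - H k, and the coefficients of [jac] are exactly those for
    which G k = H (k+1): the sum telescopes. *)
Lemma harmonic_zkernel w : cdot w w = 1 -> harmonic_fun (zkernel w).
Proof.
move=> w1 z.
have pz k := polyfun_zonal w (p - k) (q - k) k.
pose a k : C := ('C(m + al, m - k) * 'C(m + d, k))%:R.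
pose F (k : 'I_m.+1) z := a k * zonal w (p - k) (q - k) k z.
have pF (k : 'I_m.+1) : polyfun (F k) by apply: polyfunM; [exact: polyfun_cst|exact: pz].
have pS : polyfun (fun z => \sum_(k < m.+1) F k z) by exact: polyfun_sum.
have E j : dz j (dzbar j (zkernel w)) z = zkernel_const%:C *
    \sum_(k < m.+1) a k * dz j (dzbar j (zonal w (p - k) (q - k) k)) z.
  rewrite dzbarE /zkernel (wirtZ _ _ _ pS) dzE (wirtZ _ _ _ (wirt_polyfun _ _ pS)).
  rewrite (wirt_sum _ _ _ _ pF) wirt_sum; last by move=> k; exact: wirt_polyfun.
  congr (_ * _); apply: eq_bigr => k _.
  by rewrite (wirtZ _ _ _ (pz k)) (wirtZ _ _ _ (wirt_polyfun _ _ (pz k))) dzE.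
rewrite (eq_bigr _ (fun j _ => E j)) -mulr_sumr exchange_big/=.
under eq_bigr do rewrite -mulr_sumr laplacian_zonal//.
rewrite [X in _ * X](_ : _ = 0) ?mulr0//.
pose G k := a k * ((p - k)%:R * (q - k)%:R * zonal w (p - k).-1 (q - k).-1 k z).
pose H k := a k * (k%:R * (al + k)%:R * zonal w (p - k) (q - k) k.-1 z).
transitivity (\sum_(k < m.+1) G k - \sum_(k < m.+1) H k).
  by rewrite -sumrB; apply: eq_bigr => k _; rewrite -mulrBr.
rewrite big_ord_recr [X in _ - X]big_ord_recl/=.
have -> : H 0%N = 0 by rewrite /H !mul0r mulr0.
(* One of [p - m] and [q - m] is 0, as m is the smaller of p and q. *)
have -> : G m = 0.
  rewrite /G -natrM (_ : (p - m) * (q - m) = 0)%N ?mul0r ?mulr0//.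
  by rewrite /m; case: (leqP p q) => _; rewrite subnn ?muln0 ?mul0n.
rewrite add0r addr0 -sumrB big1// => -[k km] _ /=.
apply/eqP; rewrite subr_eq0; apply/eqP; rewrite /G /H /bump/= add1n.
(* Since (p-k)(q-k) = (m-k)(m+d-k), each factor can be absorbed into one of the two binomials. *)
suff E2 : ('C(m + al, m - k) * 'C(m + d, k) * (p - k) * (q - k) =
    'C(m + al, m - k.+1) * 'C(m + d, k.+1) * k.+1 * (al + k.+1))%N.
  by rewrite !mulrA /a -!natrM E2 add0n !subnS.
have e0 : ((p - k) * (q - k) = (m - k) * (m + d - k))%N by rewrite /m /d; lia.
have e1 : ((m - k) * 'C(m + al, m - k) = (al + k.+1) * 'C(m + al, m - k.+1))%N.
  by rewrite -{1 2}(subnSK km) mul_bin_left; congr (_ * _)%N; lia.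
have e2 : ((m + d - k) * 'C(m + d, k) = k.+1 * 'C(m + d, k.+1))%N.
  by rewrite mul_bin_left.
transitivity (((m - k) * 'C(m + al, m - k)) * ((m + d - k) * 'C(m + d, k)))%N.
  by rewrite -mulnA e0 mulnACA [('C(m + al, m - k) * _)%N]mulnC [('C(m + d, k) * _)%N]mulnC.
rewrite e1 e2 mulnACA mulnC -!mulnA; congr (_ * (_ * _))%N.
by rewrite mulnC.
Qed.

Lemma zkernelE w z : cdot z z = 1 -> zkernel w z = zkernel_const%:C *
  (cdot z w ^+ (p - m) * cdot w z ^+ (q - m) *
   ((jac R al d m).[rnorm (cdot z w) ^+ 2])%:C).
Proof.
move=> z1; rewrite /zkernel; congr (_ * _).
rewrite /jac horner_sum rmorph_sum mulr_sumr/=; apply: eq_bigr => -[k /= km] _.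
rewrite hornerZ hornerM horner_exp hornerXn -polyC1 hornerXsubC.
rewrite !rmorphM !rmorphXn/= rmorphB/= rmorph_nat rmorph1 -rmorphXn/= -cdot_mul_conj.
rewrite /zonal /gram z1.
have -> : (p - k = (p - m) + (m - k))%N by rewrite /m; move: km; rewrite /m; lia.
have -> : (q - k = (q - m) + (m - k))%N by rewrite /m; move: km; rewrite /m; lia.
rewrite !exprD exprMn.
by ring.
Qed.

(** The Funk-Hecke multiplier of the zonal kernel with profile [phi]; [(1 - 'X)^al] times [al.+1] is
    the density of t = |<z,w>|^2, and the division normalises [jac] to be 1 at t = 1. *)
Definition zonal_eigenvalue (phi : {poly R}) : R :=
  al.+1%:R / (jac R al d m).[1] * pint ('X^d * (1 - 'X) ^+ al * jac R al d m * phi).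

(** By linearity [phi] is a power t^j. Then [funk_hecke] and the Beta integral [pint_jacXn] give the
    same factorials, and both sides vanish for j < m. *)
Lemma qavg_zonal D (s : seq (R * 'rV[C]_al.+2)) f w (phi : {poly R}) :
  exact_quadrature D s -> bihom p q f -> harmonic_fun f -> cdot w w = 1 ->
  (maxn p q + size phi <= D)%N ->
  qavg s (fun z => f z * (cdot w z ^+ (p - m) * cdot z w ^+ (q - m) *
    (phi.[rnorm (cdot z w) ^+ 2])%:C)) = (zonal_eigenvalue phi)%:C * f w.
Proof.
move=> sD fpq hf w1 phiD.
pose e j : R := al.+1%:R / (jac R al d m).[1] * pint ('X^d * (1 - 'X) ^+ al * jac R al d m * 'X^j).
have -> : zonal_eigenvalue phi = \sum_(j < size phi) phi`_j * e j.
  rewrite /zonal_eigenvalue {1}(_ : phi = \sum_(j < size phi) phi`_j *: 'X^j).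
    rewrite mulr_sumr pint_sum mulr_sumr; apply: eq_bigr => j _.
    by rewrite -scalerAr pintZ /e mulrCA.
  by rewrite -poly_def; apply/polyP => i; rewrite coef_poly; case: ltnP => // /leq_sizeP ->.
rewrite (@eq_qavg _ _ s _ (fun z => \sum_(j < size phi) (phi`_j)%:C *
   (f z * (cdot w z ^+ (p - m + j) * cdot z w ^+ (q - m + j))))); last first.
  move=> z; rewrite horner_coef rmorph_sum/= !mulr_sumr; apply: eq_bigr => j _.
  rewrite rmorphM rmorphXn/= -cdot_mul_conj exprMn !exprD.
  move: (phi`_j)%:C (f z) (_ ^+ _) (_ ^+ _) (_ ^+ _) (_ ^+ _).
  by move=> *; ring.
rewrite qavg_sum rmorph_sum/= mulr_suml; apply: eq_bigr => -[j /= jphi] _.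
rewrite qavgZ rmorphM/= -mulrA; congr (_ * _).
have pq : (p + (q - m + j) = q + (p - m + j))%N by rewrite /m; lia.
have pD : (p + (q - m + j) <= D)%N.
  rewrite (leq_trans _ phiD)// (_ : p + (q - m + j) = maxn p q + j)%N; last by rewrite /m; lia.
  by rewrite leq_add2l ltnW.
rewrite (funk_hecke sD fpq hf w1 pq pD); congr (_ * _).
rewrite /e jac1 pint_jacXn /fact_quot.
have -> : (p <= p - m + j)%N = (m <= j)%N by rewrite /m; lia.
case: leqP => mj; last by rewrite mulr0 mulr0 rmorph0.
have -> : (p - m + j - p = j - m)%N by rewrite /m; move: mj; rewrite /m; lia.
have -> : (al.+1`! * (p - m + j)`! * (q - m + j)`! = al.+1`! * (j`! * (d + j)`!))%N.
  rewrite -mulnA; congr (_ * _)%N; rewrite /m /d.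
  case: (leqP p q) => pq'.
    by rewrite subnn add0n distnEr.
  by rewrite subnn add0n mulnC distnEl// ltnW.
have -> : (al.+1 + (p + (q - m + j)) = (al + m + d + j).+1)%N by rewrite /m /d; lia.
have mal : (m <= m + al)%N by exact: leq_addr.
have bf := bin_fact mal; rewrite addKn in bf.
have b0 : ('C(m + al, m)%:R : R) != 0 by rewrite pnatr_eq0 -lt0n bin_gt0.
have f0 k : (k`!%:R : R) != 0 by rewrite pnatr_eq0 -lt0n fact_gt0.
rewrite [(al + m)%N]addnC -bf factS.
move: (f0 m) (f0 (j - m)%N) (f0 (m + al + d + j).+1) b0.
move: (m`!) ((j - m)`!) ((m + al + d + j).+1`!) ('C(m + al, m)) => x y t c x0 y0 t0 c0.
rewrite !(rmorphM (real_complex R)) !fmorphV !rmorph_nat !natrM.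
have cC (k : nat) : (k%:R : R) != 0 -> (k%:R : C) != 0 by rewrite !pnatr_eq0.
by field; rewrite ?cC.
Qed.

End zonal_kernel.

End zonal_functions.

(** * L1 norm of the kernel *)

Section sqrt_approximation.
Variable R : realType.

(** The classical iteration s + (x - s^2)/2 for the square root of x, with s = x y and the factor x
    removed: y approximates x^(-1/2). *)
Fixpoint sqrt_approx k : {poly R} :=
  if k is k'.+1 then
    sqrt_approx k' + 2^-1 *: (1%:P - 'X * sqrt_approx k' ^+ 2)
  else 0.

Lemma sqrt_approxP k (e : R) : 0 <= e <= 1 ->
  0 <= e ^+ 2 * (sqrt_approx k).[e ^+ 2] <= e /\
  e - e ^+ 2 * (sqrt_approx k).[e ^+ 2] <= e * (1 - e / 2) ^+ k.
Proof.
move=> /andP[e0 e1]; elim: k => [|k [/andP[y0 ye] IH]] /=.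
  by rewrite horner0 mulr0 expr0 subr0 mulr1 !lexx e0.
rewrite hornerD hornerZ hornerD hornerN hornerM hornerX horner_exp hornerC.
set y := (sqrt_approx k).[_] in y0 ye IH *.
set x := e ^+ 2 * y in y0 ye IH.
have -> : e ^+ 2 * (y + 2^-1 * (1 - e ^+ 2 * y ^+ 2)) =
    x + (e ^+ 2 - x ^+ 2) / 2 by rewrite /x; field.
(* The error is multiplied by 1 - (e+s)/2, where s is the current iterate, named [x] here. As 0 <= s
   <= e <= 1, this factor lies between 0 and 1 - e/2. *)
have E : e - (x + (e ^+ 2 - x ^+ 2) / 2) = (e - x) * (1 - (e + x) / 2) by field.
have f0 : 0 <= 1 - (e + x) / 2 by lra.
split.
  apply/andP; split; last by rewrite -subr_ge0 E mulr_ge0// subr_ge0.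
  by rewrite addr_ge0// divr_ge0// subr_ge0 ler_sqr ?nnegrE.
by rewrite E exprSr mulrA ler_pM ?subr_ge0//; lra.
Qed.

(** With a = e/2 this turns the geometric bound e(1-e/2)^k, useless for e near 0, into the uniform
    bound 2/(k+1). *)
Lemma bernoulli_inv (a : R) k : 0 <= a <= 1 -> (1 - a) ^+ k * (1 + k%:R * a) <= 1.
Proof.
move=> /andP[a0 a1]; elim: k => [|k IH]; first by rewrite expr0 mul0r addr0 mul1r.
apply: le_trans IH; rewrite exprSr -mulrA ler_wpM2l ?exprn_ge0 ?subr_ge0//.
rewrite -natr1; have : 0 <= (k%:R : R) by [].
by move: (k%:R : R) => r r0; nra.
Qed.

Lemma sqrt_approx_error k (x : R) : 0 <= x <= 1 ->
  0 <= x * (sqrt_approx k).[x] <= Num.sqrt x /\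
  Num.sqrt x - x * (sqrt_approx k).[x] <= 2 / k.+1%:R.
Proof.
move=> /andP[x0 x1]; set e := Num.sqrt x.
have e01 : 0 <= e <= 1 by rewrite sqrtr_ge0 -sqrtr1 ler_wsqrtr.
have xe : x = e ^+ 2 by rewrite sqr_sqrtr.
have [h1 h2] := sqrt_approxP k e01; rewrite xe; split => //.
apply: le_trans h2 _; rewrite ler_pdivlMr ?ltr0n//.
have /andP[e0 e1] := e01.
have a01 : 0 <= e / 2 <= 1 by apply/andP; split; lra.
have := bernoulli_inv k a01; set u := (1 - e / 2) ^+ k => hu.
have u0 : 0 <= u by rewrite exprn_ge0//; lra.
rewrite -natr1; have : 0 <= (k%:R : R) by [].
move: (k%:R : R) hu => r hu r0.
by nra.
Qed.

Lemma sqrt_approx_le1 k (x : R) : 0 <= x <= 1 ->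
  x * (sqrt_approx k).[x] ^+ 2 <= 1.
Proof.
move=> x01; have /andP[x0 x1] := x01.
have [/andP[h0 h1] _] := sqrt_approx_error k x01.
have [->|x0'] := eqVneq x 0; first by rewrite mul0r.
have xp : 0 < x by rewrite lt_neqAle eq_sym x0' x0.
rewrite -(ler_pM2l xp) mulr1 mulrA -expr2 -exprMn.
by rewrite -[leRHS]sqr_sqrtr// ler_sqr// nnegrE sqrtr_ge0.
Qed.

Lemma poly_bounded01 (p : {poly R}) :
  exists2 B : R, 0 < B & forall t, 0 <= t <= 1 -> p.[t] <= B ^+ 2.
Proof.
pose S := \sum_(i < size p) `|p`_i|.
have S0 : 0 <= S by exact: sumr_ge0.
exists (1 + S) => [|t /andP[t0 t1]]; first by rewrite ltr_pwDl.
apply: (@le_trans _ _ S); last by nra.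
rewrite horner_coef ler_sum// => i _.
rewrite (le_trans (ler_norm _))// normrM ler_piMr//.
by rewrite normrX (ger0_norm t0) exprn_ile1.
Qed.

End sqrt_approximation.

(** * Quadrature bounds for the L1 norm of the kernel *)

Section kernel_bounds.
Variables (R : realType) (al p q : nat).
Local Notation C := R[i].
Let m := minn p q.
Let d := `|p - q|%N.
Let y := jac R al d m.
Let kc := zkernel_const R al p q.
Implicit Types (z w : 'rV[C]_al.+2) (t : R).

Let fact_neq0 k : (k`!%:R : R) != 0.
Proof. by rewrite pnatr_eq0 -lt0n fact_gt0. Qed.

Lemma jac1_neq0 : y.[1] != 0.
Proof. by rewrite /y jac1 pnatr_eq0 -lt0n bin_gt0 leq_addr. Qed.

Lemma zkernel_const_ge0 : 0 <= kc.
Proof. by rewrite /kc /zkernel_const divr_ge0// mulr_ge0. Qed.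

(** This equation determines [zkernel_const]: the kernel then acts as the identity on the
    harmonics. *)
Lemma zonal_eigenvalue_jac : zonal_eigenvalue al p q (kc *: y) = 1.
Proof.
rewrite /zonal_eigenvalue -/m -/d -/y -scalerAr pintZ pint_jac_sqr jac_lead pint_jacXn leqnn.
rewrite subnn fact0 muln1 /y jac1 /kc /zkernel_const.
have -> : maxn p q = (m + d)%N by rewrite /m /d; lia.
have -> : (al.+2 + p + q - 1 = (al + m + d + m).+1)%N by rewrite /m /d; lia.
have bf1 := bin_fact (leq_addr al m); rewrite addKn in bf1.
have mm : (m <= m + m + al + d)%N by lia.
have := bin_fact mm.
have -> : (m + m + al + d - m = m + d + al)%N by lia.
have -> : (m + m + al + d = al + m + d + m)%N by lia.
rewrite [(d + m)%N]addnC [(al + m)%N]addnC => bf2.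
rewrite !factS -bf1 -bf2.
have b1 : ('C(m + al, m)%:R : R) != 0 by rewrite pnatr_eq0 -lt0n bin_gt0 leq_addr.
have b2 : ('C(m + al + d + m, m)%:R : R) != 0 by rewrite pnatr_eq0 -lt0n bin_gt0; lia.
have s1 : (al.+1%:R : R) != 0 by rewrite pnatr_eq0.
have s2 : ((m + al + d + m).+1%:R : R) != 0 by rewrite pnatr_eq0.
move: (fact_neq0 m) (fact_neq0 al) (fact_neq0 (m + d)) (fact_neq0 (m + d + al)) b1 b2 s1 s2.
move: (m`!) (al`!) ((m + d)`!) ((m + d + al)`!) ('C(m + al, m)) ('C(m + al + d + m, m)) (al.+1)
  ((m + al + d + m).+1).
move=> x1 x2 x3 x4 x5 x6 x7 x8 n1 n2 n3 n4 n5 n6 n7 n8.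
rewrite !natrM; field.
by rewrite ?n1 ?n2 ?n3 ?n4 ?n5 ?n6 ?n7 ?n8.
Qed.

Lemma rnormX (x : C) k : rnorm (x ^+ k) = rnorm x ^+ k.
Proof. by apply: complexI; rewrite rmorphXn/= -!rnormE normrX. Qed.

Lemma rnorm_real (x : R) : 0 <= x -> rnorm (x%:C : C) = x.
Proof. by move=> x0; apply: complexI; rewrite -rnormE ger0_norm// lecR. Qed.

Lemma rnorm_realE (x : R) : rnorm (x%:C : C) = `|x|.
Proof.
have [x0|/ltW x0] := leP 0 x; first by rewrite rnorm_real// ger0_norm.
apply: complexI; rewrite -rnormE ler0_norm; last by rewrite lecR.
by rewrite ler0_norm// rmorphN.
Qed.

Lemma rnorm_cdotC z w : rnorm (cdot w z) = rnorm (cdot z w).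
Proof. by rewrite -conj_cdot rnormJ. Qed.

(* The squared modulus of the kernel is [kc ^+ 2] times chi. *)
Let chi : {poly R} := 'X^d * y ^+ 2.

Lemma chi_ge0 t : 0 <= t -> 0 <= chi.[t].
Proof.
by move=> t0; rewrite hornerM hornerXn horner_exp mulr_ge0 ?sqr_ge0 ?exprn_ge0.
Qed.

Lemma rnorm_zonal_sqr z w (phi : {poly R}) a b : (a + b = d)%N ->
  rnorm (cdot z w ^+ a * cdot w z ^+ b * (phi.[rnorm (cdot z w) ^+ 2])%:C) ^+ 2 =
  (rnorm (cdot z w) ^+ 2) ^+ d * phi.[rnorm (cdot z w) ^+ 2] ^+ 2.
Proof.
move=> abd; rewrite !rnormM !rnormX rnorm_cdotC rnorm_realE !exprMn.
rewrite real_normK ?num_real//; congr (_ * _).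
by rewrite -!exprM -!exprD -abd; congr (_ ^+ _); lia.
Qed.

Let exponents : ((p - m) + (q - m) = d)%N.
Proof. by rewrite /m /d; lia. Qed.

Lemma rnorm_zkernel z w : cdot z z = 1 ->
  rnorm (zkernel p q w z) = kc * Num.sqrt chi.[rnorm (cdot z w) ^+ 2].
Proof.
move=> z1; rewrite zkernelE// rnormM rnorm_real ?zkernel_const_ge0//; congr (_ * _).
rewrite -[LHS]ger0_norm ?rnorm_ge0// -sqrtr_sqr rnorm_zonal_sqr//.
by rewrite /chi hornerM hornerXn horner_exp.
Qed.

Lemma cauchy_schwarz_cdot z w : cdot z z = 1 -> cdot w w = 1 ->
  0 <= rnorm (cdot z w) ^+ 2 <= 1.
Proof.
move=> z1 w1; rewrite sqr_ge0/=.
(* The squared norm of the component of z orthogonal to w. *)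
have h : \sum_j (z 0 j - cdot z w * w 0 j) * (z 0 j - cdot z w * w 0 j)^*%C =
    (1 - rnorm (cdot z w) ^+ 2)%:C.
  rewrite (eq_bigr (fun j => z 0 j * (z 0 j)^*%C - cdot w z * (z 0 j * (w 0 j)^*%C) -
     cdot z w * (w 0 j * (z 0 j)^*%C) + cdot z w * cdot w z * (w 0 j * (w 0 j)^*%C))).
    rewrite big_split !sumrB/= -!mulr_sumr.
    rewrite -[\sum_j z 0 j * (z 0 j)^*%C]/(cdot z z) -[\sum_j z 0 j * (w 0 j)^*%C]/(cdot z w).
    rewrite -[\sum_j w 0 j * (z 0 j)^*%C]/(cdot w z) -[\sum_j w 0 j * (w 0 j)^*%C]/(cdot w w).
    rewrite z1 w1 mulr1 rmorphB rmorph1/= -cdot_mul_conj.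
    by move: (cdot z w) (cdot w z) => a b; ring.
  move=> j _; have -> : (z 0 j - cdot z w * w 0 j)^*%C = (z 0 j)^*%C - cdot w z * (w 0 j)^*%C.
    by rewrite -(conj_cdot z w) -conjcM; exact: rmorphB.
  move: (cdot z w) (cdot w z) (z 0 j) (w 0 j) (z 0 j)^*%C (w 0 j)^*%C.
  by move=> *; ring.
rewrite -subr_ge0 -lecR -h sumr_ge0// => j _.
by rewrite mulcJ_ge0.
Qed.

Section quadrature.
Variables (D : nat) (s : seq (R * 'rV[C]_al.+2)).
Hypothesis sD : exact_quadrature D s.

Lemma quad_node x : x \in s -> cdot x.2 x.2 = 1.
Proof. by move=> xs; have [_ <-] := sD.1 _ xs. Qed.

Lemma reproducing f z : ((p + q).+2 <= D)%N -> bihom p q f -> harmonic_fun f ->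
  cdot z z = 1 -> f z = qavg s (fun w => f w * zkernel p q w z).
Proof.
move=> pqD fpq hf z1.
have sz : (maxn p q + size (kc *: y)%R <= D)%N.
  apply: leq_trans pqD; have := size_scale_leq kc y; have := size_jac R al d m.
  rewrite -/y; set a := size y; set b := size _ => h1 h2.
  have : (b <= m.+1)%N by exact: leq_trans h2 h1.
  by rewrite /m; lia.
have := qavg_zonal sD fpq hf z1 sz.
rewrite zonal_eigenvalue_jac mul1r => <-.
apply: eq_big_seq => x xs; congr (_ * _).
rewrite zkernelE// hornerZ [rnorm (cdot z _)]rnorm_cdotC.
by rewrite [in LHS]rmorphM/=; ring.
Qed.

End quadrature.

Let wsqrt t : R := (1 - t) ^+ al * Num.sqrt chi.[t].

Lemma integrable_wsqrt :
  lebesgue_measure.-integrable `[0, 1] (EFin \o wsqrt).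
Proof.
apply: continuous_compact_integrable; first exact: segment_compact.
apply: continuous_subspaceT => t; rewrite /wsqrt.
have -> : (fun t => (1 - t) ^+ al * Num.sqrt chi.[t]) =
    (fun t => horner ((1 - 'X) ^+ al) t * (Num.sqrt \o horner chi) t).
  by apply/funext => u /=; rewrite horner_exp hornerD hornerN hornerX hornerC.
apply: continuousM; first exact: continuous_horner.
by apply: continuous_comp; [exact: continuous_horner|exact: sqrt_continuous].
Qed.

(** The mean over the sphere of the modulus of the kernel, written with the density (al+1)(1-t)^al
    of t. *)
Definition zonal_constant : R :=
  kc * al.+1%:R * \int[lebesgue_measure]_(t in `[0, 1]) wsqrt t.

Lemma pint_cst (c : R) : pint c%:P = c.
Proof.
have -> : c%:P = deriv (c *: 'X) by rewrite derivZ derivX alg_polyC.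
by rewrite pint_deriv !hornerZ !hornerX mulr1 mulr0 subr0.
Qed.

(** [psi] stands for chi^(-1/2). The upper bound uses the second and third properties, the lower
    bound the first and the fourth. *)
Lemma zonal_approx (e : R) : 0 < e -> exists (psi : {poly R}),
  [/\ forall t, 0 <= t <= 1 -> chi.[t] * psi.[t] ^+ 2 <= 1,
      forall t, 0 <= t <= 1 -> Num.sqrt chi.[t] <= (chi * psi).[t] + e,
      pint ((1 - 'X) ^+ al * (chi * psi)) <= \int[lebesgue_measure]_(t in `[0, 1]) wsqrt t &
      \int[lebesgue_measure]_(t in `[0, 1]) wsqrt t <=
      pint ((1 - 'X) ^+ al * (chi * psi)) + e].
Proof.
move=> e0; have [B B0 chiB] := poly_bounded01 chi.
have [k ke] : exists k, B * (2 / k.+1%:R) <= e.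
  have [k hk] := ltr_add_invr (divr_gt0 e0 (mulr_gt0 B0 (ltr0n R 2))).
  exists k; rewrite add0r ltr_pdivlMr ?mulr_gt0// in hk.
  by rewrite ltW// mulrA mulrC.
have B20 : 0 < B ^+ 2 by rewrite exprn_gt0.
(* Scaling by B^2 brings chi into [0, 1]; then chi psi = B x y with y close to x^(-1/2), within
   2B/(k+1) of sqrt chi. *)
pose x := (B ^- 2) *: chi; pose psi := B^-1 *: (sqrt_approx R k \Po x).
have x01 t : 0 <= t <= 1 -> 0 <= x.[t] <= 1.
  move=> t01; rewrite /x hornerZ mulr_ge0 ?invr_ge0 ?(ltW B20)//=.
    by rewrite mulrC ler_pdivrMr// mul1r chiB.
  by rewrite chi_ge0//; case/andP: t01.
have sx t : 0 <= t -> Num.sqrt x.[t] = Num.sqrt chi.[t] / B.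
  move=> t0; rewrite /x hornerZ sqrtrM ?invr_ge0 ?(ltW B20)// mulrC sqrtrV ?(ltW B20)//.
  by rewrite sqrtr_sqr ger0_norm// ltW.
have cp t : (chi * psi).[t] = B * (x.[t] * (sqrt_approx R k).[x.[t]]).
  rewrite hornerM /psi hornerZ horner_comp /x hornerZ.
  by field; rewrite gt_eqF.
have low t : 0 <= t <= 1 -> (chi * psi).[t] <= Num.sqrt chi.[t].
  move=> t01; have [/andP[_ h] _] := sqrt_approx_error k (x01 _ t01).
  rewrite cp mulrC -ler_pdivlMr// -sx//; by case/andP: t01.
have high t : 0 <= t <= 1 -> Num.sqrt chi.[t] <= (chi * psi).[t] + e.
  move=> t01; have [_ h] := sqrt_approx_error k (x01 _ t01).
  rewrite cp -lerBlDl; apply: le_trans ke.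
  have t0 : 0 <= t by case/andP: t01.
  rewrite sx// in h; have := ler_wpM2l (ltW B0) h; apply: le_trans.
  by rewrite mulrBr [B * (_ / B)]mulrC divfK// gt_eqF.
have w0 t : 0 <= t <= 1 -> 0 <= (1 - t) ^+ al <= 1.
  by move=> /andP[t0 t1]; rewrite exprn_ge0 ?subr_ge0// exprn_ile1 ?subr_ge0// lerBlDr lerDl.
exists psi; split => //.
- move=> t t01; have := sqrt_approx_le1 k (x01 _ t01).
  have -> : psi.[t] = B^-1 * (sqrt_approx R k).[x.[t]] by rewrite /psi hornerZ horner_comp.
  have xt : x.[t] = B ^- 2 * chi.[t] by rewrite /x hornerZ.
  move: ((sqrt_approx R k).[x.[t]]) => u.
  have -> : chi.[t] * (B^-1 * u) ^+ 2 = x.[t] * u ^+ 2 by rewrite xt; field; rewrite gt_eqF.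
  by [].
- apply: le_Rintegral => //; [exact: integrable_poly|exact: integrable_wsqrt|].
  move=> t /=; rewrite in_itv/= => t01; rewrite hornerM horner_exp.
  have /andP[w1 _] := w0 _ t01.
  by rewrite hornerD hornerN hornerX hornerC ler_wpM2l// low.
- rewrite -[X in _ + X]pint_cst -pintD.
  apply: le_Rintegral => //; [exact: integrable_wsqrt|exact: integrable_poly|].
  move=> t /=; rewrite in_itv/= => t01; rewrite hornerD hornerC hornerM horner_exp.
  have /andP[w1 w2] := w0 _ t01.
  rewrite hornerD hornerN hornerX hornerC.
  apply: (@le_trans _ _ ((1 - t) ^+ al * ((chi * psi).[t] + e))).
    by rewrite ler_wpM2l// high.
  by rewrite mulrDr lerD2l ler_piMl// ltW.
Qed.

Lemma exact_quadrature_exists D : exists s : seq (R * 'rV[C]_al.+2),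
  exact_quadrature D s.
Proof. by have [s [s1 s2]] := sphere_quadrature R al.+1 D; exists s; split. Qed.

(** The modulus of the kernel is majorised by a polynomial in t, whose average is exact and
    independent of z; hence one quadrature serves all z. *)
Lemma kernel_upper_bound (e : R) : 0 < e ->
  exists D (s : seq (R * 'rV[C]_al.+2)), [/\ exact_quadrature D s,
    ((p + q).+2 <= D)%N & forall z, cdot z z = 1 ->
    \sum_(x <- s) x.1 * rnorm (zkernel p q x.2 z) <= zonal_constant + e].
Proof.
(* The [+ 1] makes the divisor positive, only [0 <= kc] being known. *)
move=> e0; have K0 : 0 < kc * al.+1%:R + 1 by rewrite ltr_wpDl// mulr_ge0// zkernel_const_ge0.
have kc0 : 0 <= kc by exact: zkernel_const_ge0.
have e1 : 0 < e / (kc * al.+1%:R + 1) by rewrite divr_gt0.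
have [psi [_ h1 h2 _]] := zonal_approx e1.
pose phi := chi * psi; pose D := ((p + q).+2 + size phi)%N.
have [s sD] := exact_quadrature_exists D.
exists D, s; split => //; first exact: leq_addr.
move=> z z1.
(* Funk-Hecke for bidegree (0, 0) and the constant 1 is the formula for the average of a polynomial
   in t. *)
have one : bihom 0 0 (fun _ : 'rV[C]_al.+2 => 1 : C).
  by apply: eq_bihom (bihomX 0 (bihom_coord R (ord0 : 'I_al.+2))) => u; rewrite expr0.
have hone : harmonic_fun (fun _ : 'rV[C]_al.+2 => 1 : C).
  move=> u; rewrite big1// => j _; rewrite dzbarE wirt_cst dz_cst0//.
have sphi : (maxn 0 0 + size phi <= D)%N by rewrite max0n add0n leq_addl.
have := qavg_zonal sD one hone z1 sphi.
rewrite mulr1 /zonal_eigenvalue minnn distnn.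
have -> : jac R al 0 0 = 1.
  by rewrite /jac big_ord1 subnn !bin0 muln1 scale1r !expr0 mulr1.
rewrite hornerC divr1 expr0 mul1r mulr1 => Q.
have Qr : \sum_(x <- s) x.1 * phi.[rnorm (cdot x.2 z) ^+ 2] =
    al.+1%:R * pint ((1 - 'X) ^+ al * phi).
  apply: complexI; rewrite -Q rmorph_sum/=; apply: eq_bigr => x _.
  by rewrite !subnn !expr0 !mul1r rmorphM.
have S1 : \sum_(x <- s) x.1 = 1.
  apply: complexI; rewrite rmorph1 -(qavg_cst sD 1) rmorph_sum/=.
  by apply: eq_bigr => x _; rewrite mulr1.
apply: (@le_trans _ _ (\sum_(x <- s) x.1 * (kc * (phi.[rnorm (cdot x.2 z) ^+ 2] +
     e / (kc * al.+1%:R + 1))))).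
  rewrite big_seq [leRHS]big_seq ler_sum// => x xs.
  rewrite ler_wpM2l//; first by have [] := sD.1 _ xs.
  rewrite rnorm_zkernel// ler_wpM2l// rnorm_cdotC h1//.
  by apply: cauchy_schwarz_cdot => //; exact: (quad_node sD).
under eq_bigr do rewrite mulrCA mulrDr.
rewrite -mulr_sumr big_split/= Qr -mulr_suml S1 mul1r mulrDr mulrA.
rewrite lerD//; first by rewrite ler_wpM2l ?mulr_ge0.
rewrite mulrA ler_pdivrMr// mulrC ler_wpM2l// ?ltW//.
have : kc <= kc * al.+1%:R by rewrite ler_peMr// ler1n.
by lra.
Qed.

(** The conjugate of the angular factor of [zkernel p q w z]. With phi = J psi it approximates the
    conjugate phase; exchanging z and w gives the phase itself. *)
Definition zonal_sign (phi : {poly R}) w z : C :=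
  cdot w z ^+ (p - m) * cdot z w ^+ (q - m) * (phi.[rnorm (cdot z w) ^+ 2])%:C.

(** [kc * y.[1]] is the kernel on the diagonal. It cancels the normalisation of the eigenvalue and
    leaves the weighted integral of chi psi. *)
Lemma kernel_lower_bound (e : R) : 0 < e ->
  exists D (s : seq (R * 'rV[C]_al.+2)) (phi : {poly R}), [/\ exact_quadrature D s,
    ((p + q).+2 <= D)%N, (maxn p q + size phi <= D)%N,
    forall z w, cdot z z = 1 -> cdot w w = 1 -> rnorm (zonal_sign phi w z) <= 1 &
    zonal_constant - e <= zonal_eigenvalue al p q phi * (kc * y.[1])].
Proof.
move=> e0; have K0 : 0 < kc * al.+1%:R + 1 by rewrite ltr_wpDl// mulr_ge0// zkernel_const_ge0.
have kc0 : 0 <= kc by exact: zkernel_const_ge0.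
have e1 : 0 < e / (kc * al.+1%:R + 1) by rewrite divr_gt0.
have [psi [h1 _ _ h2]] := zonal_approx e1.
pose phi := y * psi; pose D := ((p + q).+2 + size phi + maxn p q)%N.
have [s sD] := exact_quadrature_exists D.
exists D, s, phi; split => //.
- by rewrite /D -addnA leq_addr.
- by rewrite /D; lia.
- move=> z w z1 w1; rewrite -(@expr_le1 _ 2) ?rnorm_ge0// /zonal_sign.
  rewrite [X in rnorm (X * _)]mulrC rnorm_zonal_sqr ?[(q - m + _)%N]addnC//.
  have := h1 _ (cauchy_schwarz_cdot z1 w1); apply: le_trans.
  set u := rnorm _ ^+ 2.
  have -> : chi.[u] = u ^+ d * y.[u] ^+ 2 by rewrite /chi hornerM hornerXn horner_exp.
  by rewrite /phi hornerM [(_ * _) ^+ 2]exprMn mulrA.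
rewrite /zonal_eigenvalue -/m -/d -/y.
have -> : 'X^d * (1 - 'X) ^+ al * y * phi = (1 - 'X) ^+ al * (chi * psi).
  have E (K : comPzRingType) (a b c f : K) : b * a * c * (c * f) = a * (b * c ^+ 2 * f) by ring.
  exact: E.
have -> : al.+1%:R / y.[1] * pint ((1 - 'X) ^+ al * (chi * psi)) * (kc * y.[1]) =
    kc * al.+1%:R * pint ((1 - 'X) ^+ al * (chi * psi)).
  by have := jac1_neq0; move: y.[1] (pint _) (al.+1%:R : R) => a b c a0; field.
rewrite lerBlDr /zonal_constant.
apply: le_trans (ler_wpM2l _ h2) _; first by rewrite mulr_ge0.
rewrite mulrDr lerD2l mulrA ler_pdivrMr// mulrC ler_wpM2l ?ltW//.
by rewrite ltrDl.
Qed.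

End kernel_bounds.

(** * Hahn-Banach over the complex numbers *)

Section hahn_banach.
Variable R : realType.
Local Notation C := R[i].

Section sublinear_functionals.
Variable V : lmodType C.
Implicit Types (p q : V -> R) (u v a : V).

Definition sublinear p : Prop :=
  (forall u v, p (u + v) <= p u + p v) /\
  (forall (r : R) v, 0 <= r -> p (r%:C *: v) <= r * p v).

Lemma sublinear0 p : sublinear p -> p 0 = 0.
Proof.
move=> [pD pZ]; apply/eqP; rewrite eq_le; apply/andP; split.
  by have := pZ 0 0 (lexx 0); rewrite scaler0 mul0r.
by have := pD 0 0; rewrite addr0 -[leLHS]addr0 lerD2l.
Qed.

Lemma sublinearN p v : sublinear p -> - p (- v) <= p v.
Proof.
by move=> sp; rewrite -subr_ge0 opprK -(sublinear0 sp) -(subrr v); exact: sp.1.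
Qed.

Lemma sublinearZ p (r : R) v : sublinear p -> 0 <= r -> p (r%:C *: v) = r * p v.
Proof.
move=> sp; rewrite le_eqVlt => /predU1P[<-|r0].
  by rewrite scale0r mul0r sublinear0.
apply/eqP; rewrite eq_le sp.2 ?(ltW r0)//=.
have := sp.2 r^-1 (r%:C *: v); rewrite invr_ge0 (ltW r0) => /(_ isT).
rewrite scalerA -rmorphM mulVf ?gt_eqF// scale1r => h.
by rewrite mulrC -ler_pdivlMr// mulrC.
Qed.

(** [lo] keeps the infimum finite, and the last two hypotheses are a directedness of the family.
    Used for chains in Zorn's lemma, for translations along a vector, and for translations along the
    range of a map. *)
Lemma sublinear_inf (I : Type) (D : set I) (F : I -> V -> R) (lo : V -> R) :
  D !=set0 -> (forall i v, D i -> lo v <= F i v) ->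
  (forall i j u v, D i -> D j -> exists2 k, D k & F k (u + v) <= F i u + F j v) ->
  (forall i (r : R) v, D i -> 0 <= r -> exists2 k, D k & F k (r%:C *: v) <= r * F i v) ->
  sublinear (fun v => inf [set F i v | i in D]) /\
  forall i v, D i -> inf [set F i v | i in D] <= F i v.
Proof.
move=> [i0 Di0] loF FD FZ.
have hi v : has_inf [set F i v | i in D].
  split; first by exists (F i0 v), i0.
  by exists (lo v) => _ [i Di <-]; exact: loF.
have le_i i v : D i -> inf [set F i v | i in D] <= F i v.
  by move=> Di; apply: ge_inf; [exact: (hi v).2|exists i].
split=> //; split=> [u v|r v r0].
  rewrite -lerBlDr; apply: lb_le_inf; first exact: (hi u).1.
  move=> _ [i Di <-]; rewrite lerBlDr -lerBlDl; apply: lb_le_inf; first exact: (hi v).1.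
  move=> _ [j Dj <-]; rewrite lerBlDl.
  by have [k Dk] := FD i j u v Di Dj; apply: le_trans; exact: le_i.
have [->|rp] := eqVneq r 0.
  have [k Dk] := FZ i0 0 v Di0 (lexx 0); rewrite !mul0r; apply: le_trans.
  exact: le_i.
have {}rp : 0 < r by rewrite lt_neqAle eq_sym rp.
rewrite mulrC -ler_pdivrMr//; apply: lb_le_inf; first exact: (hi v).1.
move=> _ [i Di <-]; rewrite ler_pdivrMr// mulrC.
by have [k Dk] := FZ i r v Di r0; apply: le_trans; exact: le_i.
Qed.

(** Zorn for the reversed order; a chain is bounded by its pointwise infimum, which stays above
    -p(-v). *)
Lemma minimal_sublinear p : sublinear p -> exists q, [/\ sublinear q,
  forall v, q v <= p v &
  forall q', sublinear q' -> (forall v, q' v <= q v) -> q' = q].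
Proof.
move=> sp; pose T := {q : V -> R | sublinear q /\ forall v, q v <= p v}.
pose le (q q' : T) := `[< forall v, sval q' v <= sval q v >].
have [|||A tA|q qmin] := @Zorn T le.
- by move=> q; apply/asboolP => v.
- move=> q1 q2 q3 /asboolP h1 /asboolP h2; apply/asboolP => v.
  exact: le_trans (h2 v) (h1 v).
- move=> [q1 H1] [q2 H2] /asboolP/= h1 /asboolP/= h2.
  have E : q1 = q2 by apply/funext => v; apply/eqP; rewrite eq_le h1 h2.
  by move: H1 {h1 h2}; rewrite E => H1; congr exist; exact: Prop_irrelevance.
- have [->|/set0P A0] := eqVneq A set0.
    by exists (exist _ p (conj sp (fun v => lexx (p v)))).
  have [|||s1 s2] := @sublinear_inf T A (fun (r : T) v => sval r v) (fun v => - p (- v)) A0.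
  + move=> [q [sq qp]] v _ /=; apply: le_trans (sublinearN v sq).
    by rewrite lerN2.
  + move=> q1 q2 u v A1 A2; have [/asboolP h|/asboolP h] := tA _ _ A1 A2.
      exists q2 => //; apply: le_trans ((svalP q2).1.1 u v) _.
      by rewrite lerD2r.
    exists q1 => //; apply: le_trans ((svalP q1).1.1 u v) _.
    by rewrite lerD2l.
  + by move=> q r v Aq r0; exists q => //; exact: (svalP q).1.2.
  have [q0 Aq0] := A0.
  have lep v : inf [set sval q v | q in A] <= p v.
    by apply: le_trans (s2 q0 v Aq0) _; exact: (svalP q0).2.
  by exists (exist (fun q : V -> R => sublinear q /\ forall v, q v <= p v) _
    (conj s1 lep)) => q Aq; apply/asboolP => v /=; exact: s2.
exists (sval q); split; [exact: (svalP q).1|exact: (svalP q).2|].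
move=> q' sq' q'q.
have q'p v : q' v <= p v by apply: le_trans (q'q v) _; exact: (svalP q).2.
have /(congr1 sval) := qmin (exist _ q' (conj sq' q'p) : T) (asboolT q'q).
by [].
Qed.

(** The infimum over t >= 0 of q(v + t a) - t q(a) is sublinear and below [q], hence equal to it; t
    = 1 gives q(v) + q(a) <= q(v + a). *)
Lemma minimal_sublinearD q : sublinear q ->
  (forall q', sublinear q' -> (forall v, q' v <= q v) -> q' = q) ->
  forall u v, q (u + v) = q u + q v.
Proof.
move=> sq qmin v a; apply/eqP; rewrite eq_le sq.1/=.
have [||||s1 s2] := @sublinear_inf R [set t | 0 <= t]
  (fun t v => q (v + t%:C *: a) - t * q a) (fun v => - q (- v)).
- by exists 0 => /=.
- move=> t u /= t0; rewrite lerBrDr addrC lerBlDr -sublinearZ//.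
  by have := sq.1 (u + t%:C *: a) (- u); rewrite addrC addKr.
- move=> s t u w /= s0 t0; exists (s + t); first exact: addr_ge0.
  rewrite rmorphD scalerDl addrACA mulrDl opprD [leRHS]addrACA lerD2r.
  exact: sq.1.
- move=> t r u /= t0 r0; exists (r * t); first exact: mulr_ge0.
  by rewrite rmorphM -scalerA -scalerDr mulrBr mulrA lerD2r sq.2.
have E : (fun v => inf [set q (v + t%:C *: a) - t * q a | t in [set t | 0 <= t]]) = q.
  apply: qmin => // w; have := s2 0 w (lexx 0).
  by rewrite scale0r addr0 mul0r subr0.
have := s2 1 v ler01.
by rewrite scale1r mul1r (congr1 (@^~ v) E) lerBrDr.
Qed.

End sublinear_functionals.

Section real_part.

(** The infimum over w of p(v - I w) + f w is sublinear, below [p] (w = 0), and at most f u at I u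
    (w = u). A minimal functional below it is linear, and the inequality at u and -u becomes an
    equality. *)
Lemma real_hahn_banach (W V : lmodType C) (I : {linear W -> V}) (p : V -> R)
    (f : W -> R) : sublinear p ->
  (forall u v, f (u + v) = f u + f v) ->
  (forall (r : R) u, f (r%:C *: u) = r * f u) ->
  (forall u, f u <= p (I u)) ->
  exists g : V -> R, [/\ forall u v, g (u + v) = g u + g v,
    forall (r : R) v, g (r%:C *: v) = r * g v,
    forall v, g v <= p v & forall u, g (I u) = f u].
Proof.
move=> sp fD fZ fp.
have fN u : f (- u) = - f u.
  by have := fZ (- 1) u; rewrite rmorphN rmorph1 !mulN1r scaleN1r.
have [||||s1 s2] := @sublinear_inf V W setT
  (fun w v => p (v - I w) + f w) (fun v => - p (- v)).
- by exists 0.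
- move=> w v _; rewrite addrC -lerBlDr.
  have := sp.1 (v - I w) (- v); rewrite addrAC subrr add0r -linearN.
  by have := fp (- w); rewrite fN; lra.
- move=> w w' u v _ _; exists (w + w') => //.
  rewrite linearD fD opprD addrACA [leRHS]addrACA lerD2r; exact: sp.1.
- move=> w r v _ r0; exists (r%:C *: w) => //.
  by rewrite linearZ fZ mulrDr lerD2r -scalerBr; exact: sp.2.
have [g [sg gle gmin]] := minimal_sublinear s1.
have gD := minimal_sublinearD sg gmin.
have gN v : g (- v) = - g v.
  by apply/eqP; rewrite -addr_eq0 addrC -gD subrr (sublinear0 sg).
have gI u : g (I u) <= f u.
  apply: le_trans (gle _) (le_trans (s2 u (I u) Logic.I) _).
  by rewrite subrr (sublinear0 sp) add0r.
exists g; split=> [//|r v|v|u].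
- have [r0|r0] := leP 0 r; first exact: sublinearZ.
  rewrite -[r]opprK rmorphN scaleNr gN sublinearZ ?mulNr// oppr_ge0; exact: ltW.
- apply: le_trans (gle v) (le_trans (s2 0 v Logic.I) _).
  by rewrite linear0 subr0 -(subrr (0 : W)) fD fN subrr addr0.
- apply/eqP; rewrite eq_le gI /=.
  by have := gI (- u); rewrite linearN gN fN lerN2.
Qed.

End real_part.

Lemma rnormZ (V : normedModType C) (a : C) (v : V) :
  rnorm (a *: v) = rnorm a * rnorm v.
Proof. by apply: complexI; rewrite rmorphM /= -!rnormE normrZ. Qed.

Lemma Re_le_rnorm (x : C) : complex.Re x <= rnorm x.
Proof.
rewrite -lecR -rnormE; apply: le_trans (normc_ge_Re x).
by rewrite lecR ler_norm.
Qed.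

Lemma sublinear_rnorm (V : normedModType C) : sublinear (@rnorm R V).
Proof.
split=> [u v|r v r0]; first exact: rnormD.
by rewrite rnormZ rnorm_real.
Qed.

Lemma complex_hahn_banach (W : lmodType C) (V : normedModType C)
    (I : {linear W -> V}) (g : W -> C) :
  (forall u v, g (u + v) = g u + g v) ->
  (forall a u, g (a *: u) = a * g u) ->
  (forall u, rnorm (g u) <= rnorm (I u)) ->
  exists h : V -> C, [/\ forall u v, h (u + v) = h u + h v,
    forall a v, h (a *: v) = a * h v,
    forall v, rnorm (h v) <= rnorm v & forall u, h (I u) = g u].
Proof.
move=> gD gZ gle.
have [|r u|u|f [fD fZ fle fI]] := @real_hahn_banach W V I (@rnorm R V)
  (fun u => complex.Re (g u)) (sublinear_rnorm V).
- by move=> u v; rewrite gD ReD.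
- by rewrite gZ Defs.ReM /= mul0r subr0.
- exact: le_trans (Re_le_rnorm _) (gle u).
(* The complex-linear functional with real part [f]. *)
pose h v : C := f v +i* (- f ('i%C *: v)).
have hD u v : h (u + v) = h u + h v.
  by rewrite /h scalerDr !fD opprD.
have fN v : f (- v) = - f v.
  by have := fZ (- 1) v; rewrite rmorphN rmorph1 scaleN1r mulN1r.
have hR (r : R) v : h (r%:C *: v) = r%:C * h v.
  rewrite /h scalerA mulrC -scalerA !fZ -mulrN.
  by apply/eqP; rewrite eq_complex /= !mul0r subr0 addr0 !eqxx.
have hi v : h ('i%C *: v) = 'i%C * h v.
  rewrite /h scalerA -expr2 sqr_i scaleN1r fN opprK.
  by apply/eqP; rewrite eq_complex /= !mul0r !mul1r sub0r opprK add0r !eqxx.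
have hZ a v : h (a *: v) = a * h v.
  rewrite [a]complexE scalerDl hD -scalerA hi !hR.
  by rewrite mulrDl mulrA.
exists h; split=> // [v|u].
  have [h0|h0] := eqVneq (rnorm (h v)) 0; first by rewrite h0 rnorm_ge0.
  have hp : 0 < rnorm (h v) by rewrite lt_neqAle eq_sym h0 rnorm_ge0.
  (* Scaling v by the conjugate of h v makes the value of h the real number |h v|^2, to which the
     bound on [f] applies. *)
  rewrite -(ler_pM2l hp) -{3}(rnormJ (h v)) -rnormZ; apply: le_trans (fle _).
  have -> : f ((h v)^*%C *: v) = complex.Re (h ((h v)^*%C *: v)) by [].
  have -> : h ((h v)^*%C *: v) = (rnorm (h v) * rnorm (h v))%:C; last by [].
  by rewrite hZ mulrC -[_ * _]normCK rnormE -rmorphXn /= expr2.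
rewrite /h fI -linearZ fI gZ.
by apply/eqP; rewrite eq_complex Defs.ReM /= eqxx mul0r mul1r sub0r opprK eqxx.
Qed.

End hahn_banach.

(** * The Banach space of bounded functions *)

Section bounded_functions.
Variables (R : realType) (T : Type).
Local Notation C := R[i].

Definition bounded_functions : {pred T -> C} :=
  fun f => `[< exists M : R, forall t, rnorm (f t) <= M >].

Lemma bounded_functions_submod_closed : submod_closed bounded_functions.
Proof.
split.
  by apply/asboolP; exists (rnorm (0 : C)) => t.
move=> k f g /asboolP[M fM] /asboolP[N gN].
apply/asboolP; exists (rnorm k * M + N) => t.
rewrite (le_trans (rnormD _ _))// lerD// rnormM ler_wpM2l ?rnorm_ge0//.
Qed.

HB.instance Definition _ := GRing.isSubmodClosed.Build _ _ bounded_functions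
  bounded_functions_submod_closed.

Record bfun : Type := MkBfun {
  bfun_fun :> T -> C;
  bfun_funP : bfun_fun \in bounded_functions }.

HB.instance Definition _ := [isSub for bfun_fun].
HB.instance Definition _ := [Choice of bfun by <:].
HB.instance Definition _ := [SubChoice_isSubLmodule of bfun by <:].

Definition bnorm (f : bfun) : R := sup (range (fun t => rnorm (f t))).

Lemma le_bnorm (f : bfun) t : rnorm (f t) <= bnorm f.
Proof.
apply: ub_le_sup; last by exists t.
have /asboolP[M fM] := bfun_funP f.
by exists M => _ [w _ <-].
Qed.

Lemma bnorm_le (f : bfun) (M : R) : 0 <= M ->
  (forall t, rnorm (f t) <= M) -> bnorm f <= M.
Proof.
move=> M0 fM; rewrite /bnorm.
have [->|/set0P fN0] := eqVneq (range (fun t => rnorm (f t))) set0.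
  by rewrite sup0.
by apply: ge_sup => // _ [z _ <-].
Qed.

Lemma bnorm_ge0 (f : bfun) : 0 <= bnorm f.
Proof.
have [S0|/set0P[_ [z _ _]]] := eqVneq (range (fun t => rnorm (f t))) set0.
  by rewrite /bnorm S0 sup0.
exact: le_trans (rnorm_ge0 (f z)) (le_bnorm f z).
Qed.

Definition bfun_norm (f : bfun) : C := (bnorm f)%:C.

Lemma bfun_normD f g : bfun_norm (f + g) <= bfun_norm f + bfun_norm g.
Proof.
rewrite -rmorphD/= lecR; apply: bnorm_le => [|z].
  by rewrite addr_ge0 ?bnorm_ge0.
by rewrite (le_trans (rnormD _ _))// lerD ?le_bnorm.
Qed.

Lemma bfun_normZ (l : C) f : bfun_norm (l *: f) = `|l| * bfun_norm f.
Proof.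
have le_scale k g : bnorm (k *: g) <= rnorm k * bnorm g.
  apply: bnorm_le => [|z]; first by rewrite mulr_ge0 ?rnorm_ge0 ?bnorm_ge0.
  by rewrite rnormM ler_wpM2l ?rnorm_ge0 ?le_bnorm.
rewrite rnormE -rmorphM/=; congr (_%:C); apply/eqP; rewrite eq_le le_scale/=.
have [->|l0] := eqVneq l 0.
  suff -> : rnorm (0 : C) = 0 by rewrite mul0r bnorm_ge0.
  by apply/eqP; rewrite rnorm_eq0.
have lgt0 : 0 < rnorm l by rewrite lt_neqAle eq_sym rnorm_eq0 l0 rnorm_ge0.
have := le_scale l^-1 (l *: f); rewrite scalerA mulVf// scale1r.
move=> /(ler_wpM2l (ltW lgt0)); rewrite mulrA -rnormM divff//.
by rewrite rnorm_real// mul1r.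
Qed.

Lemma bfun_norm_eq0 f : bfun_norm f = 0 -> f = 0.
Proof.
move=> /complexI f0; apply: val_inj; apply/funext => z; apply/eqP.
by rewrite -rnorm_eq0 eq_le rnorm_ge0 -f0 le_bnorm.
Qed.

HB.instance Definition _ := Lmodule_isNormed.Build R[i] bfun
  bfun_normD bfun_normZ bfun_norm_eq0.

Lemma rnorm_Re_Im (x : C) : rnorm x <= `|complex.Re x| + `|complex.Im x|.
Proof.
rewrite {1}[x]complexE (le_trans (rnormD _ _))// rnormM !rnorm_realE lerD2l.
suff -> : rnorm ('i%C : C) = 1 by rewrite mul1r.
by rewrite /rnorm normc_def /= expr0n expr1n add0r sqrtr1.
Qed.

Lemma Re_Im_le_rnorm (x : C) :
  (`|complex.Re x| <= rnorm x) /\ (`|complex.Im x| <= rnorm x).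
Proof.
have h (y : R) (a b : C) : `|y| ^+ 2 <= rnorm a ^+ 2 -> `|y| <= rnorm a.
  by rewrite ler_sqr ?nnegrE ?rnorm_ge0.
have E : rnorm x ^+ 2 = complex.Re x ^+ 2 + complex.Im x ^+ 2.
  by rewrite /rnorm normc_def /= sqr_sqrtr// addr_ge0 ?sqr_ge0.
by split; apply: h => //; rewrite E real_normK ?num_real// ?lerDl ?lerDr sqr_ge0.
Qed.

Lemma gt0_complexE (e : C) : 0 < e -> exists2 r : R, 0 < r & e = r%:C.
Proof.
move=> e0; exists (complex.Re e); last by rewrite RRe_real ?gtr0_real.
by rewrite -ltcR RRe_real ?gtr0_real.
Qed.

Lemma bfun_ballE (f g : bfun) (r : R) :
  ball f (r%:C) g <-> bnorm (f - g) < r.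
Proof. by rewrite -ball_normE /= /bfun_norm; split; rewrite [`|_|]/(bfun_norm _) ltcR. Qed.

(** The limit is built pointwise from real and imaginary parts. It is uniform because the centre [x]
    of a small ball is chosen before the point [t]; only the auxiliary [g] depends on [t]. *)
Lemma bfun_complete (F : set_system bfun) : ProperFilter F -> cauchy F -> cvg F.
Proof.
move=> FF /cauchyP Fc.
have Fx (e : R) : 0 < e -> exists x, F [set g | bnorm (x - g) < e].
  move=> e0; have [|x Fx] := Fc (e%:C); first by rewrite ltcR.
  by exists x; apply: filterS Fx => g /bfun_ballE.
have lim_coord (u : C -> R) : (forall x y, u (x - y) = u x - u y) ->
    (forall x, `|u x| <= rnorm x) ->
    exists l : T -> R, forall t (e : R), 0 < e -> F [set g | `|l t - u (g t)| < e].
  move=> uB ule.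
  have : forall t, exists l : R, forall e : R, 0 < e -> F [set g | `|l - u (g t)| < e].
    move=> t; have FG : ProperFilter ((fun g : bfun => u (g t)) @ F) by exact: fmap_proper_filter.
    have /cauchy_cvg/cvg_ex[l /fcvg_ballP lF] : cauchy ((fun g : bfun => u (g t)) @ F).
      apply/cauchy_exP => e e0; have [x Fe] := Fx e e0.
      exists (u (x t)).
      suff : F [set g | `|u (x t) - u (g t)| < e] by [].
      apply: filterS Fe => g /= ge.
      by rewrite -uB; apply: le_lt_trans (ule _) (le_lt_trans (le_bnorm (x - g) t) ge).
    exists l => e e0; have := lF e e0; rewrite near_simpl -ball_normE /=.
    by [].
  by move=> /choice[l lP]; exists l.
have [|x|lr lrF] := lim_coord (@complex.Re R).
- by move=> x y; case: x => a b; case: y.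
- exact: (Re_Im_le_rnorm x).1.
have [|x|li liF] := lim_coord (@complex.Im R).
- by move=> x y; case: x => a b; case: y.
- exact: (Re_Im_le_rnorm x).2.
pose f t : C := lr t +i* li t.
have close e : 0 < e -> exists x : bfun, F [set g | bnorm (x - g) < e] /\
    forall t, rnorm (f t - x t) <= 3 * e.
  move=> e0; have [x xF] := Fx e e0; exists x; split=> // t.
  have [g [/= [g1 g2] g3]] := filter_ex (filterI (filterI (lrF t e e0) (liF t e e0)) xF).
  have -> : f t - x t = (f t - g t) - (x t - g t) by rewrite opprB addrA subrK.
  apply: le_trans (rnormD _ _) _.
  have h1 := le_bnorm (x - g) t; have h2 := rnorm_Re_Im (f t - g t).
  have E : `|complex.Re (f t - g t)| + `|complex.Im (f t - g t)| =
     `|lr t - complex.Re (g t)| + `|li t - complex.Im (g t)|.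
    by rewrite /f; case: (g t).
  have E2 : rnorm (- (x t - g t)) = rnorm ((x - g) t) by rewrite /rnorm normrN.
  by rewrite E2; lra.
have fb : f \in bounded_functions.
  have [x [_ fx]] := close 1 ltr01; apply/asboolP; exists (3 * 1 + bnorm x) => t.
  by rewrite -[f t](subrK (x t)) (le_trans (rnormD _ _))// lerD// le_bnorm.
apply/cvg_ex; exists (MkBfun fb); apply/fcvg_ballP => e /gt0_complexE[r r0 ->].
(* 3r/5 from the limit to [x] and r/5 from [x] to [g], in all less than r. *)
have [|x [xF fx]] := close (r / 5); first by rewrite divr_gt0.
apply: filterS xF => g /= xg; apply/bfun_ballE.
have : bnorm (MkBfun fb - g) <= 4 * (r / 5); last by lra.
apply: bnorm_le => [|t]; first by lra.
have -> : (MkBfun fb - g) t = (f t - x t) + (x - g) t.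
  by rewrite /= addrA subrK.
by apply: le_trans (rnormD _ _) _; have := fx t; have := le_bnorm (x - g) t; lra.
Qed.

HB.instance Definition _ := Uniform_isComplete.Build bfun bfun_complete.

End bounded_functions.

(** * The projection constant *)

Section spherical_harmonics_space.
Variables (R : realType) (al p q : nat).
Local Notation C := R[i].
Local Notation S := (sphere R al.+2).
Local Notation X := (Hpq R al.+2 p q).

Lemma cdot_rnorm n (z : 'rV[C]_n) : cdot z z = (\sum_j rnorm (z 0 j) ^+ 2)%:C.
Proof.
by rewrite rmorph_sum; apply: eq_bigr => j _; rewrite -normCK rnormE rmorphXn.
Qed.

Lemma sphere_cdot n (z : 'rV[C]_n) :
  (Num.sqrt (\sum_j rnorm (z 0 j) ^+ 2) == 1) = (cdot z z == 1).
Proof.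
have s0 : 0 <= \sum_j rnorm (z 0 j) ^+ 2 by apply: sumr_ge0 => j _; exact: sqr_ge0.
by rewrite cdot_rnorm (inj_eq (@complexI R)) -(@eqrXn2 _ 2)// sqr_sqrtr// expr1n.
Qed.

Lemma sphere_val_cdot (z : S) : cdot (val z) (val z) = 1.
Proof. by apply/eqP; rewrite -sphere_cdot; exact: (valP z). Qed.

Lemma sphere_base_proof :
  Num.sqrt (\sum_j rnorm ((delta_mx 0 0 : 'rV[C]_al.+2) 0 j) ^+ 2) == 1.
Proof.
rewrite sphere_cdot /cdot (bigD1 0)//= big1 ?addr0 => [|j /negbTE j0].
  by rewrite mxE eqxx mul1r rmorph1.
by rewrite !mxE j0 mul0r.
Qed.

Lemma rnorm_sum (I : Type) (r : seq I) (F : I -> C) :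
  rnorm (\sum_(i <- r) F i) <= \sum_(i <- r) rnorm (F i).
Proof.
elim: r => [|i r IH]; first by rewrite !big_nil /rnorm normr0.
by rewrite !big_cons (le_trans (rnormD _ _))// lerD2l.
Qed.

(** The default, a basis vector, makes this total: it turns quadrature nodes into points of the
    sphere, and [sphere_pt 0] into some point of it. *)
Definition sphere_pt (z : 'rV[C]_al.+2) : S := insubd 
  (exist (fun z : 'rV[C]_al.+2 => Num.sqrt (\sum_j rnorm (z 0 j) ^+ 2) == 1) _
    sphere_base_proof : S) z.

Lemma sphere_ptK (z : 'rV[C]_al.+2) : cdot z z = 1 -> val (sphere_pt z) = z.
Proof. by move=> z1; rewrite insubdK// unfold_in sphere_cdot z1. Qed.

Lemma bihomogeneous_bihom f : @bihomogeneous R al.+2 p q f -> bihom p q f.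
Proof.
move=> [c fE]; apply: eq_bihom (fun z => esym (fE z)) _.
apply: bihom_sum => a /eqP ap; apply: bihom_sum => b /eqP bq.
exact: bihom_mon.
Qed.

Lemma bihom_bihomogeneous f : bihom p q f -> @bihomogeneous R al.+2 p q f.
Proof.
elim=> [|c a b {}f ap bq _ IH].
  exists (fun _ _ => 0) => z; rewrite big1// => a _; rewrite big1// => b _.
  by rewrite mul0r.
apply: bihomogeneous_linear IH.
have le_sum (e : 'I_al.+2 -> nat) j : (e j < (\sum_j e j).+1)%N.
  by rewrite ltnS (bigD1 j)//= leq_addr.
have ha j : (a j < p.+1)%N by rewrite -ap le_sum.
have hb j : (b j < q.+1)%N by rewrite -bq le_sum.
have eqs k (e : 'I_al.+2 -> nat) (e' : {ffun 'I_al.+2 -> 'I_k.+1}) :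
    (forall j, e' j = e j :> nat) -> (\sum_j e j)%N = k -> (\sum_j e' j == k)%N.
  by move=> ee ek; apply/eqP; apply: etrans ek; apply: eq_bigr => j _.
pose a' := [ffun j => Ordinal (ha j)]; pose b' := [ffun j => Ordinal (hb j)].
(* The coefficients of a single monomial: the indicator of its pair of exponents. *)
exists (fun u v => ((u == a') && (v == b'))%:R) => z.
rewrite (bigD1 a')/=; last by apply: (eqs p a) => // j; rewrite ffunE.
rewrite (bigD1 b')/=; last by apply: (eqs q b) => // j; rewrite ffunE.
rewrite !eqxx mul1r [X in _ = _ + X]big1 ?addr0 => [|u /andP[_ /negbTE u0]]; last first.
  by rewrite big1// => v _; rewrite u0 mul0r.
rewrite [X in _ = _ + X]big1 ?addr0 => [|v /andP[_ /negbTE v0]]; last by rewrite v0 mul0r.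
by rewrite /monomial; congr (_ * _); apply: eq_bigr => j _; rewrite ffunE.
Qed.

Lemma harmonicsP f : @harmonics R al.+2 p q f <-> bihom p q f /\ harmonic_fun f.
Proof.
split=> -[h1 h2]; split => //; first exact: bihomogeneous_bihom.
exact: bihom_bihomogeneous.
Qed.

Lemma kernel_elt_proof (w : S) :
  (fun u : S => zkernel p q (val w) (val u)) \in @sphere_harmonics R al.+2 p q.
Proof.
apply/asboolP; exists (zkernel p q (val w)) => //; apply/harmonicsP; split.
  exact: bihom_zkernel.
exact/harmonic_zkernel/sphere_val_cdot.
Qed.

Definition kernel_elt (w : S) : X := MkHpq (kernel_elt_proof w).

Lemma Hpq_sumE (I : Type) (r : seq I) (F : I -> X) (u : S) :
  (\sum_(i <- r) F i) u = \sum_(i <- r) F i u.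
Proof. exact: (big_morph (fun f : X => f u)). Qed.

Lemma Hpq_reproducing D s (f : X) (u : S) : exact_quadrature D s ->
  ((p + q).+2 <= D)%N ->
  f u = \sum_(x <- s) x.1%:C * f (sphere_pt x.2) * zkernel p q x.2 (val u).
Proof.
move=> sD pqD; have /asboolP[g /harmonicsP[bg hg] fE] := Hpq_funP f.
have := reproducing sD pqD bg hg (sphere_val_cdot u).
rewrite fE /= => ->; apply: eq_big_seq => x xs.
by rewrite sphere_ptK ?mulrA// (quad_node sD xs).
Qed.

Lemma Hpq_reproducingE D s (f : X) : exact_quadrature D s ->
  ((p + q).+2 <= D)%N ->
  f = \sum_(x <- s) (x.1%:C * f (sphere_pt x.2)) *: kernel_elt (sphere_pt x.2).
Proof.
move=> sD pqD; apply: val_inj; apply/funext => u /=.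
rewrite Hpq_sumE [LHS](Hpq_reproducing f u sD pqD); apply: eq_big_seq => x xs.
rewrite [RHS]/(x.1%:C * f (sphere_pt x.2) * zkernel p q (val (sphere_pt x.2)) (val u)).
by rewrite [val (sphere_pt x.2)]sphere_ptK// (quad_node sD xs).
Qed.

Lemma zonal_constant_upper (Y : completeNormedModType C) (I : {linear X -> Y}) :
  (forall f, `|I f| = `|f|) ->
  (rel_projection_constant (range I) <= (zonal_constant R al p q)%:E)%E.
Proof.
move=> isoI; apply/lee_addgt0Pr => e e0.
have [D [s [sD pqD sle]]] := kernel_upper_bound al p q e0.
set M := _ + e in sle.
have M0 : 0 <= M.
  apply: le_trans (sle _ (sphere_val_cdot (sphere_pt 0))).
  rewrite big_seq; apply: sumr_ge0 => x xs; rewrite mulr_ge0 ?rnorm_ge0//.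
  by have [] := sD.1 _ xs.
have rI (f : X) : rnorm (I f) = rnorm f by rewrite /rnorm isoI.
(* Evaluation at [w] is bounded by the supremum norm, which [I] preserves. *)
have /choice[h hP] : forall w : S, exists h : Y -> C,
    [/\ forall u v, h (u + v) = h u + h v, forall a v, h (a *: v) = a * h v,
      forall v, rnorm (h v) <= rnorm v & forall f : X, h (I f) = f w].
  move=> w; apply: (@complex_hahn_banach R X Y I (fun f : X => f w)) => // f.
  by rewrite rI; exact: le_supnorm.
pose Q (y : Y) : X :=
  \sum_(x <- s) (x.1%:C * h (sphere_pt x.2) y) *: kernel_elt (sphere_pt x.2).
have Ql : linear (I \o Q).
  move=> a u v /=; rewrite -linearP; congr (I _); rewrite /Q scaler_sumr -big_split.
  apply: eq_bigr => x _ /=; have [hD hZ _ _] := hP (sphere_pt x.2).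
  by rewrite hD hZ scalerA -scalerDl; congr (_ *: _); ring.
pose P : {linear Y -> Y} := HB.pack (I \o Q) (GRing.isLinear.Build _ _ _ _ _ Ql).
have PM y : rnorm (P y) <= rnorm y * M.
  rewrite [P y]/(I (Q y)) rI; apply: supnorm_le => [|u].
    by rewrite mulr_ge0 ?rnorm_ge0.
  rewrite Hpq_sumE.
  apply: le_trans (_ : _ <= \sum_(x <- s) rnorm y * (x.1 * rnorm (zkernel p q x.2 (val u)))) _.
    apply: le_trans (rnorm_sum _ _) _.
    rewrite big_seq [leRHS]big_seq; apply: ler_sum => x xs.
    have [x0 _] := sD.1 _ xs; have [_ _ hle _] := hP (sphere_pt x.2).
    rewrite [X in rnorm X]/(x.1%:C * h (sphere_pt x.2) y * zkernel p q (val (sphere_pt x.2)) (val u)).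
    rewrite sphere_ptK ?(quad_node sD xs)// rnormM; move: (rnorm_ge0 (zkernel p q x.2 (val u))).
    set k := rnorm (zkernel _ _ _ _) => k0; rewrite rnormM rnorm_real// -mulrA mulrCA.
    by rewrite ler_wpM2r ?hle// mulr_ge0.
  by rewrite -mulr_sumr ler_wpM2l ?rnorm_ge0// sle// sphere_val_cdot.
have QI (f : X) : Q (I f) = f.
  rewrite [RHS](Hpq_reproducingE f sD pqD); apply: eq_bigr => x _.
  by have [_ _ _ ->] := hP (sphere_pt x.2).
apply: le_trans (_ : _ <= opnorm P)%E _.
  apply: ereal_inf_lbound; exists P => //; split.
  - apply/linear_bounded_continuous/linear_boundedP.
    exists (M%:C); split; first by rewrite ger0_real// lecR.
    move=> r Mr y; apply: le_trans (_ : _ <= M%:C * `|y|) _.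
      by rewrite !rnormE -rmorphM lecR mulrC PM.
    by rewrite ler_wpM2r// ltW.
  - apply/seteqP; split=> [_ [y _ <-]|_ [f _ <-]]; first by exists (Q y).
    by exists (I f) => //; rewrite [LHS]/(I (Q (I f))) QI.
  - by move=> _ [f _ <-]; rewrite [LHS]/(I (Q (I f))) QI.
apply: ge_ereal_sup => _ [y /= y1 <-]; rewrite -EFinD lee_fin -/M.
by apply: le_trans (PM y) _; rewrite ler_piMl.
Qed.

Lemma Hpq_bounded (f : X) : (f : S -> C) \in @bounded_functions R S.
Proof. by apply/asboolP; exists (supnorm f) => u; exact: le_supnorm. Qed.

Definition Hpq_bfun (f : X) : bfun R S := MkBfun (Hpq_bounded f).

Lemma Hpq_bfun_linear : linear Hpq_bfun.
Proof. by move=> a f g; exact: val_inj. Qed.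

HB.instance Definition _ := GRing.isLinear.Build _ _ _ _ Hpq_bfun Hpq_bfun_linear.

Lemma zonal_sign_bounded (phi : {poly R}) (z : S) :
  (forall z w, cdot z z = 1 -> cdot w w = 1 -> @rnorm R C (@zonal_sign R al p q phi w z) <= 1) ->
  (fun u : S => zonal_sign p q phi (val u) (val z)) \in @bounded_functions R S.
Proof. by move=> h; apply/asboolP; exists 1 => u; apply: h; exact: sphere_val_cdot. Qed.

Lemma bfun_sumE (I : Type) (r : seq I) (F : I -> bfun R S) (u : S) :
  (\sum_(i <- r) F i) u = \sum_(i <- r) F i u.
Proof. exact: (big_morph (fun f : bfun R S => f u)). Qed.

Lemma bfun_scaleE a (f : bfun R S) (u : S) : (a *: f) u = a * f u.
Proof. by []. Qed.

Lemma zonal_constant_lower :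
  ((zonal_constant R al p q)%:E <= rel_projection_constant (range Hpq_bfun))%E.
Proof.
apply: le_ereal_inf_tmp => _ [P [_ Prange Pid] <-].
apply/lee_addgt0Pr => e e0.
have [D [s [phi [sD pqD phiD phi1 le_lam]]]] := kernel_lower_bound al p q e0.
pose F (z : S) : bfun R S := MkBfun (zonal_sign_bounded z phi1).
have F1 z : rnorm (F z) <= 1.
  by apply: bnorm_le => // u; apply: (phi1); exact: sphere_val_cdot.
(* Funk-Hecke applied to the kernel itself, in the variable over which the functions [F] are
   indexed. *)
have Pcol (u : S) : \sum_(x <- s) (x.1%:C * zkernel p q (val u) x.2) *: F (sphere_pt x.2) =
    (zonal_eigenvalue al p q phi)%:C *: Hpq_bfun (kernel_elt u).
  apply: val_inj; apply/funext => v /=; rewrite bfun_sumE.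
  have := qavg_zonal sD (bihom_zkernel p q (val u))
    (harmonic_zkernel p q (sphere_val_cdot u)) (sphere_val_cdot v) phiD.
  move=> E; transitivity ((zonal_eigenvalue al p q phi)%:C * zkernel p q (val u) (val v)) => //.
  rewrite -E; apply: eq_big_seq => x xs.
  rewrite /= [LHS]/(x.1%:C * zkernel p q (val u) x.2 *
    zonal_sign p q phi (val v) (val (sphere_pt x.2))).
  by rewrite sphere_ptK ?(quad_node sD xs)// mulrA.
have Prep (z u : S) : P (F z) u =
    \sum_(x <- s) x.1%:C * P (F z) (sphere_pt x.2) * zkernel p q x.2 (val u).
  have [f _ <-] : range Hpq_bfun (P (F z)) by rewrite -Prange; exists (F z).
  exact: (Hpq_reproducing f u sD pqD).
(* After the exchange of sums, the inner one is P applied to [Pcol]; what remains is the average of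
   the kernel on the diagonal, which is the same at every node. *)
have trace : \sum_(y <- s) y.1%:C * P (F (sphere_pt y.2)) (sphere_pt y.2) =
    (zonal_eigenvalue al p q phi * (zkernel_const R al p q * (jac R al `|p - q| (minn p q)).[1]))%:C.
  under eq_bigr do rewrite Prep mulr_sumr.
  rewrite exchange_big /=.
  transitivity (\sum_(x <- s) x.1%:C *
      (zonal_eigenvalue al p q phi *
       (zkernel_const R al p q * (jac R al `|p - q| (minn p q)).[1]))%:C); last first.
    by rewrite -[LHS]/(qavg s (fun=> _)) (qavg_cst sD).
  apply: eq_big_seq => x xs; have xn := quad_node sD xs.
  transitivity (x.1%:C * P (\sum_(y <- s) (y.1%:C * zkernel p q (val (sphere_pt x.2)) y.2) *:
      F (sphere_pt y.2)) (sphere_pt x.2)).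
    rewrite linear_sum bfun_sumE mulr_sumr; apply: eq_big_seq => y ys; have yn := quad_node sD ys.
    rewrite [P (_ *: _)]linearZ bfun_scaleE (sphere_ptK yn) (sphere_ptK xn).
    by move: (P _ _) (zkernel _ _ _ _) => a b; ring.
  rewrite Pcol linearZ Pid; last by exists (kernel_elt (sphere_pt x.2)).
  have kx : Hpq_bfun (kernel_elt (sphere_pt x.2)) (sphere_pt x.2) =
    zkernel p q (val (sphere_pt x.2)) (val (sphere_pt x.2)) by [].
  rewrite bfun_scaleE kx (sphere_ptK xn) zkernelE// xn.
  have -> : rnorm (1 : C) = 1 by rewrite /rnorm normr1.
  by rewrite !expr1n !mul1r !rmorphM.
have mass : \sum_(y <- s) y.1 = 1.
  apply: complexI; rewrite rmorph1 -(qavg_cst sD 1) rmorph_sum/=.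
  by apply: eq_bigr => x _; rewrite mulr1.
have {le_lam}le_lam : zonal_constant R al p q - e <=
    \sum_(y <- s) y.1 * rnorm (P (F (sphere_pt y.2))).
  apply: le_trans le_lam _; apply: le_trans (Re_le_rnorm ((_)%:C)) _.
  rewrite -trace; apply: le_trans (rnorm_sum _ _) _.
  rewrite big_seq [leRHS]big_seq; apply: ler_sum => x xs.
  have [x0 _] := sD.1 _ xs.
  by rewrite rnormM rnorm_real// ler_wpM2l// le_bnorm.
have Ple z : ((rnorm (P (F z)))%:E <= opnorm P)%E.
  by apply: ereal_sup_ubound; exists (F z) => //; exact: F1.
(* The norm is an extended real: +oo is trivial, and -oo is excluded by any one value. *)
case: (opnorm P) Ple => [r|_|Ple].
- move=> Ple; rewrite -EFinD lee_fin -lerBlDr; apply: le_trans le_lam _.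
  rewrite -[r]mul1r -mass mulr_suml big_seq [leRHS]big_seq; apply: ler_sum => x xs.
  have [x0 _] := sD.1 _ xs.
  by rewrite ler_wpM2l// -lee_fin.
- by rewrite addye// leey.
- by have := Ple (sphere_pt 0); rewrite leeNy_eq.
Qed.

Lemma projection_constant_zonal :
  projection_constant X = (zonal_constant R al p q)%:E.
Proof.
apply/eqP; rewrite eq_le; apply/andP; split.
  by apply: ge_ereal_sup => _ [Y [I [isoI ->]]]; exact: zonal_constant_upper.
apply: le_trans zonal_constant_lower _; apply: ereal_sup_ubound.
by exists (bfun R S), Hpq_bfun.
Qed.

End spherical_harmonics_space.

(** * Gamma and Jacobi polynomials in closed form *)

Section gamma_factorial.
Variable R : realType.

(** Minus this polynomial times e^(-t) is a primitive of t^k e^(-t). *)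
Fixpoint gamma_primitive k : {poly R} :=
  if k is k'.+1 then 'X^k + k%:R *: gamma_primitive k' else 1.

Lemma deriv_gamma_primitive k : (gamma_primitive k)^`() = gamma_primitive k - 'X^k.
Proof.
elim: k => [|k IH] /=; first by rewrite expr0 subrr derivC.
rewrite derivD derivZ IH derivXn scalerBr -[_ *+ k.+1]scaler_nat addrC subrK.
by rewrite addrAC subrr add0r.
Qed.

Lemma gamma_primitive0 k : (gamma_primitive k).[0] = k`!%:R.
Proof.
elim: k => [|k IH] /=; first by rewrite hornerC.
by rewrite hornerD hornerXn expr0n hornerZ IH add0r -natrM.
Qed.

Lemma cvg_exprn_expRN k : t ^+ k * expR (- t) @[t --> +oo] --> (0 : R).
Proof.
apply: (@squeeze_cvgr _ _ _ _ (cst 0) (fun t : R => k.+1`!%:R * t^-1)).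
- near=> t; have t0 : 0 < t by near: t; exact: nbhs_pinfty_gt.
  rewrite mulr_ge0 ?exprn_ge0 ?expR_ge0 ?(ltW t0)//=.
  rewrite expRN ler_pdivrMr ?expR_gt0// mulrAC ler_pdivlMr// -exprSr.
  have := expR_ge1Dxn k (ltW t0).
  have f0 : 0 < k.+1`!%:R :> R by rewrite ltr0n fact_gt0.
  rewrite -ler_pdivrMl// mulrC; apply: le_trans.
  by rewrite lerDr.
- exact: cvg_cst.
- rewrite -[X in _ --> X](mulr0 k.+1`!%:R).
  apply: cvgM; first exact: cvg_cst.
  by apply/gtr0_cvgV0; [exact: nbhs_pinfty_gt|exact: cvg_id].
Unshelve. all: by end_near. Qed.

Lemma cvg_gamma_primitive k :
  (gamma_primitive k).[t] * expR (- t) @[t --> +oo] --> (0 : R).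
Proof.
elim: k => [|k IH] /=.
  by under eq_fun => t do rewrite hornerC -(expr0 t); exact: cvg_exprn_expRN.
under eq_fun do rewrite hornerD hornerXn hornerZ mulrDl -mulrA.
have := cvgD (cvg_exprn_expRN k.+1) (cvgM (@cvg_cst _ (k.+1%:R : R) _ +oo _) IH).
by rewrite mulr0 addr0; apply.
Qed.

Lemma Gamma_nat k : Gamma (k.+1%:R : R) = k`!%:R.
Proof.
rewrite /Gamma -[k.+1]addn1 natrD addrK.
pose f (t : R) := t ^+ k * expR (- t).
pose F (t : R) := - ((gamma_primitive k).[t] * expR (- t)).
have dF t : is_derive t (1 : R) F (f t).
  have h1 : is_derive t (1 : R) (horner (gamma_primitive k)) (gamma_primitive k)^`().[t].
    exact: is_derive_poly.
  have h2 : is_derive t (1 : R) (fun t => expR (- t)) (- expR (- t)).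
    have := @is_derive1_comp R expR -%R t _ _ (is_derive_expR _) (is_deriveNid t 1).
    by rewrite mulrN1.
  have := is_deriveN (is_deriveM h1 h2); congr is_derive.
  rewrite deriv_gamma_primitive /f /GRing.scale/= !hornerE; ring.
have cf : continuous f.
  move=> t; apply: cvgM; first exact: exprn_continuous.
  apply: continuous_comp; first exact: oppr_continuous.
  exact: continuous_expR.
have cF : continuous F.
  by move=> t; apply/differentiable_continuous/derivable1_diffP; exact: (@ex_derive _ _ _ _ _ _ _ (dF t)).
have E : (\int[lebesgue_measure]_(t in `[0%R, +oo[) (f t)%:E = k`!%:R%:E)%E.
  rewrite (@ge0_continuous_FTC2y _ f F 0 0).
  - by rewrite /F oppr0 expR0 mulr1 gamma_primitive0 EFinN oppeK add0e.
  - by move=> t t0; rewrite mulr_ge0 ?exprn_ge0 ?expR_ge0.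
  - exact: continuous_subspaceT.
  - by rewrite -[X in _ --> X]oppr0; apply: cvgN; exact: cvg_gamma_primitive.
  - by move=> t _; exact: (@ex_derive _ _ _ _ _ _ _ (dF t)).
  - by apply: cvg_at_right_filter; exact: cF.
  - by move=> t _; rewrite derive1E (@derive_val _ _ _ _ _ _ _ (dF t)).
rewrite (@eq_Rintegral _ _ _ lebesgue_measure _ f); last first.
  by move=> t; rewrite inE /= in_itv /= andbT => t0; rewrite /f powR_mulrn// ltW.
rewrite /Rintegral integral_itv_obnd_cbnd; first by rewrite E.
apply/measurable_realfun.measurable_EFinP; apply: measurable_funTS.
exact: measurable_realfun.continuous_measurable_fun.
Qed.

End gamma_factorial.

(** * Rodrigues' formula moved to [0, 1] *)

Section jacobi_shifted.
Variables (R : realType) (al d m : nat).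

Lemma poly_eq_itv (p q : {poly R}) :
  (forall t, 0 < t < 1 -> p.[t] = q.[t]) -> p = q.
Proof.
move=> pq; apply/eqP; rewrite -subr_eq0; apply/contraT => pq0.
pose N := size (p - q); pose x (i : nat) : R := i.+1%:R / N.+2%:R.
pose s := [seq x i | i <- iota 0 N].
have us : uniq s.
  rewrite map_inj_uniq ?iota_uniq// => i j /(mulIf _) h.
  by apply/succn_inj/eqP; rewrite -(eqr_nat R) h// invr_neq0// pnatr_eq0.
have rs : all (root (p - q)) s.
  apply/allP => _ /mapP[i + ->]; rewrite mem_iota add0n /= => iN.
  rewrite /root hornerD hornerN pq ?subrr// /x divr_gt0 ?ltr0n//=.
  by rewrite ltr_pdivrMr ?ltr0n// mul1r ltr_nat !ltnS ltnW.
by have := max_poly_roots pq0 rs us; rewrite size_map size_iota ltnn.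
Qed.

Lemma derive1n_itv (f g : R -> R) a b k :
  (forall t, a < t < b -> f t = g t) ->
  forall t, a < t < b -> derive1n k f t = derive1n k g t.
Proof.
move=> fg; elim: k => [|k IH] t tab; first by rewrite !derive1n0 fg.
rewrite !derive1nS !derive1E; apply: near_eq_derive; near=> s; apply: IH.
near: s.
have : t \in `]a, b[ by rewrite in_itv.
by move=> /near_in_itvoo; apply: filterS => s; rewrite in_itv.
Unshelve. all: by end_near. Qed.

Lemma derive1n_horner (p : {poly R}) k : derive1n k (horner p) = horner (derivn k p).
Proof.
elim: k => [|k IH]; first by rewrite derive1n0.
rewrite derive1nS IH derivnS; apply/funext => t; rewrite derive1E.
exact: (@derive_val _ _ _ _ _ _ _ (is_derive_poly _ _)).
Qed.

Lemma derivn_comp_affine (p : {poly R}) (a b : R) k :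
  derivn k (p \Po (a *: 'X + b%:P)) = a ^+ k *: (derivn k p \Po (a *: 'X + b%:P)).
Proof.
elim: k => [|k IH]; first by rewrite scale1r.
rewrite !derivnS IH derivZ deriv_comp derivD derivZ derivX derivC addr0.
by rewrite -scalerAr mulr1 scalerA exprSr.
Qed.

Let aff : {poly R} := 2 *: 'X + (-1)%:P.

Let aff_horner t : aff.[t] = 2 * t - 1.
Proof. by rewrite /aff !hornerE. Qed.

(** Both sides are polynomials in t, so it is enough to compare them on ]0, 1[, where Rodrigues'
    formula holds at 2t - 1. *)
Lemma jacobi_jac t : (jacobi (al.+2%:R - 2) d%:R m : {poly R}).[2 * t - 1] = (jac R al d m).[t].
Proof.
rewrite (_ : al.+2%:R - 2 = al%:R); last by rewrite -addn2 natrD addrK.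
suff : (jacobi al%:R d%:R m : {poly R}) \Po aff = jac R al d m.
  by move=> <-; rewrite horner_comp aff_horner.
apply: poly_eq_itv => {}t /andP[t0 t1].
rewrite horner_comp aff_horner.
have s1 : -1 < 2 * t - 1 < 1 by apply/andP; split; lra.
rewrite jacobiE// /rodrigues.
pose G : {poly R} := (1 - 'X) ^+ (al + m) * (1 + 'X) ^+ (d + m).
rewrite (@derive1n_itv _ (horner G) (-1) 1 m _ _ s1); last first.
  move=> s /andP[s2 s3]; rewrite -!natrD !powR_mulrn; [|lra..].
  by rewrite /G hornerM !horner_exp !hornerE.
rewrite derive1n_horner -aff_horner -horner_comp.
(* 1 - s and 1 + s become 2(1-t) and 2t. The resulting powers of 2 cancel against the chain rule,
   the 2^m of Rodrigues' formula and the outer weights. *)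
have E : G \Po aff = (2 ^+ (al + m) * 2 ^+ (d + m)) *: jac_weight R al d m.
  rewrite /G /jac_weight rmorphM !rmorphXn /=.
  have -> : (1 - 'X : {poly R}) \Po aff = 2 *: (1 - 'X).
    rewrite comp_polyB comp_polyX comp_polyC /aff polyCN polyC1 !scaler_nat !mulr2n; ring.
  have -> : (1 + 'X : {poly R}) \Po aff = 2 *: 'X.
    rewrite comp_polyD comp_polyX comp_polyC /aff polyCN polyC1 !scaler_nat !mulr2n; ring.
  by rewrite !exprZn -scalerAl -scalerAr scalerA [_ ^+ (al + m) * 'X^_]mulrC.
have := derivn_comp_affine G 2 (-1) m; rewrite -/aff E derivnZ jac_rodrigues.
move=> /(congr1 (horner^~ t)); rewrite !hornerZ => D.
have -> : (derivn m G \Po aff).[t] = 2 ^- m * (2 ^+ m * (derivn m G \Po aff).[t]).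
  by rewrite mulKf// expf_neq0.
rewrite -D aff_horner.
have -> : 1 - (2 * t - 1) = 2 * (1 - t) by ring.
have -> : 1 + (2 * t - 1) = 2 * t by ring.
rewrite !powRN !powR_mulrn; [|lra..].
rewrite !hornerM hornerXn horner_exp hornerD hornerN hornerX hornerC.
have f0 : m`!%:R != 0 :> R by rewrite pnatr_eq0 -lt0n fact_gt0.
have t0' : t ^+ d != 0 by rewrite expf_neq0// gt_eqF.
have t1' : (1 - t) ^+ al != 0 by rewrite expf_neq0// gt_eqF// subr_gt0.
have h2 k : (2 : R) ^+ k != 0 by rewrite expf_neq0.
rewrite !exprMn !exprD.
have sg : ((-1) ^+ m * (-1) ^+ m : R) = 1 by rewrite -expr2 sqrr_sign.
transitivity (((-1) ^+ m * (-1) ^+ m) * (jac R al d m).[t]); last by rewrite sg mul1r.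
move: ((-1) ^+ m) (h2 m) (h2 al) (h2 d) {sg D}.
move: (2 ^+ m) (2 ^+ al) (2 ^+ d) (t ^+ d) ((1 - t) ^+ al) t0' t1' (m`!%:R) f0 (_.[t]).
move=> A B C E1 E2 e1 e2 K k0 J s A0 B0 C0; field.
by rewrite k0 A0 B0 C0 e1 e2.
Qed.

End jacobi_shifted.

(** * The two integrals of the statement *)

Section jacobi_integrals.
Variables (R : realType) (al p q : nat).
Let m := minn p q.
Let d := `|p - q|%N.
Let P : {poly R} := jacobi (al.+2%:R - 2) d%:R m.

Let wsqrt (t : R) : R := (1 - t) ^+ al * Num.sqrt ('X^d * (jac R al d m) ^+ 2).[t].

Let sqrt_chi (t : R) : 0 <= t ->
  Num.sqrt ('X^d * (jac R al d m) ^+ 2).[t] = Num.sqrt (t ^+ d) * `|P.[2 * t - 1]|.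
Proof.
move=> t0; rewrite /P jacobi_jac hornerM hornerXn horner_exp.
by rewrite sqrtrM ?exprn_ge0// sqrtr_sqr.
Qed.

Let powR_half (t : R) : 0 <= t -> t `^ (d%:R / 2) = Num.sqrt (t ^+ d).
Proof. by move=> t0; rewrite powRrM powR_mulrn// powR12_sqrt// exprn_ge0. Qed.

Lemma jacobi_integral01 :
  \int[lebesgue_measure]_(t in `[0, 1])
      ((1 - t) ^+ al * t `^ (d%:R / 2) * `|P.[2 * t - 1]|) =
  \int[lebesgue_measure]_(t in `[0, 1]) wsqrt t.
Proof.
apply: eq_Rintegral => t; rewrite inE /= in_itv /= => /andP[t0 _].
by rewrite /wsqrt sqrt_chi// powR_half// mulrA.
Qed.

(** Substitution s = 2t - 1. The exponent of 2 collects al from (1-s)^al, d/2 from (1+s)^(d/2), and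
    1 from ds = 2 dt. *)
Lemma jacobi_integral11 :
  \int[lebesgue_measure]_(s in `[-1, 1])
      ((1 - s) ^+ al * (1 + s) `^ (d%:R / 2) * `|P.[s]|) =
  2 `^ (al.+2%:R - 1 + d%:R / 2) * \int[lebesgue_measure]_(t in `[0, 1]) wsqrt t.
Proof.
pose G (s : R) : R := (1 - s) ^+ al * Num.sqrt ((1 + s) ^+ d) * `|P.[s]|.
pose F : R -> R := horner (2 *: 'X + (-1)%:P).
have FE t : F t = 2 * t - 1 by rewrite /F !hornerE.
have dF t : derive1 F t = 2.
  rewrite derive1E (@derive_val _ _ _ _ _ _ _ (is_derive_poly _ _)).
  by rewrite derivD derivZ derivX derivC addr0 hornerZ hornerC mulr1.
(* With the half-integer power written as the root of a polynomial, continuity holds on the whole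
   line. *)
have cG : continuous G.
  have -> : G = fun s => horner ((1 - 'X) ^+ al) s *
      (Num.sqrt \o horner ((1 + 'X) ^+ d)) s * (Num.norm \o horner P) s.
    by apply/funext => u /=; rewrite !horner_exp !hornerE.
  move=> s; apply: cvgM; first apply: cvgM.
  - exact: continuous_horner.
  - by apply: continuous_comp; [exact: continuous_horner|exact: sqrt_continuous].
  - by apply: continuous_comp; [exact: continuous_horner|exact: norm_continuous].
have sub : (\int[lebesgue_measure]_(s in `[F 0%R, F 1%R]) (G s)%:E =
    \int[lebesgue_measure]_(t in `[0%R, 1%R]) (((G \o F) * derive1 F)%R t)%:E)%E.
  apply: integration_by_substitution_increasing.
  - exact: ler01.
  - by move=> u v _ _ uv; rewrite !FE; lra.
  - move=> u _; rewrite (_ : derive1 F = cst 2); last by apply/funext => v; exact: dF.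
    exact: cst_continuous.
  - rewrite (_ : derive1 F = cst 2); last by apply/funext => v; exact: dF.
    exact: is_cvg_cst.
  - rewrite (_ : derive1 F = cst 2); last by apply/funext => v; exact: dF.
    exact: is_cvg_cst.
  - split.
    + by move=> u _; exact: (@ex_derive _ _ _ _ _ _ _ (is_derive_poly _ _)).
    + by apply: cvg_at_right_filter; exact: continuous_horner.
    + by apply: cvg_at_left_filter; exact: continuous_horner.
  - exact: continuous_subspaceT.
rewrite (_ : `[-1, 1]%classic = `[F 0, F 1]%classic); last first.
  by rewrite !FE mulr0 mulr1 sub0r (_ : 2 - 1 = 1)//; ring.
rewrite (@eq_Rintegral _ _ _ lebesgue_measure _ G); last first.
  move=> s; rewrite !FE inE /= in_itv /= => /andP[s0 _].
  by rewrite /G powR_half//; lra.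
rewrite /Rintegral sub -/(Rintegral _ _ _).
rewrite -RintegralZl//; last exact: integrable_wsqrt.
apply: eq_Rintegral => t; rewrite inE /= in_itv /= => /andP[t0 t1].
rewrite mulrfctE dF /= FE /G /wsqrt sqrt_chi//.
have -> : 1 - (2 * t - 1) = 2 * (1 - t) by ring.
have -> : 1 + (2 * t - 1) = 2 * t by ring.
rewrite !exprMn sqrtrM ?exprn_ge0//.
have -> : (2 : R) `^ (al.+2%:R - 1 + d%:R / 2) = 2 ^+ al * 2 * Num.sqrt (2 ^+ d).
  rewrite (_ : al.+2%:R - 1 = al.+1%:R); last by rewrite -[in LHS]addn1 natrD addrK.
  rewrite powRD; last by rewrite pnatr_eq0 implybT.
  by rewrite powR_half// powR_mulrn// exprSr.
ring.
Qed.

End jacobi_integrals.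

(* The source has the exponent n + |p - q| / 2 of 2 in the second formula; the
   substitution s = 2 t - 1 gives n - 1 + |p - q| / 2, and for p = q = 0 the
   former would make the projection constant of the scalars 1/2. *)
Theorem theorem5p2 (R : realType) (n p q : nat) (hn : (2 <= n)%N) :
  let d := `|p - q|%N in
  let P : {poly R} := jacobi (n%:R - 2) d%:R (minn p q) in
  let c : R := (n%:R + p%:R + q%:R - 1) *
    (Gamma (n%:R + (maxn p q)%:R - 1) /
     (Gamma (n%:R - 1) * Gamma (1 + (maxn p q)%:R))) in
  projection_constant (Hpq R n p q) =
    (c * \int[lebesgue_measure]_(t in `[0, 1])
      ((1 - t) ^+ (n - 2) * t `^ (d%:R / 2) * `|P.[2 * t - 1]|))%:E /\
  projection_constant (Hpq R n p q) =
    (c / 2 `^ (n%:R - 1 + d%:R / 2) *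
     \int[lebesgue_measure]_(s in `[-1, 1])
      ((1 - s) ^+ (n - 2) * (1 + s) `^ (d%:R / 2) * `|P.[s]|))%:E.

Proof.
case: n hn => [|[|al]]// _ d P c; rewrite projection_constant_zonal.
(* The Gamma values are factorials, with n - 1 = al + 1; the factor [al.+1] comes from the density
   of t. *)
have cE : c = zkernel_const R al p q * al.+1%:R.
  rewrite /c.
  rewrite (_ : al.+2%:R + (maxn p q)%:R - 1 = (al + maxn p q).+1%:R); last first.
    by rewrite -natrD -[in LHS]addn1 addSn addSn addn1 -[in LHS]addn1 natrD addrK.
  rewrite (_ : al.+2%:R - 1 = al.+1%:R); last by rewrite -[in LHS]addn1 natrD addrK.
  rewrite (_ : 1 + (maxn p q)%:R = (maxn p q).+1%:R); last by rewrite -add1n natrD.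
  rewrite !Gamma_nat /zkernel_const.
  have -> : al.+2%:R + p%:R + q%:R - 1 = (al.+2 + p + q - 1)%:R :> R.
    by rewrite natrB ?natrD// !addSn.
  have f0 k : k`!%:R != 0 :> R by rewrite pnatr_eq0 -lt0n fact_gt0.
  have a0 : al.+1%:R != 0 :> R by rewrite pnatr_eq0.
  rewrite factS [(maxn p q + al)%N]addnC !natrM.
  move: (f0 al) (f0 (maxn p q)) a0 ((al + maxn p q)`!%:R : R) (_%:R : R).
  move: (al`!%:R : R) ((maxn p q)`!%:R : R) (al.+1%:R : R) => u v w u0 v0 w0 x y.
  by field; rewrite u0 v0 w0.
split; congr (_%:E).
  by rewrite /P /d subn2 jacobi_integral01 cE.
rewrite /P /d subn2 jacobi_integral11 cE mulrA divfK//.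
Qed.
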